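(* Let $n\ge1$, $1\le k\le n$, and let $\Omega\subset\mathbb{R}^{n+1}$ be a bounded convex domain whose boundary $\Sigma=\partial\Omega$ is a smooth closed convex hypersurface. Suppose $0$ is the center of the circumscribed sphere of $\Sigma$, and let $r$ denote the circumradius. Then: (i) For $0<m\le1$, $$I_k^{m-1}\cdot\frac{I_{k-1}^2-I_kI_{k-2}}{I_k^m+I_{k-1}^m}+\frac{2+(2-m)r^m}{2(1+r^m)^2}\,\delta_{2,k}\left(\Omega,B_0\left(\frac{I_{k-1}}{I_k}\right)\right)^2+\frac{m}{2(1+r^m)^2r^{1-m}}\,\delta_{2,k-1}\left(\Omega,B_0\left(\frac{I_{k-2}}{I_{k-1}}\right)\right)^2\le\frac{1}{k\binom{n}{k}}\int_\Sigma\frac{T_{k-1}\circ A(X^T,X^T)}{1+u^m}\,d\mu .$$ (ii) For $1<m\le2$, $$I_k^{m-1}\cdot\frac{I_{k-1}^2-I_kI_{k-2}}{I_k^m+I_{k-1}^m}+\frac{2+(2-m)r^m}{2(1+r^m)^2}\,\delta_{2,k}\left(\Omega,B_0\left(\frac{I_{k-1}}{I_k}\right)\right)^2\le\frac{1}{k\binom{n}{k}}\int_\Sigma\frac{T_{k-1}\circ A(X^T,X^T)}{1+u^m}\,d\mu .$$ If $H_k>0$ on $\Sigma$, then equality holds in the inequality of (i), respectively of (ii), if and only if $\Sigma$ is a sphere centered at the origin.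
   Context: $X$ is the position vector, $\nu$ the outward unit normal of $\Sigma$, $X^T$ the component of $X$ tangential to $\Sigma$, $u=\langle X,\nu\rangle$ the support function, $d\mu$ the induced area measure. The circumscribed sphere is the smallest sphere enclosing $\Sigma$, and its radius is the circumradius. $A$ is the shape operator with respect to $\nu$ (positive for round spheres), with eigenvalues the principal curvatures $\kappa_1,\dots,\kappa_n$. $H_j=\binom{n}{j}^{-1}\sigma_j(\kappa)$ with $\sigma_j$ the $j$-th elementary symmetric polynomial ($H_0=1$). $I_{-1}=(n+1)|\Omega|$ and $I_j=\int_\Sigma H_j\,d\mu$ for $0\le j\le n$. The Newton tensors are $T_0=\mathrm{Id}$, $T_j=\sigma_j(\kappa)\,\mathrm{Id}-A\circ T_{j-1}$, and $T_{k-1}\circ A(Y,Y)=\langle T_{k-1}(A(Y)),Y\rangle$. $B_0(s)$ is the ball of radius $s$ centered at the origin, and $\delta_{2,j}(\Omega,B_0(s))=\left(\int_\Sigma(u-s)^2H_j\,d\mu\right)^{1/2}$. *)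

(* Defs.v *)
From HB Require Import structures.
From mathcomp Require Import all_boot all_order all_algebra.
From mathcomp Require Import all_classical all_reals all_analysis.
Set Implicit Arguments.
Unset Strict Implicit.
Unset Printing Implicit Defensive.
Import Order.TTheory GRing.Theory Num.Theory.
Import numFieldNormedType.Exports.
Local Open Scope classical_set_scope.
Local Open Scope ring_scope.

(* The norm carried by 'rV[R]_d in the library is the sup norm; it is only used
   for the topology (and boundedness). Lengths and angles come from [dotv]. *)
Section euclidean.
Context {R : realType} {d : nat}.
Implicit Types x y c : 'rV[R]_d.

Definition dotv x y : R := \sum_(i < d) x ord0 i * y ord0 i.

Definition enorm x : R := Num.sqrt (dotv x x).

Definition esphere c (s : R) : set 'rV[R]_d := [set x | enorm (x - c) = s].

Definition circumscribed (S : set 'rV[R]_d) c (r : R) : Prop :=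
  (forall x, S x -> enorm (x - c) <= r) /\
  (forall c' (r' : R), (forall x, S x -> enorm (x - c') <= r') -> r <= r').

End euclidean.

Definition boundary {T : topologicalType} (A : set T) : set T :=
  closure A `\` interior A.

(* Class C^k through iterated directional derivatives; on finite-dimensional
   spaces this is the usual notion. *)
Section smoothness.
Context {R : realType} {V W : normedModType R}.

Fixpoint Ck (k : nat) (U : set V) (f : V -> W) : Prop :=
  (forall x, U x -> {for x, continuous f}) /\
  match k with
  | 0 => True
  | k'.+1 => forall v : V,
      (forall x, U x -> derivable f x v) /\ Ck k' U (fun x => 'D_v f x)
  end.

Definition smooth_on (U : set V) (f : V -> W) : Prop := forall k, Ck k U f.

End smoothness.

Notation borelType T := (g_sigma_algebraType (@open T)).

(* Lebesgue integral over R^d of a nonnegative Borel function, as an iterated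
   integral (Tonelli); the library has no Lebesgue measure on R^d. *)
Fixpoint lebesgue_int {R : realType} (d : nat) : ('rV[R]_d -> \bar R) -> \bar R :=
  match d with
  | 0 => fun f => f 0
  | d'.+1 => fun f =>
      (\int[lebesgue_measure]_(t in [set: R])
         lebesgue_int (fun x : 'rV[R]_d' => f (row_mx t%:M x)))%E
  end.

Definition volume {R : realType} {d : nat} (A : set 'rV[R]_d) : R :=
  fine (lebesgue_int (fun x => (\1_A x)%:E)).

Section hypersurface.
Context {R : realType} {n : nat}.
Local Notation E := 'rV[R]_n.+1.
Implicit Types (S Om : set E) (p v : E).

Definition local_equation S p (V : set E) (rho : E -> R) : Prop :=
  [/\ open V, V p, smooth_on V rho,
      S `&` V = [set x | rho x = 0] `&` V &
      forall x, (S `&` V) x -> exists v, 'D_v rho x != 0].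

Definition smooth_hypersurface S : Prop :=
  forall p, S p -> exists V rho, local_equation S p V rho.

(* T_p S = ker (d rho)_p for any local equation rho of S at p. *)
Definition tangent S p v : Prop :=
  exists V rho, local_equation S p V rho /\ 'D_v rho p = 0.

(* The induced area measure is the unique Borel measure on S given in every
   regular parametrization phi by the density sqrt (det (g_ij)), where
   g_ij = <d_i phi, d_j phi>. Only its values on subsets of S are prescribed. *)
Definition area_measure S (mu : {measure set (borelType E) -> \bar R}) : Prop :=
  forall (U : set 'rV[R]_n) (phi : 'rV[R]_n -> E),
    open U -> smooth_on U phi ->
    (forall x y, U x -> U y -> phi x = phi y -> x = y) ->
    (forall x, U x -> row_free ('J phi x)) ->
    phi @` U `<=` S ->
    forall B : set 'rV[R]_n, (<<s @open 'rV[R]_n >>) B -> B `<=` U ->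
      mu (phi @` B) =
      lebesgue_int (fun x =>
        (\1_B x * Num.sqrt (\det ('J phi x *m ('J phi x)^T)))%:E).

Section domain.
Variable Om : set E.
Local Notation Sigma := (boundary Om).

Definition is_outer_unit_normal p v : Prop :=
  [/\ dotv v v = 1, (forall w, tangent Sigma p w -> dotv v w = 0) &
      \forall t \near 0^'+, ~ closure Om (p + t *: v)].

Definition outer_normal p : E :=
  xget 0 [set v | is_outer_unit_normal p v].

(* Operators on T_p Sigma are represented by matrices acting on row vectors of
   the ambient space, on the right. The shape operator w |-> D_w nu, computed
   with any local smooth extension of nu, is extended by 0 on the normal line;
   it is positive on round spheres. *)
Definition is_shape_operator p (A : 'M[R]_n.+1) : Prop :=
  outer_normal p *m A = 0 /\
  exists (V : set E) (N : E -> E),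
    [/\ open V, V p, smooth_on V N, {in Sigma `&` V, N =1 outer_normal} &
        forall w, tangent Sigma p w -> w *m A = 'D_w N p].

Definition shape_op p : 'M[R]_n.+1 := xget 0 [set A | is_shape_operator p A].

(* Eigenvalues of the shape operator on T_p Sigma, with multiplicity: the rows
   of F are an orthonormal basis of principal directions. *)
Definition is_principal_curvatures p (kap : 'rV[R]_n) : Prop :=
  exists F : 'M[R]_(n, n.+1),
    [/\ F *m F^T = 1%:M, (forall i, tangent Sigma p (row i F)) &
        forall i, row i F *m shape_op p = kap ord0 i *: row i F].

Definition principal_curv p : 'rV[R]_n :=
  xget 0 [set kap | is_principal_curvatures p kap].

Definition sigma_curv (j : nat) p : R :=
  \sum_(I : {set 'I_n} | #|I| == j) \prod_(i in I) principal_curv p ord0 i.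

Definition mean_curv (j : nat) p : R := sigma_curv j p / ('C(n, j))%:R.

(* Since vectors are rows, A \o T is represented by T *m A. *)
Fixpoint newton (j : nat) p : 'M[R]_n.+1 :=
  match j with
  | 0 => 1%:M
  | j'.+1 => (sigma_curv j'.+1 p)%:M - newton j' p *m shape_op p
  end.

Definition support_fun p : R := dotv p (outer_normal p).

Definition tangential p : E := p - support_fun p *: outer_normal p.

Definition newton_shape_form (j : nat) p (Y : E) : R :=
  dotv (Y *m shape_op p *m newton j p) Y.

Section integrals.
Variable mu : {measure set (borelType E) -> \bar R}.

(* I_{-1} = (n+1)|Omega|; indices below -1 are never used. *)
Definition Icurv (j : int) : R :=
  match j with
  | Posz i => Rintegral mu Sigma (mean_curv i)
  | Negz _ => n.+1%:R * volume Om
  end.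

(* delta_{2,j}(Omega, B_0(s)) *)
Definition delta2 (j : nat) (s : R) : R :=
  Num.sqrt (Rintegral mu Sigma (fun p => (support_fun p - s) ^+ 2 * mean_curv j p)).

End integrals.
End domain.
End hypersurface.

(* Main.v *)
(* The smallest sphere enclosing Sigma is centered at 0, so 0 lies in Omega; the gauge g of Omega is
   then smooth off the origin, and the unit normal nu, the shape operator A and the support function
   u = 1 / |grad g| extend to homogeneous fields on the punctured space. The rows of T_{k-1} are
   divergence free, so integrating the divergence of bump(g) psi(u) T_{k-1} nu over the whole space in
   polar coordinates dx = t^n dt u dmu yields
     \int psi(u) (u H_k - H_{k-1}) dmu
       = (k C(n,k))^-1 \int psi'(u) <T_{k-1} A X^T, X^T> dmu.
   Take psi = G with G' = 1 / (1 + t^m). On (0, r], which contains the values of u, the second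
   derivative of t G(t) is at least its value at r, and for m <= 1 that of -G is at least
   m / ((1 + r^m)^2 r^(1-m)). The second-order Jensen inequalities at the means I_{k-1} / I_k and
   I_{k-2} / I_{k-1} produce the two delta terms, and concavity of G between these two means produces
   the first term. Equality forces u to be constant, say a; then |X| >= a on Sigma, with equality
   at the farthest point, where X is normal, so Sigma is the sphere of radius a. *)

From HB Require Import structures.
Require Import Defs.
From mathcomp Require Import all_boot all_order all_algebra.
From mathcomp Require Import all_classical all_reals all_analysis.
From mathcomp Require Import measurable_realfun ring lra.
Set Implicit Arguments.
Unset Strict Implicit.
Unset Printing Implicit Defensive.
Import Order.TTheory GRing.Theory Num.Theory.
Import numFieldNormedType.Exports.
Import HBNNSimple.
Local Open Scope classical_set_scope.
Local Open Scope ring_scope.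

(** * Lebesgue measure on row vectors *)

(** The area measure is prescribed only through parametrizations, and the normal, the shape operator
    and the principal curvatures are choices made by [xget]; two reductions deal with this.
    Geometry: each field is computed from the gauge as an explicit ambient field and then shown to
    be what the choice must return. The ambient derivative [weingarten] of the normal is in general
    not symmetric, but it annihilates the position vector, so its eigenvalues are 0 and the
    principal curvatures, and its Newton tensors carry the same sigma_j. Measure: the charts are
    central projections of the hyperplanes x_c = 1 and x_c = -1, which splits Lebesgue measure into
    area and ray integrals. Integration by parts then concerns only compactly supported functions,
    one coordinate at a time; the cutoff removes the singularity at the origin and, by homogeneity,
    leaves just a positive common factor. For m > 1 the function -G'' = m t^(m-1) / (1 + t^m)^2
    tends to 0 at 0, so only convexity of -G remains and the third term disappears. Strictness is
    drawn from t G(t) alone, which is why positivity of H_k settles the equality case. *)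

Section borel_row_vectors.
Context {R : realType}.

Lemma open_boxP (d : nat) (U : set 'rV[R]_d) x : open U -> U x ->
  exists2 e : R, 0 < e & forall y : 'rV[R]_d, (forall i, `|x 0 i - y 0 i| < e) -> U y.
Proof.
move=> oU Ux; have /nbhs_ballP[e /= e0 eU] : nbhs x U by exact: open_nbhs_nbhs.
exists e => // y xy; apply: eU; split => // i j; rewrite (ord1 i).
exact: xy.
Qed.

(** The cubes with rational centre and radius [1 / (k + 1)] form a countable family, and an open set
    is the union of those it contains; their preimages are finite intersections of coordinate
    conditions. *)
Lemma borel_coord (d : nat) (dT : measure_display) (T : measurableType dT)
    (f : T -> borelType 'rV[R]_d) :
  (forall i, measurable_fun setT (fun x => f x 0 i)) -> measurable_fun setT f.
Proof.
move=> mf; apply: (@measurability _ _ T (borelType 'rV[R]_d) setT f (@open 'rV[R]_d)) => //.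
move=> _ [U oU <-]; rewrite setTI.
pose box (z : 'rV[rat]_d * nat) : set 'rV[R]_d :=
  [set y | forall i, `|ratr (z.1 0 i) - y 0 i| < z.2.+1%:R^-1].
have -> : f @^-1` U = \bigcup_z (if `[< box z `<=` U >] then f @^-1` box z else set0).
  apply/seteqP; split => [x Ufx|x [z _]]; last first.
    by case: asboolP => // zU; exact: zU.
  have [e e0 eU] := open_boxP oU Ufx.
  have [k ke] : exists k : nat, k.+1%:R^-1 < e / 2.
    have := @near_infty_natSinv_lt R (PosNum (divr_gt0 e0 (ltr0n _ 2))).
    by case=> N _ /(_ N (leqnn N)) /= NN; exists N.
  have [q hq] : exists q : 'rV[rat]_d, forall i, `|ratr (q 0 i) - f x 0 i| < k.+1%:R^-1.
    have k0 : (0 : R) < k.+1%:R^-1 by rewrite invr_gt0.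
    have /choice[q hq] : forall i, exists q : rat, `|ratr q - f x 0 i| < k.+1%:R^-1.
      move=> i; have : f x 0 i - k.+1%:R^-1 < f x 0 i + k.+1%:R^-1 by rewrite ltrD2l gtrN.
      move/rat_in_itvoo => [q]; rewrite in_itv /= => /andP[q1 q2]; exists q.
      by rewrite ltr_distl; apply/andP; split.
    by exists (\row_i q i) => i; rewrite mxE.
  exists (q, k) => //; case: asboolP => // -[] y qy; apply: eU => i.
  rewrite -(subrKA (ratr (q 0 i))); apply: le_lt_trans (ler_normD _ _) _.
  rewrite (splitr e) ltrD//; first by rewrite distrC (lt_trans (hq i)).
  by rewrite (lt_trans (qy i)).
apply: countable_bigcupT_measurable; first exact: countableP.
move=> z; case: asboolP => // _.
have -> : f @^-1` box z = \bigcap_(i in [set: 'I_d])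
    (fun x => f x 0 i) @^-1` [set t | `|ratr (z.1 0 i) - t| < z.2.+1%:R^-1].
  by apply/seteqP; split => [x /= xz i _|x /= xz i]; apply: xz.
apply: fin_bigcap_measurable => // i _; rewrite -[X in measurable X]setTI.
apply: mf => //; apply: open_measurable.
exact: (@ball_open _ R^o).
Qed.

Lemma measurable_open (d : nat) (U : set 'rV[R]_d) :
  open U -> measurable (U : set (borelType 'rV[R]_d)).
Proof. exact: sub_sigma_algebra. Qed.

Lemma measurable_closed (d : nat) (U : set 'rV[R]_d) :
  closed U -> measurable (U : set (borelType 'rV[R]_d)).
Proof.
move=> cU; rewrite -[X in measurable X]setCK; apply: measurableC.
by apply: measurable_open; exact: closed_openC.
Qed.

Lemma continuous_on_measurable (d : nat) (A : set 'rV[R]_d) (f : 'rV[R]_d -> R) :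
  open A -> (forall x, A x -> {for x, continuous f}) ->
  measurable_fun (A : set (borelType 'rV[R]_d)) (f : borelType 'rV[R]_d -> R).
Proof.
move=> oA cf; apply: (measurability _ (RGenOInfty.measurableE R)) => //.
move=> _ [_ [a ->] <-]; apply: measurable_open; rewrite openE => x /= [Ax fx].
move: fx; rewrite in_itv /= andbT => fx.
pose x0 : 'rV[R]_d := x.
have h : \forall y \near x0, a < f y.
  exact: (@cvgr_gt R _ (nbhs x0) _ f (f x0) (cf x0 Ax) a fx).
have h' := (open_nbhs_nbhs (conj oA Ax)).

near=> y; split; first by near: y.
by rewrite /= in_itv /= andbT; near: y.
Unshelve. all: by end_near. Qed.

Lemma continuous_rV_measurable (d : nat) (f : 'rV[R]_d -> R) :
  continuous f -> measurable_fun setT (f : borelType 'rV[R]_d -> R).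
Proof. move=> cf; apply: (@continuous_on_measurable d setT f) => //; first exact: openT.
by move=> x _; exact: cf. Qed.

Lemma measurable_coord (d : nat) i :
  measurable_fun setT (fun x : borelType 'rV[R]_d => x 0 i).
Proof. by apply: continuous_rV_measurable; exact: coord_continuous. Qed.

(** Same term as in the recursion of [lebesgue_int], so that the iterated integral unfolds directly
    to [consr]. *)
Definition consr (d : nat) (t : R) (x : 'rV[R]_d) : 'rV[R]_d.+1 := row_mx t%:M x.

Lemma consr0 (d : nat) (t : R) (x : 'rV[R]_d) j : consr t x j ord0 = t.
Proof.
rewrite /consr (_ : ord0 = lshift d (ord0 : 'I_1)); last exact: val_inj.
by rewrite (@row_mxEl _ 1 1 d) ord1 mxE eqxx.
Qed.

Lemma consrS (d : nat) (t : R) (x : 'rV[R]_d) j i :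
  consr t x j (lift ord0 i) = x j i.
Proof.
rewrite /consr (_ : lift ord0 i = rshift 1 i); last exact: val_inj.
by rewrite (@row_mxEr _ 1 1 d).
Qed.

Definition behead_rV (d : nat) (x : 'rV[R]_d.+1) : 'rV[R]_d :=
  \row_i x ord0 (lift ord0 i).

Lemma behead_consr (d : nat) (t : R) (x : 'rV[R]_d) : behead_rV (consr t x) = x.
Proof. by apply/rowP => i; rewrite mxE consrS. Qed.

Lemma measurable_consr (d : nat) :
  measurable_fun setT (fun z : measurableTypeR R * borelType 'rV[R]_d =>
    consr z.1 z.2 : borelType 'rV[R]_d.+1).
Proof.
apply: borel_coord => i; case: (unliftP ord0 i) => [j ->|->].
  apply: (eq_measurable_fun (fun z : measurableTypeR R * borelType 'rV[R]_d => z.2 0 j)) => [z _|].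
    by rewrite consrS.
  apply: (measurableT_comp (measurable_coord j)); exact: measurable_snd.
apply: (eq_measurable_fun fst) => [z _|]; last exact: measurable_fst.
by rewrite consr0.
Qed.

Section lebesgue_successor.
Context (d : nat)
  (L : {sigma_finite_measure set (borelType 'rV[R]_d) -> \bar R}).
Local Open Scope ereal_scope.

Definition leb_succ : set (borelType 'rV[R]_d.+1) -> \bar R :=
  pushforward (@lebesgue_measure R \x L)
    (fun z => consr z.1 z.2 : borelType 'rV[R]_d.+1).

HB.instance Definition _ := Measure.copy leb_succ
  (measure_function_pushforward__canonical__measure_function_Measure
    (@lebesgue_measure R \x L) (@measurable_consr d)).

Let leb_succ_sigma_finite : sigma_finite setT leb_succ.
Proof.
have [F UF Foo] : sigma_finite setT (@lebesgue_measure R \x L).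
  have /sigma_finiteP[F [UF ndF Foo]] := sigma_finiteT (@lebesgue_measure R).
  have /sigma_finiteP[G [UG ndG Goo]] := sigma_finiteT L.
  exists (fun k => F k `*` G k) => [|k]; last first.
    have [mF Fk] := Foo k; have [mG Gk] := Goo k; split; first exact: measurableX.
    by rewrite product_measure1E// lte_mul_pinfty// ge0_fin_numE.
  apply/seteqP; split => // -[x y] _.
  have [i _ Fx] : (\bigcup_i F i) x by rewrite -UF.
  have [j _ Gy] : (\bigcup_i G i) y by rewrite -UG.
  exists (maxn i j) => //; split => /=.
    by move: x Fx {UF}; apply/subsetPset/ndF/leq_maxl.
  by move: y Gy {UG}; apply/subsetPset/ndG/leq_maxr.
(* [sp] is a measurable inverse of [consr]; it transports the exhausting rectangles of the product
   measure. *)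
pose sp (x : borelType 'rV[R]_d.+1) : R * borelType 'rV[R]_d :=
  (x ord0 ord0, behead_rV x).
have spK z : sp (consr z.1 z.2) = z.
  by case: z => t x; rewrite /sp /= consr0 behead_consr.
have msp : measurable_fun setT sp.
  apply: measurable_fun_pair; first exact: measurable_coord.
  apply: borel_coord => i.
  apply: (eq_measurable_fun (fun x : borelType 'rV[R]_d.+1 => x ord0 (lift ord0 i))).
    by move=> x _; rewrite mxE.
  exact: measurable_coord.
exists (fun k => sp @^-1` F k).
  by rewrite -preimage_bigcup -UF.
move=> k; have [mF Fk] := Foo k; split.
  by rewrite -[X in measurable X]setTI; exact: msp.
rewrite /leb_succ /pushforward.
rewrite (_ : _ @^-1` _ = F k)//.
by apply/seteqP; split => z /=; rewrite spK.
Qed.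

HB.instance Definition _ := Measure_isSigmaFinite.Build _ _ _ leb_succ leb_succ_sigma_finite.

Definition leb_succ_sf : {sigma_finite_measure set (borelType 'rV[R]_d.+1) -> \bar R} := leb_succ.

End lebesgue_successor.

(** A genuine measure behind the iterated integral: it agrees with [lebesgue_int] on nonnegative
    Borel functions ([lebesgue_intE]) and gives access to signed integrals, Fubini and monotone
    convergence. *)
Fixpoint leb (d : nat) : {sigma_finite_measure set (borelType 'rV[R]_d) -> \bar R} :=
  match d with
  | 0 => dirac (0 : borelType 'rV[R]_0)
  | d'.+1 => leb_succ_sf (leb d')
  end.

Local Open Scope ereal_scope.

Lemma measurable_consr2 (d : nat) (t : R) :
  measurable_fun setT (fun x : borelType 'rV[R]_d =>
    consr t x : borelType 'rV[R]_d.+1).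
Proof.
exact: (measurableT_comp (@measurable_consr d) (pair1_measurable t)).
Qed.

Lemma leb_succ_integral (d : nat) (f : borelType 'rV[R]_d.+1 -> \bar R) :
  \int[leb d.+1]_x f x =
  \int[pushforward (@lebesgue_measure R \x leb d)
    (fun z : measurableTypeR R * borelType 'rV[R]_d => consr z.1 z.2 : borelType 'rV[R]_d.+1)]_x f x.
Proof. exact: erefl. Qed.

Lemma leb_tonelli1 (d : nat) (f : borelType 'rV[R]_d.+1 -> \bar R) :
  measurable_fun setT f -> (forall x, 0 <= f x) ->
  \int[leb d.+1]_x f x = \int[lebesgue_measure]_t \int[leb d]_x f (consr t x).
Proof.
move=> mf f0; rewrite leb_succ_integral.
have mg := measurableT_comp mf (@measurable_consr d).
rewrite -(@fubini_tonelli1 _ _ _ _ _ (@lebesgue_measure R) (leb d)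
  (fun z => f (consr z.1 z.2)))//.
have := @ge0_integral_pushforward _ _ _ _ R _ (@measurable_consr d)
  (@lebesgue_measure R \x leb d) setT f measurableT mf.
by rewrite preimage_setT; apply.
Qed.

Lemma leb_tonelli2 (d : nat) (f : borelType 'rV[R]_d.+1 -> \bar R) :
  measurable_fun setT f -> (forall x, 0 <= f x) ->
  \int[leb d.+1]_x f x = \int[leb d]_x \int[lebesgue_measure]_t f (consr t x).
Proof.
move=> mf f0; rewrite leb_tonelli1//.
apply: (@fubini_tonelli _ _ _ _ _ (@lebesgue_measure R) (leb d)
  (fun z => f (consr z.1 z.2))) => //.
exact: (measurableT_comp mf (@measurable_consr d)).
Qed.

Lemma lebesgue_intE (d : nat) (f : borelType 'rV[R]_d -> \bar R) :
  measurable_fun setT f -> (forall x, 0 <= f x) ->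
  lebesgue_int f = \int[leb d]_x f x.
Proof.
elim: d f => [|d IH] f mf f0.
  by rewrite /= integral_dirac// diracT mul1e.
rewrite leb_tonelli1//; apply: eq_integral => t _; apply: IH => //.
exact: (measurableT_comp mf (@measurable_consr2 d t)).
Qed.

Definition cube (d : nat) (c : 'rV[R]_d) (M : R) : set (borelType 'rV[R]_d) :=
  [set x : 'rV[R]_d | forall i, (`|x ord0 i - c ord0 i| <= M)%R].

Lemma measurable_cube (d : nat) (c : 'rV[R]_d) (M : R) : measurable (cube c M).
Proof.
rewrite (_ : cube c M = \bigcap_(i in [set: 'I_d])
    [set x : borelType 'rV[R]_d | (`|x ord0 i - c ord0 i| <= M)%R]).
  apply: fin_bigcap_measurable => // i _; rewrite -[X in measurable X]setTI.
  apply: (@measurable_coord d i measurableT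
    [set t : R | (`|t - c ord0 i| <= M)%R]).
  rewrite (_ : [set x | _] = `[(c ord0 i - M)%R, (c ord0 i + M)%R]%classic)//.
  by apply/seteqP; split => x /=; rewrite in_itv /= ler_distl.
by apply/seteqP; split => [x /= xz i _|x /= xz i]; apply: xz.
Qed.

Lemma leb_cube (d : nat) (c : 'rV[R]_d) (M : R) : (0 <= M)%R ->
  leb d (cube c M) = ((M + M) ^+ d)%:E.
Proof.
move=> M0; elim: d c => [|d IH] c.
  by rewrite /= expr0 diracE mem_set// => -[].
rewrite /= /leb_succ /pushforward.
set c0 := c ord0 ord0.
rewrite (_ : _ @^-1` _ = `[(c0 - M)%R, (c0 + M)%R]%classic `*` cube (behead_rV c) M).
  rewrite product_measure1E//; last exact: measurable_cube.
  rewrite [X in X * _](lebesgue_measure_itv `[(c0 - M)%R, (c0 + M)%R]) /= lte_fin.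
  have [M00|] := ltP.
    by rewrite -EFinB [X in _ * X]IH -EFinM exprS; congr (_ * _)%:E; lra.
  move=> MN; have -> : M = 0%R by lra.
  by rewrite mul0e addr0 exprS mul0r.
apply/seteqP; split => -[t x] /=; rewrite in_itv /= -ler_distl.
  move=> h; split=> [|i].
    by have := h ord0; rewrite consr0.
  by have := h (lift ord0 i); rewrite consrS mxE.
move=> [t12 h] i; case: (unliftP ord0 i) => [j ->|->].
  by have := h j; rewrite consrS mxE.
by rewrite consr0.
Qed.

Definition box (d : nat) (M : R) : set (borelType 'rV[R]_d) :=
  [set x : 'rV[R]_d | forall i, (`|x ord0 i| <= M)%R].

Lemma box_cube (d : nat) (M : R) : @box d M = cube 0 M.
Proof. by apply/seteqP; split => x h i; have := h i; rewrite mxE subr0. Qed.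

Lemma measurable_box (d : nat) (M : R) : measurable (@box d M).
Proof. by rewrite box_cube; exact: measurable_cube. Qed.

Lemma leb_box (d : nat) (M : R) : (0 <= M)%R ->
  leb d (@box d M) = ((M + M) ^+ d)%:E.
Proof. by move=> M0; rewrite box_cube leb_cube. Qed.

End borel_row_vectors.
#[global] Opaque leb.

Section leb_fubini.
Context {R : realType} (d : nat).
Local Open Scope ereal_scope.
Local Notation m1 := (@lebesgue_measure R).
Local Notation m2 := (@leb R d).

Lemma integrable_consr (f : borelType 'rV[R]_d.+1 -> \bar R) :
  (@leb R d.+1).-integrable setT f ->
  (m1 \x m2).-integrable setT
    (fun z : measurableTypeR R * borelType 'rV[R]_d => f (consr z.1 z.2)).
Proof.
move=> /integrableP[mf fi]; apply/integrable12ltyP.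
  exact: (measurableT_comp mf (@measurable_consr R d)).
by move: fi; rewrite leb_tonelli1//; exact: measurableT_comp.
Qed.

Lemma leb_fubini_prod (f : borelType 'rV[R]_d.+1 -> \bar R) :
  (@leb R d.+1).-integrable setT f ->
  \int[@leb R d.+1]_x f x = \int[m1 \x m2]_z f (consr z.1 z.2).
Proof.
move=> fi; rewrite leb_succ_integral.
have := @integral_pushforward _ _ _ _ R _ (@measurable_consr R d)
  (m1 \x m2) setT f (measurable_int _ fi) _ measurableT.
by rewrite preimage_setT; apply; exact: integrable_consr.
Qed.

Lemma leb_fubini1 (f : borelType 'rV[R]_d.+1 -> \bar R) :
  (@leb R d.+1).-integrable setT f ->
  \int[@leb R d.+1]_x f x = \int[m1]_t \int[m2]_x f (consr t x).
Proof.
by move=> fi; rewrite leb_fubini_prod// -integral12_prod_meas1//; exact: integrable_consr.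
Qed.

Lemma leb_fubini2 (f : borelType 'rV[R]_d.+1 -> \bar R) :
  (@leb R d.+1).-integrable setT f ->
  \int[@leb R d.+1]_x f x = \int[m2]_x \int[m1]_t f (consr t x).
Proof.
by move=> fi; rewrite leb_fubini_prod// -integral21_prod_meas1//; exact: integrable_consr.
Qed.

End leb_fubini.

(** * Compactly supported functions and integration by parts *)

Section compact_support.
Context {R : realType}.

(** Both difference quotients are the same function of [h], so this chain rule holds for merely
    directional derivatives. *)
Lemma is_derive_affine (V W U : normedModType R) (phi : V -> W) (f : W -> U)
    (x v : V) (w : W) (D : U) : (forall h : R, phi (h *: v + x) = h *: w + phi x) ->
  is_derive (phi x) w f D -> is_derive x v (f \o phi) D.
Proof.
move=> phiE [df <-].
have E : (fun h : R => h^-1 *: (((f \o phi) \o shift x) (h *: v) - (f \o phi) x)) =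
         (fun h : R => h^-1 *: ((f \o shift (phi x)) (h *: w) - f (phi x))).
  by apply/funext => h /=; rewrite phiE.
by split; rewrite /derivable /derive E.
Qed.

Lemma cvg_rV (T : Type) (F : set_system T) (FF : Filter F) (d : nat)
    (f : T -> 'rV[R]_d) (l : 'rV[R]_d) :
  (forall i, f x ord0 i @[x --> F] --> l ord0 i) -> f x @[x --> F] --> l.
Proof.
move=> fl; apply/cvgrPdist_le => /= e e0.
have h : \forall x \near F, forall i, `|l ord0 i - f x ord0 i| <= e.
  by apply: filter_forall => i; exact: (cvgrPdist_le _ _).1 (fl i) _ e0.
apply: filterS h => x h; rewrite [leLHS]/Num.Def.normr/= mx_normrE.
apply: bigmax_le => [|[i j] _ /=]; first exact: ltW.
by rewrite !mxE (ord1 i).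
Qed.

Lemma consr_cvg (T : Type) (F : set_system T) (FF : Filter F) (d : nat)
    (f : T -> R) (g : T -> 'rV[R]_d) (l : R) (m : 'rV[R]_d) :
  f x @[x --> F] --> l -> g x @[x --> F] --> m ->
  consr (f x) (g x) @[x --> F] --> consr l m.
Proof.
move=> fl gm; apply: cvg_rV => i; case: (unliftP ord0 i) => [j ->|->].
  rewrite consrS; under eq_fun do rewrite consrS.
  exact: (cvg_comp g (fun y : 'rV[R]_d => y ord0 j) gm (@coord_continuous _ _ _ _ _ _)).
by rewrite consr0; under eq_fun do rewrite consr0.
Qed.

Lemma normrV_leP (d : nat) (x : 'rV[R]_d) M : 0 <= M ->
  reflect (forall i, `|x ord0 i| <= M) (`|x| <= M).
Proof.
move=> M0; apply: (iffP idP) => [xM i|h].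
  apply: le_trans xM; rewrite [leRHS]/Num.Def.normr/= mx_normrE.
  exact: (le_bigmax _ (fun ij : 'I_1 * 'I_d => `|x ij.1 ij.2|) (ord0, i)).
rewrite [leLHS]/Num.Def.normr/= mx_normrE; apply: bigmax_le => // -[i j] _ /=.
by rewrite (ord1 i).
Qed.

Lemma boxE (d : nat) (M : R) : 0 <= M -> box M = [set x : 'rV[R]_d | `|x| <= M].
Proof. by move=> M0; apply/seteqP; split => x /= /normrV_leP; apply. Qed.

Lemma box_closed (d : nat) (M : R) : 0 <= M -> closed (box M : set 'rV[R]_d).
Proof.
move=> M0; rewrite boxE//.
apply: (@closed_comp _ _ (fun x : 'rV[R]_d => `|x|) [set t | t <= M]).
  by move=> x _; exact: norm_continuous.
exact: closed_le.
Qed.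

Lemma box_compact (d : nat) (M : R) : 0 <= M -> compact (box M : set 'rV[R]_d).
Proof.
move=> M0; apply: bounded_closed_compact; last exact: box_closed.
exists M; split; first exact: num_real.
move=> t Mt x; rewrite boxE//= => xM; exact: le_trans (ltW Mt).
Qed.

Lemma compact_support_integrable (d : nat) (f : 'rV[R]_d -> R) M :
  0 <= M -> continuous f -> (forall x, ~ box M x -> f x = 0) ->
  (@leb R d).-integrable setT (EFin \o f).
Proof.
move=> M0 cf f0.
have [C fC] : exists C : R, forall x, `|f x| <= C.
  have [||c _ cmax] := @EVT_max_rV R d (fun x => `|f x|) (box M) _ (box_compact M0) _.
  - by exists 0 => i; rewrite mxE normr0.
  - apply: continuous_subspaceT => x; apply: continuous_comp; first exact: cf.
    exact: norm_continuous.
  - exists (`|f c|) => x; have [xM|/f0 ->] := pselect (box M x).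
      by apply: cmax; rewrite inE.
    by rewrite normr0.
have C0 : 0 <= C by apply: le_trans (fC 0).
have mb := @measurable_box R d M.
have mf : measurable_fun setT (EFin \o f : borelType 'rV[R]_d -> \bar R).
  by apply/measurable_EFinP; exact: continuous_rV_measurable.
apply: (@le_integrable _ _ _ _ setT measurableT _
  (fun x => (C%:E * (\1_(box M : set (borelType 'rV[R]_d)) x)%:E)%E)) => //.
  move=> x _ /=; rewrite lee_fin indicE; have [xM|xM] := pselect (box M x).
    by rewrite mem_set// mulr1 (ger0_norm C0).
  by rewrite f0// normr0.
apply: (integrableZl measurableT C).
apply/integrableP; split.
  by apply/measurable_EFinP; exact: measurable_indic.
rewrite (eq_integral (fun x => (\1_(box M : set (borelType 'rV[R]_d)) x)%:E)).
  rewrite integral_indic// setIT.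
  by rewrite [X in (X < _)%E](leb_box d M0) ltry.
by move=> x _; rewrite gee0_abs// lee_fin.
Qed.

Lemma integral_derive1_compact (F f : R -> R) (M : R) : 0 <= M ->
  (forall x : R, is_derive x 1 F (f x)) -> continuous f ->
  (forall x : R, M < `|x| -> F x = 0) -> (forall x : R, M < `|x| -> f x = 0) ->
  (\int[lebesgue_measure]_x (f x)%:E = 0)%E.
Proof.
move=> M0 dF cf F0 f0.
(* At both ends of this slightly larger interval [F] already vanishes. *)
have E := @continuous_FTC2 R f F (- (M + 1)) (M + 1).
have MM : M < `|M + 1| by rewrite ger0_norm; lra.
rewrite F0// F0 ?normrN// subee// in E.
rewrite -[RHS]E; last 4 first.
- lra.
- exact: continuous_subspaceT.
- have cF : continuous F.
    move=> x; apply: differentiable_continuous; apply/derivable1_diffP.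
    by have [] := dF x.
  split.
  + by move=> x _; have [] := dF x.
  + apply: cvg_at_right_filter; exact: cF.
  + apply: cvg_at_left_filter; exact: cF.
- by move=> x _; rewrite derive1E; have [] := dF x.
rewrite [RHS]integral_mkcond; apply: eq_integral => x _.
rewrite patchE; case: ifPn => //; rewrite notin_setE /= in_itv /= => xM.
rewrite f0//; rewrite ltNge; apply/negP; rewrite ler_norml => h.
by apply: xM; lra.
Qed.

(** The divergence theorem in the form used later, one coordinate at a time. If [i] is the first
    coordinate, Fubini puts it innermost and every line contributes 0 by the one-variable case;
    otherwise the first coordinate is frozen and the induction on [d] applies to each slice. *)
Lemma leb_derive0 (d : nat) (f g : 'rV[R]_d -> R) (i : 'I_d) M : 0 <= M ->
  (forall x, is_derive x (delta_mx 0 i) f (g x)) -> continuous g ->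
  (forall x, ~ box M x -> f x = 0) -> (forall x, ~ box M x -> g x = 0) ->
  (\int[@leb R d]_x (g x)%:E = 0)%E.
Proof.
move=> M0; elim: d f g i => [|d IH] f g i df cg f0 g0; first by case: i df.
have gi := compact_support_integrable M0 cg g0.
have cc1 (x : 'rV[R]_d) : continuous (fun t : R => consr t x).
  by move=> t; apply: consr_cvg; [exact: cvg_id|exact: cvg_cst].
have cc2 (t : R) : continuous (fun x : 'rV[R]_d => consr t x).
  move=> x; apply: (@consr_cvg _ _ (nbhs_filter x) _ (fun=> t) id t x); last exact: cvg_id.
  exact: (@cvg_cst _ t _ _ (nbhs_filter x)).
have nb1 t x : M < `|t| -> ~ box M (consr t x).
  by move=> tM /(_ ord0); rewrite consr0 leNgt tM.
have nb2 t (x : 'rV[R]_d) : ~ box M x -> ~ box M (consr t x).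
  by move=> xM h; apply: xM => j; have := h (lift ord0 j); rewrite consrS.
case: (unliftP ord0 i) df => [j ->|->] df; last first.
  rewrite leb_fubini2//; apply: integral0_eq => x _.
  apply: (@integral_derive1_compact (fun t => f (consr t x)) _ M) => //.
  - move=> t; apply: (@is_derive_affine R 'rV[R]_d.+1 R (fun t => consr t x) f t 1 _ _ _ (df (consr t x))) => h.
    apply/rowP => k; case: (unliftP ord0 k) => [j ->|->].
      by rewrite consrS [RHS]mxE consrS [X in X + _]mxE [X in _ * X]mxE /= mulr0 add0r.
    by rewrite consr0 [RHS]mxE consr0 [X in _ = X + _]mxE [X in _ = _ * X + _]mxE eqxx.
  - by move=> t; apply: continuous_comp; [exact: cc1|exact: cg].
  - by move=> t tM; apply/f0/nb1.
  - by move=> t tM; apply/g0/nb1.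
rewrite leb_fubini1//; apply: integral0_eq => t _.
apply: (IH (fun x => f (consr t x)) _ j) => //.
- move=> x; apply: (@is_derive_affine 'rV[R]_d 'rV[R]_d.+1 R (fun x => consr t x) f x _ _ _ _ (df (consr t x))) => h.
  apply/rowP => k; case: (unliftP ord0 k) => [l ->|->].
    by rewrite consrS [RHS]mxE consrS !mxE (inj_eq (@lift_inj _ ord0)).
  by rewrite consr0 [RHS]mxE consr0 [X in _ = X + _]mxE [X in _ = _ * X + _]mxE /= mulr0 add0r.
- by move=> x; apply: continuous_comp; [exact: cc2|exact: cg].
- by move=> x xM; apply/f0/nb2.
- by move=> x xM; apply/g0/nb2.
Qed.

(** Lebesgue measure is [c] times its image under multiplication by [c], since the two agree on
    half-open intervals. *)
Lemma lebesgue_integral_scale (f : R -> \bar R) (c : R) : 0 < c ->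
  measurable_fun setT f -> (forall x, (0 <= f x)%E) ->
  (\int[lebesgue_measure]_x f x = c%:E * \int[lebesgue_measure]_x f (c * x)%R)%E.
Proof.
move=> c0 mf f0.
have mc : measurable_fun setT (fun x : measurableTypeR R => c * x : measurableTypeR R).
  exact: mulrl_measurable.
pose nu : {measure set (measurableTypeR R) -> \bar R} :=
  mscale (NngNum (ltW c0))
    (measure_function_pushforward__canonical__measure_function_Measure
       (@lebesgue_measure R) mc).
have E (A : set (measurableTypeR R)) : measurable A -> lebesgue_measure A = nu A.
  apply: lebesgue_measure_unique => _ [[a b] _ <-] /=.
  rewrite /nu /mscale /= /pushforward.
  have -> : ( *%R c @^-1` `]a, b]) = `]a / c, b / c]%classic.
    apply/seteqP; split => x /=; rewrite !in_itv /= ltr_pdivrMr// ler_pdivlMr//;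
      by rewrite ![x * c]mulrC.
  rewrite !lebesgue_measure_itv /= !lte_fin ltr_pM2r ?invr_gt0//.
  case: ifP => _; last by rewrite mule0.
  by rewrite -!EFinB -EFinM -mulrBl mulrC divfK// gt_eqF.
rewrite (@eq_measure_integral _ _ _ _ nu); last by move=> A mA _; exact: E.
rewrite ge0_integral_mscale//= ge0_integral_pushforward//.
Qed.

End compact_support.

(** * Decomposition of Lebesgue measure along rays *)

Section lebesgue_cones.
Context {R : realType}.

Lemma leb_open_gt0 (d : nat) (U : set 'rV[R]_d) x : open U -> U x -> (0 < @leb R d U)%E.
Proof.
move=> oU Ux; have [e e0 eU] := open_boxP oU Ux.
apply: (@lt_le_trans _ _ (@leb R d (cube x (e / 2)))).
  by rewrite leb_cube ?lte_fin ?exprn_gt0//; lra.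
apply: le_measure; rewrite ?inE.
- exact: measurable_cube.
- exact: measurable_open.
- move=> y /= h; apply: eU => i; rewrite distrC; apply: le_lt_trans (h i) _.
  lra.
Qed.

Local Open Scope ereal_scope.

Lemma consrZ (d : nat) (c t : R) (x : 'rV[R]_d) : c *: consr t x = consr (c * t) (c *: x).
Proof.
apply/rowP => i; rewrite [LHS]mxE; case: (unliftP ord0 i) => [j ->|->].
  by rewrite !consrS mxE.
by rewrite !consr0.
Qed.

Lemma measurable_scale (d : nat) :
  measurable_fun setT (fun z : measurableTypeR R * borelType 'rV[R]_d =>
    z.1 *: (z.2 : 'rV[R]_d) : borelType 'rV[R]_d).
Proof.
apply: borel_coord => i.
apply: (eq_measurable_fun (fun z : measurableTypeR R * borelType 'rV[R]_d => (z.1 * z.2 ord0 i)%R)).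
  by move=> z _; rewrite mxE.
apply: measurable_funM; first exact: measurable_fst.
by apply: (measurableT_comp (measurable_coord i)); exact: measurable_snd.
Qed.

Lemma measurable_scale1 (d : nat) (c : R) :
  measurable_fun setT (fun x : borelType 'rV[R]_d => c *: (x : 'rV[R]_d) : borelType 'rV[R]_d).
Proof. exact: (measurableT_comp (@measurable_scale d) (pair1_measurable c)). Qed.

Lemma leb_scale (d : nat) (f : borelType 'rV[R]_d -> \bar R) (c : R) : (0 < c)%R ->
  measurable_fun setT f -> (forall x, 0 <= f x) ->
  \int[@leb R d]_x f x = (c ^+ d)%:E * \int[@leb R d]_x f (c *: (x : 'rV[R]_d)).
Proof.
move=> c0; elim: d f => [|d IH] f mf f0.
  rewrite expr0 mul1e; apply: eq_integral => x _; congr f.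
  by apply/rowP => -[].
rewrite leb_tonelli1// (lebesgue_integral_scale c0); last 2 first.
- apply: (measurable_fun_fubini_tonelli_F (m2 := leb d) (fun z => f (consr z.1 z.2))) => //.
  exact: (measurableT_comp mf (@measurable_consr R d)).
- by move=> x; exact: integral_ge0.
have mfc : measurable_fun setT (fun x : borelType 'rV[R]_d.+1 => f (c *: (x : 'rV[R]_d.+1))).
  exact: (measurableT_comp mf (@measurable_scale1 d.+1 c)).
have E := leb_tonelli1 mfc (fun x => f0 _).
rewrite [X in _ = _ * X]E.
rewrite exprS EFinM -muleA; congr (_ * _).
rewrite -ge0_integralZl//; last 3 first.
- apply: (measurable_fun_fubini_tonelli_F (m2 := leb d) (fun z => f (c *: consr z.1 z.2))) => //.
  exact: (measurableT_comp mfc (@measurable_consr R d)).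
- by move=> x _; exact: integral_ge0.
- by rewrite lee_fin exprn_ge0// ltW.
apply: eq_integral => t _; rewrite IH//; last first.
  exact: (measurableT_comp mf (@measurable_consr2 R d _)).
by congr (_ * _); apply: eq_integral => x _; rewrite consrZ.
Qed.

(** The usual passage from indicators to simple functions and, by monotone convergence, to
    nonnegative functions. The hypothesis on sets is what the definition of the area measure
    supplies for a chart, [D] being the image of the chart. *)
Lemma ge0_integral_transfer (d1 d2 : measure_display) (T : measurableType d1)
    (Y : measurableType d2) (mu : {measure set T -> \bar R})
    (lam : {measure set Y -> \bar R}) (phi : Y -> T) (w : Y -> R) (D : set T) :
  measurable_fun setT phi -> measurable_fun setT w -> (forall y, (0 <= w y)%R) ->
  measurable D ->
  (forall A, measurable A -> mu (A `&` D) = \int[lam]_y (\1_A (phi y) * w y)%:E) ->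
  forall f : T -> \bar R, measurable_fun setT f -> (forall x, 0 <= f x) ->
  \int[mu]_(x in D) f x = \int[lam]_y (f (phi y) * (w y)%:E).
Proof.
move=> mphi mw w0 mD H f mf f0.
pose f_ := nnsfun_approx measurableT mf.
have mfw n : measurable_fun setT (fun y => ((f_ n (phi y))%:E * (w y)%:E)).
  apply: emeasurable_funM; apply/measurable_EFinP => //.
  exact: measurableT_comp.
transitivity (limn (fun n => \int[mu]_(x in D) (f_ n x)%:E)).
  rewrite -monotone_convergence//.
  - by apply: eq_integral => x _; apply/esym/cvg_lim => //; exact: cvg_nnsfun_approx.
  - by move=> n; exact/measurable_EFinP/measurable_funTS.
  - by move=> n x _; rewrite lee_fin.
  - by move=> x _ m n mn; rewrite lee_fin; exact/lefP/nd_nnsfun_approx.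
transitivity (limn (fun n => \int[lam]_y ((f_ n (phi y))%:E * (w y)%:E))); last first.
  rewrite -monotone_convergence//.
  - apply: eq_integral => y _; apply/cvg_lim => //; apply: cvgeZr => //.
    exact: cvg_nnsfun_approx.
  - by move=> n y _; rewrite mule_ge0// lee_fin.
  - move=> y _ m n mn; rewrite lee_wpmul2r// lee_fin//; exact/lefP/nd_nnsfun_approx.
congr (limn _); apply/funext => n.
under eq_integral do rewrite fimfunE// -fsumEFin//.
transitivity (\int[lam]_y (\sum_(r \in range (f_ n))
    (r%:E * (\1_(f_ n @^-1` [set r]) (phi y) * w y)%:E))); last first.
  apply: eq_integral => y _; rewrite [in RHS]fimfunE// -fsumEFin// ge0_mule_fsuml//.
    by apply: eq_fsbigr => r _; rewrite -!EFinM mulrA.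
  by move=> r; rewrite nnfun_muleindic_ge0.
have mi r : measurable (f_ n @^-1` [set r]) by exact: measurable_funPTI.
have miw r : measurable_fun setT
    (fun y => (\1_(f_ n @^-1` [set r]) (phi y) * w y)%:E).
  apply/measurable_EFinP/measurable_funM => //.
  have mI : measurable_fun setT (\1_(f_ n @^-1` [set r]) : T -> R).
    exact: measurable_indic.
  exact: (measurableT_comp mI mphi).
have r0 r : r \in range (f_ n) -> (0 <= r)%R.
  by rewrite inE => -[x _ <-].
rewrite ge0_integral_fsum//; last 2 first.
- by move=> r; apply/measurable_EFinP/measurable_funM.
- by move=> r x _; rewrite EFinM nnfun_muleindic_ge0.
rewrite ge0_integral_fsum//; last 2 first.
- by move=> r; exact: emeasurable_funM.
- move=> r y _; have [rr|rr] := pselect (r \in range (f_ n)).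
    by apply: mule_ge0; rewrite lee_fin; [exact: r0|exact: mulr_ge0].
  rewrite indicE memNset ?mul0r ?mule0//= => hr; apply: rr.
  by rewrite inE; exists (phi y).
apply: eq_fsbigr => r hr; have {}hr := r0 _ hr.
under eq_integral do rewrite EFinM.
rewrite ge0_integralZl//; last first.
  by apply/measurable_EFinP; exact: measurable_indic.
rewrite integral_indic// H//.
rewrite ge0_integralZl// => y _; by rewrite lee_fin mulr_ge0.
Qed.


Lemma integral_half_lines (g : R -> \bar R) :
  measurable_fun setT g -> (forall x, 0 <= g x) ->
  \int[lebesgue_measure]_t g t =
  \int[lebesgue_measure]_t (g t * (0 < t)%R%:R%:E) +
  \int[lebesgue_measure]_t (g (- t)%R * (0 < t)%R%:R%:E).
Proof.
move=> mg g0.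
have mpos : measurable_fun setT (fun t : R => ((0 < t)%R%:R : R)%:E).
  apply/measurable_EFinP.
  apply: (measurableT_comp (f := fun b : bool => b%:R : R)) => //.
  by apply: measurable_fun_ltr => //; exact: measurable_cst.
have mneg : measurable_fun setT (fun t : R => ((t < 0)%R%:R : R)%:E).
  apply/measurable_EFinP.
  apply: (measurableT_comp (f := fun b : bool => b%:R : R)) => //.
  by apply: measurable_fun_ltr => //; exact: measurable_cst.
have mN : measurable_fun setT (-%R : measurableTypeR R -> measurableTypeR R).
  exact: oppr_measurable.
have b0 (b : bool) : 0 <= (b%:R : R)%:E by rewrite lee_fin ler0n.
have -> : \int[lebesgue_measure]_t (g (- t)%R * (0 < t)%R%:R%:E) =
    \int[lebesgue_measure]_t (g t * (t < 0)%R%:R%:E).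
  rewrite [RHS](@eq_measure_integral _ _ _ _ (measure_function_pushforward__canonical__measure_function_Measure
       (@lebesgue_measure R) mN)); last first.
    by move=> A mA _; apply/esym/lebesgue_measureN.
  rewrite ge0_integral_pushforward//=; last 2 first.
  - exact: emeasurable_funM.
  - by move=> t _; rewrite mule_ge0.
  by apply: eq_integral => t _ /=; rewrite oppr_lt0.
rewrite -ge0_integralD//; last 4 first.
- by move=> t _; rewrite mule_ge0.
- exact: emeasurable_funM.
- by move=> t _; rewrite mule_ge0.
- exact: emeasurable_funM.
rewrite -(@integral_setD1 R g 0%R setT)//; last 2 first.
- by apply: measurableD => //; exact: measurable_set1.
- exact: measurable_funTS.
rewrite [LHS]integral_mkcond; apply: eq_integral => t _.
rewrite patchE.
case: ifPn => [|]; rewrite ?notin_setE ?inE /=.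
  move=> [_ /eqP]; rewrite neq_lt => /orP[]t0; rewrite t0.
    by rewrite ltNge (ltW t0) mule0 add0e mule1.
  by rewrite (ltNge t 0%R) (ltW t0) mule0 adde0 mule1.
move=> h; have -> : t = 0%R by apply: contrapT => t0; apply: h; split.
by rewrite ltxx mule0 adde0.
Qed.

(** The polar density t^n, cut off at t <= 0 so that ray integrals are taken over the whole line. *)
Definition pospow (n : nat) (t : R) : R := ((0 < t)%R%:R * t ^+ n)%R.

Lemma pospow_ge0 n t : (0 <= pospow n t)%R.
Proof.
by rewrite /pospow; have [t0|] := ltP; rewrite ?mul0r// mul1r exprn_ge0// ltW.
Qed.

Lemma measurable_pospow n : measurable_fun setT (pospow n).
Proof.
apply: measurable_funM; last exact: exprn_measurable.
apply: (measurableT_comp (f := fun b : bool => b%:R : R)) => //.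
by apply: measurable_fun_ltr => //; exact: measurable_cst.
Qed.

Definition ray_integral (n : nat) (d : nat) (F : 'rV[R]_d -> \bar R) (p : 'rV[R]_d) :=
  \int[lebesgue_measure]_t (F (t *: p) * (pospow n t)%:E).

Lemma measurable_ray_integral (n d : nat) (F : borelType 'rV[R]_d -> \bar R) :
  measurable_fun setT F -> (forall x, 0 <= F x) ->
  measurable_fun setT (ray_integral n F : borelType 'rV[R]_d -> \bar R).
Proof.
move=> mF F0; apply: (measurable_fun_fubini_tonelli_G (m1 := lebesgue_measure)
  (fun z : measurableTypeR R * borelType 'rV[R]_d =>
    F (z.1 *: (z.2 : 'rV[R]_d)) * (pospow n z.1)%:E)).
  apply: emeasurable_funM; first exact: (measurableT_comp mF (@measurable_scale d)).
  apply/measurable_EFinP; apply: (measurableT_comp (measurable_pospow n)).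
  exact: measurable_fst.
by move=> z; rewrite mule_ge0// lee_fin pospow_ge0.
Qed.

(** Slice by the first coordinate, which is t or -t with t > 0 (the value 0 is negligible). Scaling
    a slice by t gives the Jacobian t^n and turns its points into t (1, y) or t (-1, y); exchanging
    the integrals leaves rays through two hyperplanes. *)
Lemma leb_cone (n : nat) (F : borelType 'rV[R]_n.+1 -> \bar R) :
  measurable_fun setT F -> (forall x, 0 <= F x) ->
  \int[@leb R n.+1]_x F x =
  \int[@leb R n]_y ray_integral n F (consr 1 y) +
  \int[@leb R n]_y ray_integral n F (consr (-1) y).
Proof.
move=> mF F0.
have half e : \int[lebesgue_measure]_t
      ((\int[@leb R n]_x F (consr (e * t) x)) * (0 < t)%R%:R%:E) =
    \int[@leb R n]_y ray_integral n F (consr e y).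
  have mf : measurable_fun setT (fun z : measurableTypeR R * borelType 'rV[R]_n =>
      F (z.1 *: consr e z.2) * (pospow n z.1)%:E).
    apply: emeasurable_funM; last first.
      apply/measurable_EFinP; apply: (measurableT_comp (measurable_pospow n)).
      exact: measurable_fst.
    apply: (measurableT_comp mF).
    suff mp : measurable_fun setT (fun z : measurableTypeR R * borelType 'rV[R]_n =>
        (z.1, consr e z.2) : measurableTypeR R * borelType 'rV[R]_n.+1).
      exact: (measurableT_comp (@measurable_scale n.+1) mp).
    apply: measurable_fun_pair; first exact: measurable_fst.
    apply: (measurableT_comp (@measurable_consr2 R n e)); exact: measurable_snd.
  rewrite /ray_integral -(@fubini_tonelli _ _ _ _ _ lebesgue_measure (leb n)
    (fun z => F (z.1 *: consr e z.2) * (pospow n z.1)%:E))//; last first.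
    by move=> z; rewrite mule_ge0// lee_fin pospow_ge0.
  apply: eq_integral => t _ /=.
  rewrite /pospow; have [t0|t0] := ltP; last first.
    by rewrite mule0 integral0_eq// => x _; rewrite mul0r mule0.
  have mft : measurable_fun setT (fun x : borelType 'rV[R]_n => F (consr (e * t) x)).
    exact: (measurableT_comp mF (@measurable_consr2 R n _)).
  rewrite mule1 (leb_scale t0 mft)// mul1r.
  rewrite [RHS]ge0_integralZr//; last 2 first.
  - apply: (measurableT_comp mF).
    exact: (measurableT_comp (@measurable_scale1 n.+1 t) (@measurable_consr2 R n e)).
  - by rewrite lee_fin exprn_ge0// ltW.
  rewrite muleC; congr (_ * _); apply: eq_integral => x _.
  by rewrite consrZ mulrC.
rewrite leb_tonelli1// integral_half_lines; last 2 first.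
- apply: (measurable_fun_fubini_tonelli_F (m2 := leb n) (fun z => F (consr z.1 z.2))) => //.
  exact: (measurableT_comp mF (@measurable_consr R n)).
- by move=> x; exact: integral_ge0.
congr (_ + _).
  by apply: (etrans _ (half 1%R)); apply: eq_integral => t _; rewrite mul1r.
by apply: (etrans _ (half (-1)%R)); apply: eq_integral => t _; rewrite mulN1r.
Qed.

(** Replacing t by c t costs [c] from dt and [c ^+ n] from the weight. This slides the base point of
    a ray from a chart hyperplane to the boundary. *)
Lemma ray_integral_scale (n d : nat) (F : borelType 'rV[R]_d -> \bar R) (p : 'rV[R]_d) (c : R) :
  measurable_fun setT F -> (forall x, 0 <= F x) -> (0 < c)%R ->
  ray_integral n F p = (c ^+ n.+1)%:E * ray_integral n F (c *: p).
Proof.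
move=> mF F0 c0.
have mf (q : 'rV[R]_d) : measurable_fun setT
    (fun t : measurableTypeR R => F (t *: q) * (pospow n t)%:E).
  apply: emeasurable_funM; last by apply/measurable_EFinP; exact: measurable_pospow.
  apply: (measurableT_comp mF).
  exact: (measurableT_comp (@measurable_scale d) (pair2_measurable (q : borelType 'rV[R]_d))).
have f0 (q : 'rV[R]_d) t : 0 <= F (t *: q) * (pospow n t)%:E.
  by rewrite mule_ge0// lee_fin pospow_ge0.
rewrite [LHS](lebesgue_integral_scale c0)//; last exact: mf.
rewrite exprS EFinM -muleA; congr (_ * _).
rewrite -ge0_integralZl//; last by rewrite lee_fin exprn_ge0// ltW.
apply: eq_integral => t _; rewrite scalerA mulrC muleCA -EFinM; congr (_ * _%:E).
by rewrite /pospow pmulr_lgt0// exprMn_comm ?[(_ * c ^+ n)%R]mulrC ?mulrA ?[(_%:R * _)%R]mulrC//; exact: mulrC.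
Qed.

Lemma ray_integral_ge0 (n d : nat) (F : 'rV[R]_d -> \bar R) (p : 'rV[R]_d) :
  (forall x, 0 <= F x) -> 0 <= ray_integral n F p.
Proof.
by move=> F0; apply: integral_ge0 => t _; rewrite mule_ge0// lee_fin pospow_ge0.
Qed.

End lebesgue_cones.

(** * Differential calculus *)

Section normed_neighborhoods.
Context {R : realType}.

Lemma continuous_distP (V W : normedModType R) (f : V -> W) (x : V) :
  {for x, continuous f} <->
  forall e : R, 0 < e -> \forall y \near x, `|f x - f y| < e.
Proof. exact: cvgrPdist_lt. Qed.

Lemma near_forall (V : normedModType R) (I : finType) (P : I -> V -> Prop) (x : V) :
  (forall i, \forall y \near x, P i y) -> \forall y \near x, forall i, P i y.
Proof. exact: filter_forall. Qed.

Lemma near_dist (V : normedModType R) (x : V) (e : R) :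
  0 < e -> \forall y \near x, `|x - y| < e.
Proof. by move=> e0; apply: cvgr_dist_lt. Qed.

End normed_neighborhoods.

Section is_derive_lemmas.
Context {R : realType}.

Lemma is_derive_line (V W : normedModType R) (f : V -> W) (x v : V) (t : R) (D : W) :
  is_derive (x + t *: v) v f D -> is_derive t 1 (fun h : R => f (x + h *: v)) D.
Proof.
move=> df.
apply: (@is_derive_affine R R V W (fun h : R => x + h *: v) f t 1 v D) => // h.
by rewrite /= scalerDl [h *: 1]mulr1 addrCA.
Qed.

Lemma is_derive_line0 (V W : normedModType R) (f : V -> W) (x v : V) (D : W) :
  is_derive (0 : R) 1 (fun h : R => f (x + h *: v)) D -> is_derive x v f D.
Proof.
move=> [df <-].
have E : (fun h : R => h^-1 *: ((f \o shift x) (h *: v) - f x)) =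
  (fun h : R => h^-1 *: (((fun h : R => f (x + h *: v)) \o shift 0) (h *: 1) - f (x + 0 *: v))).
  by apply/funext => h /=; rewrite scale0r !addr0 [h%:A]mulr1 [x + _]addrC.
by split; [move: df|]; rewrite /derivable /derive E.
Qed.

Lemma is_derive_scomp (V : normedModType R) (g : R -> R) (f : V -> R) (x v : V) (a b : R) :
  is_derive (f x) 1 g a -> is_derive x v f b -> is_derive x v (g \o f) (a * b).
Proof.
move=> dg df; apply: is_derive_line0.
have dg' : is_derive (f (x + 0 *: v)) 1 g a by rewrite scale0r addr0.
apply: (@is_derive1_comp R g (fun h => f (x + h *: v)) 0 a b dg').
by apply: is_derive_line; rewrite scale0r addr0.
Qed.

Lemma is_derive_near (V W : normedModType R) (f g : V -> W) (x v : V) (D : W) :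
  (\forall y \near x, f y = g y) -> is_derive x v f D -> is_derive x v g D.
Proof.
move=> fg [df <-]; split; first exact: near_eq_derivable df.
by rewrite (near_eq_derive _ fg).
Qed.

Lemma mvt_bound (phi dphi : R -> R) (h c e : R) :
  (forall t : R, `|t| <= `|h| -> is_derive t 1 phi (dphi t)) ->
  (forall t : R, `|t| <= `|h| -> `|dphi t - c| <= e) ->
  `|phi h - phi 0 - h * c| <= e * `|h|.
Proof.
move=> dphiP dc.
have cphi (t : R) : `|t| <= `|h| -> {for t, continuous phi}.
  move=> /dphiP[dt _]; apply: differentiable_continuous.
  exact/derivable1_diffP.
have [h0|h0|->] := ltgtP h 0; last by rewrite subrr mul0r subrr normr0 mulr0.
- have le (t : R) : h <= t -> t <= 0 -> `|t| <= `|h|.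
    by move=> t1 t2; rewrite !ler0_norm ?lerN2// ltW.
  have [||c0] := @MVT R phi dphi h 0 h0.
  + move=> t; rewrite in_itv /= => /andP[/ltW t1 /ltW t2]; apply: dphiP; exact: le.
  + apply: continuous_in_subspaceT => t; rewrite inE /= in_itv /= => /andP[t1 t2].
    exact/cphi/le.
  + rewrite in_itv /= => /andP[/ltW t1 /ltW t2] E.
    have -> : phi h - phi 0 - h * c = h * (dphi c0 - c) by lra.
    by rewrite normrM mulrC ler_wpM2r//; exact/dc/le.
- have le (t : R) : 0 <= t -> t <= h -> `|t| <= `|h|.
    by move=> t1 t2; rewrite !ger0_norm// (le_trans t1).
  have [||c0] := @MVT R phi dphi 0 h h0.
  + move=> t; rewrite in_itv /= => /andP[/ltW t1 /ltW t2]; apply: dphiP; exact: le.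
  + apply: continuous_in_subspaceT => t; rewrite inE /= in_itv /= => /andP[t1 t2].
    exact/cphi/le.
  + rewrite in_itv /= => /andP[/ltW t1 /ltW t2] E.
    have -> : phi h - phi 0 - h * c = h * (dphi c0 - c) by lra.
    by rewrite normrM mulrC ler_wpM2r//; exact/dc/le.
Qed.

End is_derive_lemmas.

Lemma is_diff_littleo {R : realType} (V W : normedModType R) (f : V -> W)
    (L : {linear V -> W}) (x : V) : continuous L ->
  (forall e : R, 0 < e -> \forall h \near (0 : V), `|f (x + h) - f x - L h| <= e * `|h|) ->
  is_diff x f L.
Proof.
move=> cL H.
have E : f \o shift x = cst (f x) + L +o_0 id.
  apply/eqaddoP => e e0; apply: filterS (H e e0) => h.
  by rewrite !fctE /= opprD addrA [h + x]addrC.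
have dE := diff_unique cL E.
by split=> //; apply/diff_locallyP; rewrite dE.
Qed.

Section C1_differentiable.
Context {R : realType} {d : nat}.
Implicit Types (x v h : 'rV[R]_d).

Lemma dotv_is_linear (g : 'rV[R]_d) : linear (dotv g).
Proof.
move=> a u w; rewrite /dotv scaler_sumr -big_split /=; apply: eq_bigr => i _.
by rewrite !mxE; rewrite [_ *: _]mulrCA mulrDr.
Qed.

HB.instance Definition _ (g : 'rV[R]_d) :=
  GRing.isLinear.Build R 'rV[R]_d R *:%R (dotv g) (dotv_is_linear g).

Lemma dotvC (x v : 'rV[R]_d) : dotv x v = dotv v x.
Proof. by rewrite /dotv; apply: eq_bigr => i _; rewrite mulrC. Qed.

Lemma dotv_bound (g v : 'rV[R]_d) : `|dotv g v| <= (\sum_i `|g 0 i|) * `|v|.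
Proof.
rewrite /dotv mulr_suml; apply: le_trans (ler_norm_sum _ _ _) _.
apply: ler_sum => i _; rewrite normrM ler_wpM2l//.
by have /normrV_leP := lexx `|v|; apply.
Qed.

Lemma dotv_continuous (g : 'rV[R]_d) : continuous (dotv g).
Proof.
move=> x; apply/continuous_distP => e e0.
pose C := \sum_i `|g 0 i|.
have C0 : 0 <= C by apply: sumr_ge0.
have C1 : 0 < C + 1 by rewrite ltr_wpDl.
apply: filterS (@near_dist R 'rV[R]_d x _ (divr_gt0 e0 C1)) => y xy.
rewrite -linearB; apply: le_lt_trans (dotv_bound g _) _.
apply: (@le_lt_trans _ _ ((C + 1) * `|x - y|)).
  by rewrite ler_wpM2r// lerDl.
by rewrite mulrC -ltr_pdivlMr.
Qed.

Lemma dotv_delta (g : 'rV[R]_d) i : dotv g (delta_mx 0 i) = g 0 i.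
Proof.
rewrite /dotv (bigD1 i)//= mxE !eqxx mulr1 big1 ?addr0// => j ji.
by rewrite mxE eqxx /= (negbTE ji) mulr0.
Qed.

Let trunc h (j : nat) : 'rV[R]_d := \row_i (if (i < j)%N then h 0 i else 0).

(** Walk from [x] to [x + h] one coordinate at a time through the truncations of [h]. In the sup
    norm every intermediate point stays within |h| of [x], and each of the [d] legs costs e |h| by
    the mean value theorem. *)
Lemma increment_bound (f : 'rV[R]_d -> R) (df : 'I_d -> 'rV[R]_d -> R) x h e :
  0 <= e ->
  (forall y i, `|y - x| <= `|h| -> is_derive y (delta_mx 0 i) f (df i y)) ->
  (forall y i, `|y - x| <= `|h| -> `|df i y - df i x| <= e) ->
  `|f (x + h) - f x - dotv (\row_i df i x) h| <= (d%:R * e) * `|h|.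
Proof.
move=> e0 dfP dfe.
have hi i : `|h 0 i| <= `|h| by have /normrV_leP := lexx `|h|; apply.
have trS (j : 'I_d) : trunc h j.+1 = trunc h j + h 0 j *: delta_mx 0 j.
  apply/rowP => i; rewrite !mxE eqxx /= ltnS leq_eqVlt.
  have [->|ij] := eqVneq i j; first by rewrite eqxx ltnn add0r mulr1.
  by rewrite (inj_eq val_inj) (negbTE ij) /= mulr0 addr0.
have step (j : 'I_d) : `|f (x + trunc h j.+1) - f (x + trunc h j) - h 0 j * df j x| <= e * `|h|.
  have near_x (t : R) : `|t| <= `|h 0 j| -> `|x + trunc h j + t *: delta_mx 0 j - x| <= `|h|.
    move=> tj; rewrite -[x + _ + _]addrA [x + _]addrC addrK.
    apply/normrV_leP => // i.
    rewrite !mxE eqxx /=; have [->|ij] := eqVneq i j.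
      by rewrite ltnn add0r mulr1 (le_trans tj).
    by rewrite mulr0 addr0; case: ifP => _; rewrite ?normr0.
  have := @mvt_bound R (fun t => f (x + trunc h j + t *: delta_mx 0 j))
    (fun t => df j (x + trunc h j + t *: delta_mx 0 j)) (h 0 j) (df j x) e.
  rewrite scale0r addr0 -[x + trunc h j + h 0 j *: _]addrA -trS => H; apply: le_trans (H _ _) _.
  - by move=> t tj; apply: is_derive_line; apply: dfP; exact: near_x.
  - by move=> t tj; apply: dfe; exact: near_x.
  - exact: ler_wpM2l.
have tr0 : trunc h 0 = 0 by apply/rowP => i; rewrite !mxE.
have trd : trunc h d = h by apply/rowP => i; rewrite !mxE ltn_ord.
have -> : f (x + h) - f x - dotv (\row_i df i x) h =
    \sum_(j < d) (f (x + trunc h j.+1) - f (x + trunc h j) - h 0 j * df j x).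
  rewrite big_split /= sumrN; congr (_ - _); last first.
    by rewrite /dotv; apply: eq_bigr => i _; rewrite mxE mulrC.
  rewrite -(big_mkord xpredT (fun j => f (x + trunc h j.+1) - f (x + trunc h j))).
  by rewrite telescope_sumr// tr0 trd addr0.
apply: le_trans (ler_norm_sum _ _ _) _.
apply: le_trans (ler_sum _ (fun j _ => step j)) _.
by rewrite sumr_const card_ord -mulrA [leRHS]mulr_natl.
Qed.

(** The bridge from [Ck], which speaks of directional derivatives only, to differentiability, on
    which the chain rule for maps between row vectors rests. *)
Lemma C1_is_diff (f : 'rV[R]_d -> R) (df : 'I_d -> 'rV[R]_d -> R) x :
  (\forall y \near x, forall i, is_derive y (delta_mx 0 i) f (df i y)) ->
  (forall i, {for x, continuous (df i)}) ->
  is_diff x f (dotv (\row_i df i x)).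
Proof.
move=> dfP cdf.
apply: is_diff_littleo => [|e e0]; first exact: dotv_continuous.
(* [increment_bound] loses a factor [d]; dividing by [d.+1] also covers [d = 0]. *)
pose e' := e / (d.+1)%:R.
have e'0 : 0 < e' by rewrite divr_gt0.
have : \forall y \near x, forall i, `|df i y - df i x| <= e'.
  apply: near_forall => i.
  have := (continuous_distP _ _).1 (cdf i) _ e'0.
  by apply: filterS => y /ltW; rewrite distrC.
move/(filterI dfP) => /nbhs_ballP[r /= r0 rP].
have r2 : 0 < r / 2 by rewrite divr_gt0.
apply: filterS (@near_dist R 'rV[R]_d 0 _ r2) => h.
rewrite sub0r normrN => /ltW hr.
have inb y : `|y - x| <= `|h| -> ball x r y.
  move=> yx; rewrite -ball_normE /= distrC (le_lt_trans yx)// (le_lt_trans hr)//.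
  by rewrite ltr_pdivrMr// ltr_pMr// ltr1n.
apply: le_trans (increment_bound (e := e') (ltW e'0) _ _) _.
- by move=> y i /inb /rP[+ _]; apply.
- by move=> y i /inb /rP[_]; apply.
- rewrite ler_wpM2r// /e' mulrCA ler_piMr ?(ltW e0)//.
  by rewrite ler_pdivrMr// mul1r ler_nat.
Qed.

End C1_differentiable.

(** * Closure properties of the classes C^k *)

Section Ck_general.
Context {R : realType} {V W : normedModType R}.
Implicit Types (f g : V -> W) (U : set V).

Lemma near_open (U : set V) (P : set V) x : open U -> U x ->
  (forall y, U y -> P y) -> \forall y \near x, P y.
Proof. by move=> oU Ux UP; apply: filterS UP _; exact: open_nbhs_nbhs. Qed.

Lemma Ck_continuous k U f x : Ck k U f -> U x -> {for x, continuous f}.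
Proof. by case: k => [|k] [cf _] Ux; exact: cf. Qed.

Lemma CkS k U f : Ck k.+1 U f -> Ck k U f.
Proof.
elim: k f => [|k IH] f [cf df]; split => // v.
by have [df1 df2] := df v; split => //; exact: IH.
Qed.

Lemma Ck_derivable k U f x v : Ck k.+1 U f -> U x -> derivable f x v.
Proof. by move=> [_ /(_ v)[df _]] Ux; exact: df. Qed.

Lemma Ck_is_derive k U f x v : Ck k.+1 U f -> U x -> is_derive x v f ('D_v f x).
Proof. by move=> cf Ux; apply: derivableP; exact: Ck_derivable cf Ux. Qed.

Lemma Ck_derive k U f v : Ck k.+1 U f -> Ck k U (fun x => 'D_v f x).
Proof. by move=> [_ /(_ v)[]]. Qed.

Lemma Ck_sub k U U' f : U' `<=` U -> Ck k U f -> Ck k U' f.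
Proof.
move=> UU; elim: k f => [|k IH] f [cf df].
  by split=> // x /UU; exact: cf.
split=> [x /UU|v]; first exact: cf.
have [df1 df2] := df v; split=> [x /UU|]; [exact: df1|exact: IH].
Qed.

Lemma Ck_eq k U f g : open U -> (forall x, U x -> f x = g x) -> Ck k U f -> Ck k U g.
Proof.
move=> oU; elim: k f g => [|k IH] f g fg [cf df].
  split=> // x Ux; rewrite /prop_for /continuous_at -(fg _ Ux).
  apply: cvg_trans (cf _ Ux); apply: near_eq_cvg.
  by apply: near_open oU Ux _ => y /fg.
split=> [x Ux|v].
  rewrite /prop_for /continuous_at -(fg _ Ux).
  apply: cvg_trans (cf _ Ux); apply: near_eq_cvg.
  by apply: near_open oU Ux _ => y /fg.
have [df1 df2] := df v; split.
  move=> x Ux; apply: near_eq_derivable (df1 _ Ux).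
  exact: near_open oU Ux fg.
apply: IH df2 => x Ux; apply: near_eq_derive.
exact: near_open oU Ux fg.
Qed.

Lemma Ck_local k U f :
  (forall x, U x -> exists U', [/\ open U', U' x & Ck k U' f]) -> Ck k U f.
Proof.
elim: k f => [|k IH] f H.
  by split=> // x /H[U' [_ U'x [cf _]]]; exact: cf.
split=> [x /H[U' [_ U'x [cf _]]]|v]; first exact: cf.
split=> [x /H[U' [_ U'x [_ /(_ v)[df _]]]]|]; first exact: df.
by apply: IH => x /H[U' [oU' U'x [_ /(_ v)[_ df]]]]; exists U'.
Qed.

(** An explicit formula [df] may stand in for the derivative operator; each closure property below
    is then an induction on [k] over the differentiated formula. *)
Lemma Ck_intro k U f (df : V -> V -> W) :
  (forall x, U x -> {for x, continuous f}) -> open U ->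
  (forall x v, U x -> is_derive x v f (df v x)) ->
  (forall v, Ck k U (df v)) -> Ck k.+1 U f.
Proof.
move=> cf oU dfP cdf; split => // v; split.
  by move=> x /(dfP x v)[].
by apply: Ck_eq (cdf v) => // x /(dfP x v)[_ ->].
Qed.

Lemma Ck_cst k U (c : W) : open U -> Ck k U (fun=> c).
Proof.
move=> oU; elim: k c => [|k IH] c; first by split => // x _; exact: cvg_cst.
apply: (@Ck_intro k U (fun=> c) (fun _ _ => 0)) => //.
by move=> x _; exact: cvg_cst.
Qed.

Lemma CkD k U f g : open U -> Ck k U f -> Ck k U g -> Ck k U (fun x => f x + g x).
Proof.
move=> oU; elim: k f g => [|k IH] f g cf cg.
  split=> // x Ux; apply: cvgD; [exact: Ck_continuous cf Ux|exact: Ck_continuous cg Ux].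
apply: (@Ck_intro k U _ (fun v x => 'D_v f x + 'D_v g x)) => //.
- by move=> x Ux; apply: cvgD; [exact: Ck_continuous cf Ux|exact: Ck_continuous cg Ux].
- move=> x v Ux; apply: is_deriveD; [exact: Ck_is_derive cf Ux|exact: Ck_is_derive cg Ux].
- by move=> v; apply: IH; exact: Ck_derive.
Qed.

Lemma Ck_sum k U (I : Type) (s : seq I) (F : I -> V -> W) : open U ->
  (forall i, Ck k U (F i)) -> Ck k U (fun x => \sum_(i <- s) F i x).
Proof.
move=> oU cF; elim: s => [|i s IH].
  by apply: (@Ck_eq k U (fun=> 0)) => // [x _|]; [rewrite big_nil|exact: Ck_cst].
apply: (@Ck_eq k U (fun x => F i x + \sum_(j <- s) F j x)) => // [x _|].
  by rewrite big_cons.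
exact: CkD.
Qed.

End Ck_general.

Section Ck_scalar.
Context {R : realType} {V : normedModType R}.
Implicit Types (f g : V -> R) (U : set V).

Lemma CkM k U f g : open U -> Ck k U f -> Ck k U g -> Ck k U (fun x => f x * g x).
Proof.
move=> oU; elim: k f g => [|k IH] f g cf cg.
  by split=> // x Ux; apply: cvgM; [exact: Ck_continuous cf Ux|exact: Ck_continuous cg Ux].
apply: (@Ck_intro _ _ _ k U _ (fun v x => f x * 'D_v g x + g x * 'D_v f x)) => //.
- by move=> x Ux; apply: cvgM; [exact: Ck_continuous cf Ux|exact: Ck_continuous cg Ux].
- move=> x v Ux; apply: is_deriveM; [exact: Ck_is_derive cf Ux|exact: Ck_is_derive cg Ux].
- by move=> v; apply: CkD => //; apply: IH; (exact: CkS || exact: Ck_derive).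
Qed.

Lemma CkN k U f : open U -> Ck k U f -> Ck k U (fun x => - f x).
Proof.
move=> oU cf; apply: (@Ck_eq _ _ _ k U (fun x => -1 * f x)) => // [x _|].
  by rewrite mulN1r.
by apply: CkM => //; exact: Ck_cst.
Qed.

Lemma CkB k U f g : open U -> Ck k U f -> Ck k U g -> Ck k U (fun x => f x - g x).
Proof. by move=> oU cf cg; apply: CkD => //; exact: CkN. Qed.

Lemma CkV k U f : open U -> (forall x, U x -> f x != 0) ->
  Ck k U f -> Ck k U (fun x => (f x)^-1).
Proof.
move=> oU f0; elim: k => [|k IH] cf.
  by split=> // x Ux; apply: cvgV; [exact: f0|exact: Ck_continuous cf Ux].
have cV := IH (CkS cf).
apply: (@Ck_intro _ _ _ k U _ (fun v x => - ((f x)^-1 * (f x)^-1 * 'D_v f x))) => //.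
- by move=> x Ux; apply: cvgV; [exact: f0|exact: Ck_continuous cf Ux].
- move=> x v Ux; have dfx := Ck_is_derive v cf Ux.
  split; first by apply: derivableV; [exact: f0|exact: Ck_derivable cf Ux].
  rewrite deriveV; [|exact: f0|exact: Ck_derivable cf Ux].
  by rewrite scaleNr -exprVn expr2.
- move=> v; apply: CkN => //; apply: CkM => //; first exact: CkM.
  exact: Ck_derive.
Qed.

Lemma Ck_sqrt k U f : open U -> (forall x, U x -> 0 < f x) ->
  Ck k U f -> Ck k U (fun x => Num.sqrt (f x)).
Proof.
move=> oU f0.
have c0 j : Ck j U f -> forall x, U x -> {for x, continuous (fun x => Num.sqrt (f x))}.
  move=> cf x Ux; apply: (@continuous_comp _ _ _ f Num.sqrt).
    exact: Ck_continuous cf Ux.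
  exact: sqrt_continuous.
elim: k => [|k IH] cf; first by split => //; exact: c0 cf.
have cV := IH (CkS cf).
apply: (@Ck_intro _ _ _ k U _ (fun v x => (2 * Num.sqrt (f x))^-1 * 'D_v f x)) => //.
- exact: c0 cf.
- move=> x v Ux; apply: (@is_derive_scomp R V Num.sqrt f).
    exact/is_derive1_sqrt/f0.
  exact: Ck_is_derive cf Ux.
- move=> v; apply: CkM => //; last exact: Ck_derive.
  apply: CkV => // [x Ux|]; first by rewrite mulf_neq0// gt_eqF// sqrtr_gt0 f0.
  by apply: CkM => //; exact: Ck_cst.
Qed.

End Ck_scalar.

Section Ck_rV.
Context {R : realType}.

Lemma coord_cvgP (T : Type) (F : set_system T) (FF : Filter F) (d : nat)
    (f : T -> 'rV[R]_d) (l : 'rV[R]_d) i :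
  f x @[x --> F] --> l -> f x ord0 i @[x --> F] --> l ord0 i.
Proof. by move=> fl; apply: (cvg_comp f (fun y : 'rV[R]_d => y ord0 i) fl); exact: coord_continuous. Qed.

Lemma is_derive_rVP (V : normedModType R) (m : nat) (f : V -> 'rV[R]_m) (x v : V) (D : 'rV[R]_m) :
  is_derive x v f D <-> forall i, is_derive x v (fun y => f y 0 i) (D 0 i).
Proof.
split=> [[df <-] i|H].
  split; first exact: (derivable_mxP _ _ _).1 df _ _.
  by rewrite derive_mx// mxE.
have df : derivable f x v.
  by apply/derivable_mxP => i j; rewrite (ord1 i); have [] := H j.
split=> //; rewrite derive_mx//; apply/rowP => i; rewrite mxE.
by have [] := H i.
Qed.

Lemma Ck_rVP (V : normedModType R) (m k : nat) (U : set V) (f : V -> 'rV[R]_m) :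
  open U -> Ck k U f <-> forall i, Ck k U (fun y => f y 0 i).
Proof.
move=> oU; elim: k f => [|k IH] f.
  split=> [[cf _] i|H]; split => // x Ux.
    by apply: coord_cvgP; exact: cf.
  by apply: cvg_rV => i; have [+ _] := H i; apply.
split=> [cf i|H].
- apply: (@Ck_intro _ _ _ k U _ (fun v x => ('D_v f x) 0 i)) => //.
  + by move=> x Ux; apply: coord_cvgP; exact: Ck_continuous cf Ux.
  + by move=> x v Ux; apply: (is_derive_rVP _ _ _ _).1; exact: Ck_is_derive cf Ux.
  + by move=> v; apply: (IH _).1; exact: Ck_derive.
- apply: (@Ck_intro _ _ _ k U _ (fun v x => \row_i 'D_v (fun y => f y 0 i) x)) => //.
  + by move=> x Ux; apply: cvg_rV => i; exact: Ck_continuous (H i) Ux.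
  + move=> x v Ux; apply/is_derive_rVP => i; rewrite mxE.
    exact: Ck_is_derive (H i) Ux.
  + move=> v; apply/IH => i.
    apply: (@Ck_eq _ _ _ k U (fun x => 'D_v (fun y => f y 0 i) x)) => // [x _|].
      by rewrite mxE.
    exact: Ck_derive.
Qed.

Lemma is_derive_coord (d : nat) (x v : 'rV[R]_d) i :
  is_derive x v (fun y : 'rV[R]_d => y 0 i) (v 0 i).
Proof. by move: i; apply/is_derive_rVP; exact: is_derive_id. Qed.

Lemma Ck_coord (d k : nat) (U : set 'rV[R]_d) i : open U -> Ck k U (fun y : 'rV[R]_d => y 0 i).
Proof.
move=> oU; case: k => [|k]; first by split => // x _; exact: coord_continuous.
apply: (@Ck_intro _ _ _ k U _ (fun v x => v 0 i)) => //.
- by move=> x _; exact: coord_continuous.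
- by move=> x v _; exact: is_derive_coord.
- by move=> v; exact: Ck_cst.
Qed.

Lemma Ck_is_diff (d k : nat) (U : set 'rV[R]_d) (f : 'rV[R]_d -> R) x :
  open U -> Ck k.+1 U f -> U x ->
  is_diff x f (dotv (\row_i 'D_(delta_mx 0 i) f x)).
Proof.
move=> oU cf Ux; apply: (@C1_is_diff _ _ f (fun i => 'D_(delta_mx 0 i) f)).
  apply: (near_open oU Ux) => y Uy i; exact: Ck_is_derive cf Uy.
by move=> i; apply: Ck_continuous Ux; exact: (Ck_derive _ cf).
Qed.

Lemma Ck_deriveE (d k : nat) (U : set 'rV[R]_d) (f : 'rV[R]_d -> R) x v :
  open U -> Ck k.+1 U f -> U x ->
  'D_v f x = \sum_i v 0 i * 'D_(delta_mx 0 i) f x.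
Proof.
move=> oU cf Ux; have [df dE] := Ck_is_diff oU cf Ux.
rewrite deriveE// dE /dotv; apply: eq_bigr => i _.
by rewrite mxE mulrC.
Qed.

Lemma Ck_rV_differentiable (d m k : nat) (U : set 'rV[R]_d) (f : 'rV[R]_d -> 'rV[R]_m) x :
  open U -> Ck k.+1 U f -> U x -> differentiable f x.
Proof.
move=> oU cf Ux.
have -> : f = \sum_(i < m) (fun y => f y 0 i *: (delta_mx 0 i : 'rV[R]_m)).
  apply/funext => y; rewrite fct_sumE; exact: row_sum_delta.
apply: differentiable_sum => i; apply: differentiableZl.
by have [] := Ck_is_diff oU ((Ck_rVP _ _ oU).1 cf i) Ux.
Qed.

Lemma is_derive_comp (d m k : nat) (U : set 'rV[R]_m) (f : 'rV[R]_m -> R)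
    (g : 'rV[R]_d -> 'rV[R]_m) x v (w : 'rV[R]_m) :
  open U -> Ck k.+1 U f -> U (g x) -> is_derive x v g w -> differentiable g x ->
  is_derive x v (f \o g) (\sum_i w 0 i * 'D_(delta_mx 0 i) f (g x)).
Proof.
move=> oU cf Ugx [dg gw] diffg.
have [df dE] := Ck_is_diff oU cf Ugx.
have dfg : differentiable (f \o g) x by exact: differentiable_comp.
split; first exact: diff_derivable.
rewrite deriveE// diff_comp// dE /= -deriveE// gw.
by rewrite /dotv; apply: eq_bigr => i _; rewrite mxE mulrC.
Qed.

Lemma Ck_comp (d m k : nat) (U : set 'rV[R]_d) (O : set 'rV[R]_m)
    (f : 'rV[R]_m -> R) (g : 'rV[R]_d -> 'rV[R]_m) :
  open U -> open O -> (forall x, U x -> O (g x)) ->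
  Ck k O f -> Ck k U g -> Ck k U (fun x => f (g x)).
Proof.
move=> oU oO UO.
have c0 j f' : Ck j O f' -> Ck j U g -> forall x, U x -> {for x, continuous (f' \o g)}.
  move=> cf cg x Ux; apply: continuous_comp; first exact: Ck_continuous cg Ux.
  by apply: Ck_continuous cf _; exact: UO.
elim: k f => [|k IH] f cf cg; first by split => //; exact: c0 cf cg.
apply: (@Ck_intro _ _ _ k U _ (fun v x => \sum_i ('D_v g x) 0 i * 'D_(delta_mx 0 i) f (g x))) => //.
- exact: c0 cf cg.
- move=> x v Ux; apply: (is_derive_comp oO cf (UO _ Ux)); first exact: Ck_is_derive cg Ux.
  exact: Ck_rV_differentiable cg Ux.
- move=> v; apply: Ck_sum => // i; apply: CkM => //.
    by apply: (Ck_rVP _ _ oU).1; exact: Ck_derive.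
  by apply: (IH (fun y => 'D_(delta_mx 0 i) f y)); [exact: Ck_derive|exact: CkS].
Qed.

End Ck_rV.

(** * Symmetry of second derivatives *)

Section schwarz.
Context {R : realType} {V : normedModType R}.

(** The mean value theorem is applied twice: in the direction [v] to the increment of [f] along [w],
    then in the direction [w] to ['D_v f]. Continuity of the iterated derivative bounds the
    error. *)
Lemma second_difference (f : V -> R) (U : set V) x v w (e : R) :
  open U -> Ck 2 U f -> U x -> 0 < e ->
  exists2 r : R, 0 < r & forall h : R, 0 < h -> h <= r ->
    `|f (x + h *: v + h *: w) - f (x + h *: v) - f (x + h *: w) + f x
      - h * (h * 'D_w ('D_v f) x)| <= e * h * h.
Proof.
move=> oU cf Ux e0.
have cDv := Ck_derive v cf.
have cD2 := Ck_derive w cDv.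
have : \forall y \near x, U y /\ `|'D_w ('D_v f) y - 'D_w ('D_v f) x| <= e.
  apply: filterI; first exact: open_nbhs_nbhs.
  have H := (continuous_distP _ _).1 (Ck_continuous cD2 Ux) _ e0.
  by apply: filterS H => y yx; rewrite distrC; exact: ltW yx.
move=> /nbhs_ballP[r /= r0 rP].
pose C := `|v| + `|w| + 1.
have C0 : 0 < C by rewrite ltr_wpDl// addr_ge0.
exists (r / C / 2); first by rewrite !divr_gt0.
move=> h h0 hr.
have near_x (s t : R) : `|s| <= `|h| -> `|t| <= `|h| -> ball x r (x + s *: v + t *: w).
  rewrite (gtr0_norm h0) => sh th; rewrite -ball_normE /= -addrA opprD addrA subrr add0r normrN.
  apply: le_lt_trans (ler_normD _ _) _; rewrite !normrZ.
  apply: (@le_lt_trans _ _ (h * C)).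
    rewrite /C !mulrDr mulr1 -[leLHS]addr0; apply: lerD; last exact: ltW.
    by apply: lerD; apply: ler_wpM2r.
  apply: (@le_lt_trans _ _ (r / C / 2 * C)); first by rewrite ler_wpM2r// ltW.
  rewrite mulrAC divfK ?gt_eqF// ltr_pdivrMr// ltr_pMr// ltr1n.
  by [].
have inner (s : R) : `|s| <= `|h| ->
    `|'D_v f (x + s *: v + h *: w) - 'D_v f (x + s *: v) - h * 'D_w ('D_v f) x| <= e * `|h|.
  move=> sh.
  have := @mvt_bound R (fun t => 'D_v f (x + s *: v + t *: w))
    (fun t => 'D_w ('D_v f) (x + s *: v + t *: w)) h ('D_w ('D_v f) x) e.
  rewrite scale0r addr0; apply.
  - move=> t th; apply: (@is_derive_line R V R ('D_v f) (x + s *: v) w t).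
    apply: Ck_is_derive cDv _.
    by have [] := rP _ (near_x _ _ sh th).
  - by move=> t th; have [] := rP _ (near_x _ _ sh th).
rewrite [X in `|X|](_ : _ = f (x + h *: v + h *: w) - f (x + h *: v) -
   (f (x + h *: w) - f x) - h * (h * 'D_w ('D_v f) x)); last by ring.
have -> : e * h * h = e * h * `|h| by rewrite (gtr0_norm h0).
have := @mvt_bound R (fun s => f (x + s *: v + h *: w) - f (x + s *: v))
    (fun s => 'D_v f (x + s *: v + h *: w) - 'D_v f (x + s *: v)) h (h * 'D_w ('D_v f) x) (e * h).
rewrite scale0r addr0; apply.
- move=> s sh; apply: is_deriveB.
    have -> : (fun s0 : R => f (x + s0 *: v + h *: w)) = (fun s0 : R => f (x + h *: w + s0 *: v)).
      by apply/funext => s0; rewrite addrAC.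
    apply: is_derive_line; rewrite addrAC; apply: Ck_is_derive cf _.
    by have [] := rP _ (near_x _ _ sh (lexx _)).
  apply: is_derive_line; apply: Ck_is_derive cf _.
  have := near_x s 0 sh; rewrite scale0r addr0 normr0 normr_ge0 => /(_ isT).
  by move=> /rP[].
- by move=> s sh; have := inner s sh; rewrite (gtr0_norm h0).
Qed.

(** The second difference is symmetric in [v] and [w], and after division by h^2 both iterated
    derivatives are its limit. *)
Lemma derive_comm (f : V -> R) (U : set V) x v w : open U -> Ck 2 U f -> U x ->
  'D_w ('D_v f) x = 'D_v ('D_w f) x.
Proof.
move=> oU cf Ux; apply/eqP; rewrite -subr_eq0 -normr_le0; apply/ler_addgt0Pr => e e0.
rewrite add0r.
have e2 : 0 < e / 2 by rewrite divr_gt0.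
have [r1 r10 H1] := second_difference v w oU cf Ux e2.
have [r2 r20 H2] := second_difference w v oU cf Ux e2.
pose h := Num.min r1 r2.
have h0 : 0 < h by rewrite lt_min r10.
have := H1 h h0; rewrite ge_min lexx => /(_ isT).
have := H2 h h0; rewrite ge_min lexx orbT => /(_ isT).
rewrite (_ : x + h *: w + h *: v = x + h *: v + h *: w); last by rewrite addrAC.
set a := f _; set b := f _; set c := f _; set D1 := 'D_w _ _; set D2 := 'D_v _ _.
move=> B2 B1.
have : `|h * (h * D1) - h * (h * D2)| <= e * (h * h).
  rewrite [X in `|X|](_ : _ = (a - b - c + f x - h * (h * D2)) - (a - c - b + f x - h * (h * D1))); last by ring.
  apply: le_trans (ler_normB _ _) _.
  apply: le_trans (lerD B2 B1) _.
  by rewrite le_eqVlt; apply/orP; left; apply/eqP; field.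
rewrite -!mulrBr !normrM (gtr0_norm h0) mulrA [leRHS]mulrC ler_pM2l//.
by rewrite mulr_gt0.
Qed.

End schwarz.

(** * The gauge of a convex body *)

Definition gauge {R : realType} {V : normedModType R} (Om : set V) (x : V) : R :=
  inf [set s | 0 < s /\ Om (s^-1 *: x)].

Section gauge_theory.
Context {R : realType} {V : normedModType R}.
Variable Om : set V.
Hypothesis openOm : open Om.
Hypothesis convOm : convex_set Om.
Hypothesis bndOm : bounded_set Om.
Hypothesis Om0 : Om 0.
Local Notation g := (gauge Om).

Lemma convex_setP x y (t : R) : 0 <= t -> t <= 1 -> Om x -> Om y ->
  Om (t *: x + (1 - t) *: y).
Proof.
move=> t0 t1 xO yO.
have tI : Itv.spec (Itv.num_sem (R := R)) (Itv.Real `[0%Z, 1%Z]) t.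
  by rewrite /= /Itv.num_sem /= num_real in_itv /= t0 t1.
have := convOm (Itv.mk tI : {i01 R}) (mem_set xO) (mem_set yO).
by rewrite inE.
Qed.

Let gset x : set R := [set s | 0 < s /\ Om (s^-1 *: x)].

Lemma absorbing_ball : exists2 e : R, 0 < e & forall x, `|x| < e -> Om x.
Proof.
have /nbhs_ballP[e /= e0 eO] : nbhs (0 : V) Om by exact: open_nbhs_nbhs.
by exists e => // x xe; apply: eO; rewrite -ball_normE /= sub0r normrN.
Qed.

Lemma gset_up x s t : gset x s -> s <= t -> gset x t.
Proof.
move=> [s0 sO] st; have t0 : 0 < t by apply: lt_le_trans st.
split=> //; have := @convex_setP (s^-1 *: x) 0 (s / t) _ _ sO Om0.
rewrite scaler0 addr0 scalerA mulrAC divff ?gt_eqF// mul1r; apply.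
  by rewrite divr_ge0// ltW.
by rewrite ler_pdivrMr// mul1r.
Qed.

Lemma gset_inf x : has_inf (gset x).
Proof.
split; last by exists 0 => s [/ltW].
have [e e0 eO] := absorbing_ball.
exists ((`|x| + 1) / e); split; first by rewrite divr_gt0// ltr_wpDl.
apply: eO; rewrite normrZ invf_div ger0_norm; last by rewrite divr_ge0// ?ltW// addr_ge0.
rewrite mulrAC ltr_pdivrMr ?ltr_wpDl// ltr_pM2l// ltrDl//.
Qed.

(** The defining set of the infimum is upward closed, which gives membership; conversely openness of
    [Om] leaves room to lower [s]. Strict comparison is thus membership in a dilate of [Om], and
    most later properties of the gauge go through this equivalence. *)
Lemma gauge_ltP x s : 0 < s -> g x < s <-> Om (s^-1 *: x).
Proof.
move=> s0; split=> [gs|sO].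
  have [t tx ts] : exists2 t, gset x t & t < s.
    have sg : 0 < s - g x by rewrite subr_gt0.
    have [t tx tg] := inf_adherent sg (gset_inf x).
    by exists t => //; move: tg; rewrite addrC subrK.
  by have [] := gset_up tx (ltW ts).
have /nbhs_ballP[e /= e0 eO] : nbhs (s^-1 *: x) Om by exact: open_nbhs_nbhs.
(* Small enough that [(s^-1 + d) *: x] stays in the ball of radius [e], so 1 / (1/s + d), which is
   below [s], is still admissible. *)
pose d := e / (`|x| + 1) / 2.
have x1 : 0 < `|x| + 1 by rewrite ltr_wpDl.
have d0 : 0 < d by rewrite !divr_gt0.
have sd : 0 < s^-1 + d by rewrite addr_gt0// invr_gt0.
apply: (@le_lt_trans _ _ (s^-1 + d)^-1); last first.
  by rewrite -[ltRHS]invrK ltf_pV2 ?posrE ?invr_gt0// ltrDl.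
apply: ge_inf; first by have [] := gset_inf x.
split; first by rewrite invr_gt0.
rewrite invrK; apply: eO; rewrite -ball_normE /= -scalerBl opprD addrA subrr add0r.
rewrite normrZ normrN (gtr0_norm d0).
apply: (@le_lt_trans _ _ (d * (`|x| + 1))); first by rewrite ler_pM2l// lerDl.
by rewrite /d mulrAC divfK ?gt_eqF// ltr_pdivrMr// ltr_pMr// ltr1n.
Qed.

Lemma gauge_ge0 x : 0 <= g x.
Proof. by apply: lb_le_inf; [have [] := gset_inf x|move=> s [/ltW]]. Qed.

Lemma gauge_lt1 x : Om x <-> g x < 1.
Proof. by rewrite gauge_ltP// invr1 scale1r. Qed.

Lemma gaugeZ_le x (c : R) : 0 < c -> g (c *: x) <= c * g x.
Proof.
move=> c0; apply/ler_addgt0Pr => e e0; apply/ltW.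
have s0 : 0 < c * g x + e by rewrite ltr_wpDl// mulr_ge0 ?gauge_ge0// ltW.
apply/gauge_ltP => //; rewrite scalerA.
have -> : (c * g x + e)^-1 * c = ((c * g x + e) / c)^-1 by rewrite invf_div mulrC.
apply/gauge_ltP; first by rewrite divr_gt0.
by rewrite ltr_pdivlMr// mulrC ltrDl.
Qed.

Lemma gaugeZ x (c : R) : 0 < c -> g (c *: x) = c * g x.
Proof.
move=> c0; apply/eqP; rewrite eq_le gaugeZ_le//=.
rewrite -ler_pdivlMl//.
have ci : 0 < c^-1 by rewrite invr_gt0.
by have := gaugeZ_le (c *: x) ci; rewrite scalerA mulVf ?gt_eqF// scale1r.
Qed.

(** (x + y) / (s + t) is the convex combination of x / s and y / t with weight s / (s + t). *)
Lemma gaugeD x y : g (x + y) <= g x + g y.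
Proof.
apply/ler_addgt0Pr => e e0; apply/ltW.
pose s := g x + e / 2; pose t := g y + e / 2.
have e2 : 0 < e / 2 by rewrite divr_gt0.
have s0 : 0 < s by rewrite ltr_wpDl// gauge_ge0.
have t0 : 0 < t by rewrite ltr_wpDl// gauge_ge0.
have -> : g x + g y + e = s + t by rewrite /s /t; field.
have st0 : 0 < s + t by rewrite addr_gt0.
apply/gauge_ltP => //.
have -> : (s + t)^-1 *: (x + y) = (s / (s + t)) *: (s^-1 *: x) + (1 - s / (s + t)) *: (t^-1 *: y).
  by rewrite scalerDr !scalerA; congr (_ *: _ + _ *: _); field; rewrite !gt_eqF.
apply: convex_setP.
- by rewrite divr_ge0// ltW.
- by rewrite ler_pdivrMr// mul1r lerDl ltW.
- by apply/gauge_ltP => //; rewrite ltrDl.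
- by apply/gauge_ltP => //; rewrite ltrDl.
Qed.

Lemma gauge_le_norm : exists2 C : R, 0 < C & forall x, g x <= C * `|x|.
Proof.
have [e e0 eO] := absorbing_ball.
exists e^-1; first by rewrite invr_gt0.
move=> x; apply/ler_addgt0Pr => d d0; apply/ltW.
have s0 : 0 < e^-1 * `|x| + d by rewrite ltr_wpDl// mulr_ge0// invr_ge0 ltW.
apply/gauge_ltP => //; apply: eO; rewrite normrZ gtr0_norm ?invr_gt0//.
rewrite mulrC ltr_pdivrMr// mulrDr mulrA divff ?gt_eqF// mul1r ltrDl.
by rewrite mulr_gt0.
Qed.

Lemma norm_le_gauge : exists2 M : R, 0 < M & forall x, `|x| <= M * g x.
Proof.
have [M [_ MO]] := bndOm.
pose M' := Num.max M 0 + 1.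
have M'0 : 0 < M' by rewrite ltr_wpDl// le_max lexx orbT.
have {}MO x : Om x -> `|x| <= M'.
  by apply: MO; rewrite /M' (le_lt_trans (_ : M <= Num.max M 0)) ?ltrDl// le_max lexx.
exists M' => // x; apply/ler_addgt0Pr => e e0.
have s0 : 0 < g x + e / M' by rewrite ltr_wpDl ?gauge_ge0// divr_gt0.
have /gauge_ltP : g x < g x + e / M' by rewrite ltrDl divr_gt0.
move=> /(_ s0)/MO; rewrite normrZ gtr0_norm ?invr_gt0//.
by rewrite mulrC ler_pdivrMr// mulrDr mulrCA divff ?gt_eqF// mulr1.
Qed.

Lemma gauge_gt0 x : x != 0 -> 0 < g x.
Proof.
move=> x0; have [M M0 H] := norm_le_gauge.
have : 0 < M * g x by apply: lt_le_trans (H x); rewrite normr_gt0.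
by rewrite pmulr_rgt0.
Qed.

Lemma gauge0 : g 0 = 0.
Proof.
have [C C0 H] := gauge_le_norm; apply/eqP; rewrite eq_le gauge_ge0 andbT.
by apply: le_trans (H 0) _; rewrite normr0 mulr0.
Qed.

Lemma gauge_lipschitz : exists2 C : R, 0 < C & forall x y, `|g x - g y| <= C * `|x - y|.
Proof.
have [C C0 H] := gauge_le_norm; exists C => // x y.
have h a b : g a - g b <= C * `|a - b|.
  rewrite lerBlDr -{1}[a](subrK b); apply: le_trans (gaugeD _ _) _.
  by rewrite lerD2r.
rewrite ler_norml h andbT lerNl opprB distrC; exact: h.
Qed.

Lemma gauge_continuous : continuous g.
Proof.
have [C C0 H] := gauge_lipschitz => x; apply/continuous_distP => e e0.
apply: filterS (near_dist x (divr_gt0 e0 C0)) => y xy.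
by apply: le_lt_trans (H x y) _; rewrite mulrC -ltr_pdivlMr.
Qed.

Lemma closure_gauge : closure Om = [set x | g x <= 1].
Proof.
apply/seteqP; split => x /=.
  have : closed [set x | g x <= 1].
    apply: (@closed_comp _ _ g [set t | t <= 1]); last exact: closed_le.
    by move=> y _; exact: gauge_continuous.
  move=> cg Ox; apply: cg; apply: closureS Ox => y /gauge_lt1; exact: ltW.
move=> gx B /nbhs_ballP[e /= e0 eB].
pose d := e / (`|x| + 1) / 2.
have x1 : 0 < `|x| + 1 by rewrite ltr_wpDl.
have d0 : 0 < d by rewrite !divr_gt0.
have d1 : 0 < 1 + d by rewrite addr_gt0.
exists ((1 + d)^-1 *: x); split.
  apply/gauge_ltP => //; apply: le_lt_trans gx _; by rewrite ltrDl.
apply: eB; rewrite -ball_normE /= -{1}[x]scale1r -scalerBl normrZ.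
have -> : 1 - (1 + d)^-1 = d / (1 + d) by field; rewrite gt_eqF.
rewrite gtr0_norm ?divr_gt0//.
apply: (@le_lt_trans _ _ (d * (`|x| + 1))).
  rewrite -mulrA ler_pM2l//; apply: (@le_trans _ _ `|x|); last by rewrite lerDl.
  by rewrite ler_pdivrMl// ler_peMl// lerDl ltW.
by rewrite /d mulrAC divfK ?gt_eqF// ltr_pdivrMr// ltr_pMr// ltr1n.
Qed.

Lemma boundary_gauge : boundary Om = [set x | g x = 1].
Proof.
rewrite /boundary closure_gauge (interior_id _).1//.
apply/seteqP; split=> x /=.
  move=> [g1 Ox]; apply/eqP; rewrite eq_le g1 /= leNgt; apply/negP => /gauge_lt1.
  exact: Ox.
by move=> gx; rewrite gx lexx; split => // /gauge_lt1; rewrite gx ltxx.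
Qed.

End gauge_theory.

(** * Transversality to a hypersurface *)

Section hypersurface_transversality.
Context {R : realType}.

Lemma is_derive_small (V W : normedModType R) (f : V -> W) (x v : V) (D : W) (e : R) :
  is_derive x v f D -> 0 < e ->
  exists2 r : R, 0 < r & forall t, `|t| < r -> `|f (x + t *: v) - f x - t *: D| <= e * `|t|.
Proof.
move=> [df <-] e0.
have /cvgrPdist_le /(_ e e0) := df.
rewrite /dnbhs /within => /nbhs_ballP[r /= r0 rP].
exists r => // t tr; have [->|t0] := eqVneq t 0.
  by rewrite !scale0r addr0 !subrr !normr0 mulr0.
have := rP t; rewrite -ball_normE /= sub0r normrN => /(_ tr t0).
rewrite [t *: v + x]addrC.
have -> : f (x + t *: v) - f x - t *: 'D_v f x =
   - (t *: ('D_v f x - t^-1 *: (f (x + t *: v) - f x))).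
  by rewrite scalerBr scalerA divff// scale1r opprB.
by rewrite normrN normrZ mulrC => h; apply: ler_wpM2r.
Qed.

Lemma is_derive_of_small (V W : normedModType R) (f : V -> W) (x v : V) (D : W) :
  (forall e : R, 0 < e -> exists2 r : R, 0 < r &
     forall t, `|t| < r -> `|f (x + t *: v) - f x - t *: D| <= e * `|t|) ->
  is_derive x v f D.
Proof.
move=> H.
suff cv : h^-1 *: ((f \o shift x) (h *: v) - f x) @[h --> 0^'] --> D.
  by split; [apply/cvg_ex; exists D|exact: cvg_lim cv].
apply/cvgrPdist_le => e e0; have [r r0 rP] := H e e0.
rewrite /dnbhs /within; apply/nbhs_ballP; exists r => //= t.
rewrite -ball_normE /= sub0r normrN => tr t0.
have t1 : 0 < `|t| by rewrite normr_gt0.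
have := rP t tr; rewrite [t *: v + x]addrC.
have -> : f (x + t *: v) - f x - t *: D = - (t *: (D - t^-1 *: (f (x + t *: v) - f x))).
  by rewrite scalerBr scalerA divff// scale1r opprB.
by rewrite normrN normrZ mulrC ler_pM2r.
Qed.

Lemma is_diff_small (V W : normedModType R) (f L : V -> W) (x : V) (e : R) :
  is_diff x f L -> 0 < e ->
  exists2 r : R, 0 < r & forall h, `|h| < r -> `|f (x + h) - f x - L h| <= e * `|h|.
Proof.
move=> [/diff_locallyP[_ /eqaddoP H] <-] e0.
have /nbhs_ballP[r /= r0 rP] := H _ e0.
exists r => // h hr; have := rP h; rewrite -ball_normE /= sub0r normrN => /(_ hr).
by rewrite !fctE /= opprD addrA [h + x]addrC.
Qed.

(** [y] is close to t a and [x] to -t a, each with error at most half of t |a|; the conclusion has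
    the form that the intermediate value theorem requires. *)
Lemma opposite_signs (a t x y : R) : a != 0 -> 0 < t ->
  `|y - t * a| <= `|a| / 2 * t -> `|x + t * a| <= `|a| / 2 * t ->
  Num.min x y <= 0 <= Num.max x y.
Proof.
move=> a0 t0; rewrite ge_min le_max !ler_norml => /andP[b1 b2] /andP[c1 c2].
have [as0|as0|as0] := ltgtP a 0; last by rewrite as0 eqxx in a0.
+ have ta : 0 < t * - a by rewrite mulr_gt0// oppr_gt0.
  rewrite (ltr0_norm as0) in b1 b2 c1 c2.
  by apply/andP; split; apply/orP; [right|left]; lra.
+ have ta : 0 < t * a by rewrite mulr_gt0.
  rewrite (gtr0_norm as0) in b1 b2 c1 c2.
  by apply/andP; split; apply/orP; [left|right]; lra.
Qed.

Context {n : nat}.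
Local Notation E := 'rV[R]_n.+1.
Implicit Types (S : set E) (p z v : E) (rho : E -> R).

Lemma local_equation_deriveD S p V rho a v w : local_equation S p V rho ->
  'D_(a *: v + w) rho p = a * 'D_v rho p + 'D_w rho p.
Proof.
case=> oV Vp sm _ _; rewrite !(Ck_deriveE (k := 0) _ oV (sm 1%N) Vp).
rewrite mulr_sumr -big_split /=; apply: eq_bigr => i _.
by rewrite !mxE mulrDl mulrA.
Qed.

(* If a truncated open cone with apex p misses S, its axis is transversal to S:
   otherwise rho changes sign inside the cone, and vanishes there. *)
Lemma cone_transversal S p V rho z (d tau : R) : local_equation S p V rho -> S p ->
  0 < d -> 0 < tau ->
  (forall (t : R) b, 0 < t -> t < tau -> `|b| < d -> ~ S (p + t *: (z + b))) ->
  'D_z rho p != 0.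
Proof.
move=> leq Sp d0 tau0 H; apply/eqP => Dz0.
have [oV Vp sm SV reg] := leq.
have rp : rho p = 0 by have : (S `&` V) p by []; rewrite SV => -[].
have [w Dw] := reg p (conj Sp Vp).
(* Tilting the axis by [eps *: w] in either direction stays inside the cone, and as ['D_z rho p] is
   assumed to vanish, the derivatives along the two tilted axes are opposite and nonzero. *)
pose eps := d / (`|w| + 1) / 2.
have w1 : 0 < `|w| + 1 by rewrite ltr_wpDl.
have eps0 : 0 < eps by rewrite !divr_gt0.
have epsw : `|eps *: w| < d.
  rewrite normrZ (gtr0_norm eps0); apply: (@le_lt_trans _ _ (eps * (`|w| + 1))).
    by rewrite ler_pM2l// lerDl.
  by rewrite /eps mulrAC divfK ?gt_eqF// ltr_pdivrMr// ltr_pMr// ltr1n.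
pose a := eps * 'D_w rho p.
have a0 : a != 0 by rewrite mulf_neq0// gt_eqF.
have Dp : 'D_(eps *: w + z) rho p = a by rewrite (local_equation_deriveD _ _ _ leq) Dz0 addr0.
have Dm : 'D_((- eps) *: w + z) rho p = - a by rewrite (local_equation_deriveD _ _ _ leq) Dz0 addr0 mulNr.
have a2 : 0 < `|a| / 2 by rewrite divr_gt0// normr_gt0.
have [r1 r10 H1] := is_derive_small (Ck_is_derive (eps *: w + z) (sm 1%N) Vp) a2.
have [r2 r20 H2] := is_derive_small (Ck_is_derive ((- eps) *: w + z) (sm 1%N) Vp) a2.
have {}H1 (t : R) : `|t| < r1 ->
    `|rho (p + t *: (eps *: w + z)) - t * a| <= `|a| / 2 * `|t|.
  by move=> /H1; rewrite Dp rp subr0.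
have {}H2 (t : R) : `|t| < r2 ->
    `|rho (p + t *: ((- eps) *: w + z)) - t * - a| <= `|a| / 2 * `|t|.
  by move=> /H2; rewrite Dm rp subr0.
have /nbhs_ballP[r3 /= r30 r3V] : nbhs p V by exact: open_nbhs_nbhs.
pose C := `|z| + d.
have C0 : 0 < C by rewrite ltr_wpDl.
pose t := Num.min (Num.min r1 r2) (Num.min (r3 / C) tau) / 2.
pose t' := Num.min (Num.min r1 r2) (Num.min (r3 / C) tau).
have t'0 : 0 < t' by rewrite !lt_min r10 r20 tau0 divr_gt0.
have t0 : 0 < t by rewrite divr_gt0.
have tt' : t < t' by rewrite ltr_pdivrMr// ltr_pMr// ltr1n.
have [t1 t2 t3 t4] : [/\ t < r1, t < r2, t < r3 / C & t < tau].
  by move: tt'; rewrite !lt_min => /andP[/andP[-> ->] /andP[-> ->]].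
have inV b : `|b| < d -> V (p + t *: (z + b)).
  move=> bd; apply: r3V; rewrite -ball_normE /= opprD addrA subrr add0r normrN normrZ.
  rewrite (gtr0_norm t0); apply: (@le_lt_trans _ _ (t * C)).
    by rewrite ler_pM2l// (le_trans (ler_normD _ _))// lerD2l ltW.
  by rewrite -ltr_pdivlMr.
have nz b : `|b| < d -> rho (p + t *: (z + b)) != 0.
  move=> bd; apply/eqP => r0; apply: (H t b t0 t4 bd).
  have : ([set x | rho x = 0] `&` V) (p + t *: (z + b)) by split => //; exact: inV.
  by rewrite -SV => -[].
pose phi (th : R) := rho (p + t *: (z + th *: (eps *: w))).
have small (th : R) : -1 <= th <= 1 -> `|th *: (eps *: w)| < d.
  move=> th1; rewrite normrZ; apply: le_lt_trans epsw.
  by rewrite -[leRHS]mul1r ler_wpM2r// ler_norml.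
have cphi : {within `[(-1 : R), 1], continuous phi}.
  apply: continuous_in_subspaceT => th; rewrite inE /= in_itv /= => th1.
  apply: (@continuous_comp _ _ _ (fun th : R => p + t *: (z + th *: (eps *: w))) rho).
    apply: cvgD; first exact: cvg_cst.
    apply: cvgZr; apply: cvgD; first exact: cvg_cst.
    by apply: cvgZl; exact: cvg_id.
  by apply: Ck_continuous (sm 0) _; apply: inV; exact: small.
have B1 : `|phi 1 - t * a| <= `|a| / 2 * t.
  have := H1 t; rewrite (gtr0_norm t0) => /(_ t1).
  by rewrite /phi scale1r [z + _]addrC.
have B2 : `|phi (-1) + t * a| <= `|a| / 2 * t.
  have := H2 t; rewrite (gtr0_norm t0) => /(_ t2).
  by rewrite /phi scaleN1r [z + _]addrC scaleNr mulrN opprK.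
have ta : 0 < t * `|a| by rewrite mulr_gt0 ?normr_gt0.
have [||c] := @IVT R phi (-1) 1 0 _ cphi.
- by [].
- exact: opposite_signs a0 t0 B1 B2.
- rewrite in_itv /= => cI /eqP; apply/negP; exact/nz/small.
Qed.

End hypersurface_transversality.

(** * Smoothness of the gauge off the origin *)

Section gauge_smooth.
Context {R : realType} {n : nat}.
Local Notation E := 'rV[R]_n.+1.
Variable Om : set E.
Hypothesis openOm : open Om.
Hypothesis convOm : convex_set Om.
Hypothesis bndOm : bounded_set Om.
Hypothesis Om0 : Om 0.
Hypothesis smOm : smooth_hypersurface (boundary Om).
Local Notation g := (gauge Om).
Implicit Types (p v x : E) (rho : E -> R).

Let Sig : boundary Om = [set x | g x = 1]. Proof. exact: boundary_gauge. Qed.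

(** The cone around the ray through [p] misses the boundary beyond [p]: subadditivity gives g(p + t
    (p + b)) >= 1 + t - t g(-b), which exceeds 1 as soon as g(-b) < 1. *)
Lemma radial_transversal p V rho : local_equation (boundary Om) p V rho ->
  boundary Om p -> 'D_p rho p != 0.
Proof.
move=> leq Sp.
have [C C0 HC] := gauge_le_norm openOm convOm Om0.
have gp : g p = 1 by move: Sp; rewrite Sig.
apply: (cone_transversal (d := C^-1) (tau := 1) leq Sp) => //; first by rewrite invr_gt0.
move=> t b t0 t1 bC; rewrite Sig /= => gx.
have gb : g (- b) < 1.
  by apply: le_lt_trans (HC _) _; rewrite normrN mulrC -ltr_pdivlMr// mul1r.
have e : (1 + t) *: p = (p + t *: (p + b)) + t *: (- b).
  by rewrite scalerDl scale1r scalerDr scalerN addrA addrK.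
have := gaugeD openOm convOm Om0 (p + t *: (p + b)) (t *: (- b)).
rewrite -e !gaugeZ//; last lra.
rewrite gp gx mulr1 lerD2l => h.
have : t * g (- b) < t * 1 by rewrite ltr_pM2l.
lra.
Qed.

Lemma projection_boundary x : x != 0 -> boundary Om ((g x)^-1 *: x).
Proof.
move=> x0; have gx : 0 < g x by exact: gauge_gt0.
by rewrite Sig /= gaugeZ ?invr_gt0// mulVf// gt_eqF.
Qed.

(* Differentiate rho (x / g x) = 0, using that g is Lipschitz. *)
Lemma gauge_is_derive_boundary p V rho v : local_equation (boundary Om) p V rho ->
  boundary Om p -> is_derive p v g ('D_v rho p / 'D_p rho p).
Proof.
move=> leq Sp.
have Dp := radial_transversal leq Sp.
have gp : g p = 1 by move: Sp; rewrite Sig.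
have [oV Vp sm SV reg] := leq.
have rp : rho p = 0 by have : (boundary Om `&` V) p by []; rewrite SV => -[].
have p0 : p != 0 by apply: contra_eq_neq gp => ->; rewrite gauge0// eq_sym oner_eq0.
have [L L0 HL] := gauge_lipschitz openOm convOm Om0.
have dv : 'D_v rho p = dotv (\row_i 'D_(delta_mx 0 i) rho p) v.
  rewrite (Ck_deriveE (k := 0) v oV (sm 1%N) Vp) /dotv.
  by apply: eq_bigr => i _; rewrite mxE mulrC.
have dp : 'D_p rho p = dotv (\row_i 'D_(delta_mx 0 i) rho p) p.
  rewrite (Ck_deriveE (k := 0) p oV (sm 1%N) Vp) /dotv.
  by apply: eq_bigr => i _; rewrite mxE mulrC.
apply: is_derive_of_small => e e0.
pose K := `|v| + L * `|v| * `|p| + 1.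
have K0 : 0 < K by rewrite ltr_wpDl// addr_ge0// !mulr_ge0// ltW.
(* Calibrated so that 2 e' (2 K) = e |D_p rho|: the factor 2 bounds [G], and 2 K |t| bounds the
   displacement [h]. *)
pose e' := e * `|'D_p rho p| / (2 * K) / 2.
have e'0 : 0 < e' by rewrite !divr_gt0 ?mulr_gt0 ?normr_gt0.
have [r1 r10 H1] := is_diff_small (Ck_is_diff oV (sm 1%N) Vp) e'0.
have /nbhs_ballP[r2 /= r20 r2V] : nbhs p V by exact: open_nbhs_nbhs.
pose r := Num.min (r1 / (2 * K)) (Num.min (r2 / (2 * K)) (1 / (2 * (L * `|v| + 1)))).
have Lv : 0 < L * `|v| + 1 by rewrite ltr_wpDl// mulr_ge0// ltW.
have r0 : 0 < r by rewrite !lt_min !divr_gt0 ?mulr_gt0.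
exists r => // t; rewrite !lt_min => /and3P[tr1 tr2 tr3].
pose G := g (p + t *: v).
have HG : `|G - 1| <= L * `|v| * `|t|.
  rewrite -gp; apply: le_trans (HL _ _) _.
  by rewrite [p + _]addrC addrK normrZ [`|t| * _]mulrC mulrA.
have [G2 G3] : 2^-1 <= G /\ G <= 2.
  have : `|G - 1| <= 2^-1.
    apply: le_trans HG _; rewrite ltr_pdivlMr ?mulr_gt0// in tr3.
    have : L * `|v| * `|t| <= (L * `|v| + 1) * `|t| by rewrite ler_wpM2r// lerDl.
    move: tr3; rewrite mulrCA [`|t| * _]mulrC; lra.
  by rewrite ler_norml => /andP[? ?]; split; lra.
have G0 : 0 < G by apply: lt_le_trans G2.
(* The displacement from [p] to the radial projection of [p + t *: v]. That projection lies on the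
   boundary, so [rho] vanishes there, and G times the linear part of [rho] at [h] is t D_v rho + (1
   - G) D_p rho. *)
pose h := G^-1 *: (t *: v + (1 - G) *: p).
have hE : p + h = G^-1 *: (p + t *: v).
  rewrite -{1}[p](scalerK (lt0r_neq0 G0)) -scalerDr; congr (_ *: _).
  by rewrite addrCA -scalerDl addrCA subrr addr0 scale1r addrC.
have hK : `|h| <= 2 * K * `|t|.
  rewrite normrZ gtr0_norm ?invr_gt0// -mulrA; apply: ler_pM => //.
  - by rewrite invr_ge0 ltW.
  - by rewrite -[leRHS]invrK lef_pV2 ?posrE// invr_gt0.
  apply: le_trans (ler_normD _ _) _; rewrite !normrZ distrC /K.
  rewrite !mulrDl mul1r -[leLHS]addr0; apply: lerD => //.
  rewrite [`|t| * _]mulrC lerD2l mulrAC; exact: ler_wpM2r.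
have tK0 (s : R) : 0 < s -> `|t| < s / (2 * K) -> `|h| < s.
  by move=> s0 ts; apply: le_lt_trans hK _; rewrite mulrC -ltr_pdivlMr// mulr_gt0.
have hr1 := tK0 _ r10 tr1.
have hr2 := tK0 _ r20 tr2.
have ptv0 : p + t *: v != 0.
  by apply: contraTneq G2 => E0; rewrite /G E0 gauge0// -ltNge invr_gt0.
have rh0 : rho (p + h) = 0.
  have : (boundary Om `&` V) (p + h).
    split; last by apply: r2V; rewrite -ball_normE /= opprD addrA subrr add0r normrN.
    by rewrite hE; exact: projection_boundary.
  by rewrite SV => -[].
have := H1 h hr1; rewrite rh0 rp subr0 sub0r normrN.
rewrite linearZ /= linearD !linearZ /= -dv -dp => B.
have {}B : `|t * 'D_v rho p + (1 - G) * 'D_p rho p| <= e * `|'D_p rho p| * `|t|.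
  have GB : `|t * 'D_v rho p + (1 - G) * 'D_p rho p| <= G * (e' * `|h|).
    by move: B; rewrite normrM gtr0_norm ?invr_gt0// ler_pdivrMl.
  apply: le_trans GB _.
  apply: (@le_trans _ _ (2 * (e' * (2 * K * `|t|)))).
    by apply: ler_pM => //; [exact: ltW|rewrite mulr_ge0// ltW|rewrite ler_pM2l].
  by rewrite le_eqVlt; apply/orP; left; apply/eqP; rewrite /e'; field; rewrite gt_eqF.
have Dp0 : 0 < `|'D_p rho p| by rewrite normr_gt0.
rewrite -(ler_pM2r Dp0) -normrM gp -/G.
rewrite [X in `|X|](_ : _ = - (t * 'D_v rho p + (1 - G) * 'D_p rho p)).
  by rewrite normrN mulrAC.
by rewrite /GRing.scale /=; field.
Qed.

Lemma derive_gauge_boundary p V rho v : local_equation (boundary Om) p V rho ->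
  boundary Om p -> 'D_v g p = 'D_v rho p / 'D_p rho p.
Proof. by move=> leq Sp; have [] := gauge_is_derive_boundary v leq Sp. Qed.

Lemma is_derive_scale (f : E -> R) x v (c D : R) : c != 0 ->
  is_derive (c *: x) v f D -> is_derive x v (fun y => f (c *: y)) (c * D).
Proof.
move=> c0 df.
have : is_derive (c *: x) (c *: v) f (c * D).
  apply: is_derive_of_small => e e0.
  have ec : 0 < e / `|c| by rewrite divr_gt0// normr_gt0.
  have [r r0 rP] := is_derive_small df ec.
  exists (r / `|c|); first by rewrite divr_gt0// normr_gt0.
  move=> t; rewrite ltr_pdivlMr ?normr_gt0// => tr.
  have := rP (t * c); rewrite normrM => /(_ tr).
  rewrite scalerA (_ : t *: (c * D) = (t * c) *: D); last exact: mulrA.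
  move=> h.
  apply: le_trans h _; by rewrite [`|t| * _]mulrC mulrA divfK ?normr_eq0.
move=> df'; apply: (@is_derive_affine R E E R (fun y => c *: y) f x v (c *: v)) df' => h.
by rewrite scalerDr !scalerA mulrC.
Qed.

(** Homogeneity of degree 1 makes the first derivatives homogeneous of degree 0, so the boundary
    formula holds along the whole ray. *)
Lemma gauge_is_derive x p V rho v : x != 0 -> p = (g x)^-1 *: x ->
  local_equation (boundary Om) p V rho ->
  is_derive x v g ('D_v rho p / 'D_p rho p).
Proof.
move=> x0 pE leq; have gx : 0 < g x by exact: gauge_gt0.
have Sp : boundary Om p by rewrite pE; exact: projection_boundary.
have xp : x = g x *: p by rewrite pE scalerA divff ?gt_eqF// scale1r.
have dp := gauge_is_derive_boundary v leq Sp.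
rewrite pE in dp; have := is_derive_scale _ dp; rewrite invr_eq0 gt_eqF// => /(_ isT).
rewrite -pE => d1.
have -> : 'D_v rho p / 'D_p rho p = g x * ((g x)^-1 * ('D_v rho p / 'D_p rho p)).
  by rewrite mulrA divff ?gt_eqF// mul1r.
apply: (is_derive_near (f := fun y => g x * g ((g x)^-1 *: y))).
  near=> y; rewrite gaugeZ ?invr_gt0// mulrA divff ?gt_eqF// mul1r.
  by [].
Unshelve. all: by end_near. Qed.

Lemma open_nz : open [set x : E | x != 0].
Proof.
rewrite (_ : [set x : E | x != 0] = ~` [set 0]); last first.
  by apply/seteqP; split => x /= /eqP.
exact/closed_openC/(@accessible_closed_set1 E)/hausdorff_accessible/norm_hausdorff.
Qed.

(** Bootstrap: the derivative of g at y is the quotient of D_v rho and D_P rho evaluated at P = y /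
    g(y). This expression is C^k as soon as g is, hence g is C^(k+1). *)
Lemma gauge_Ck k : Ck k [set x | x != 0] g.
Proof.
elim: k => [|k IH]; first by split => // x _; exact: gauge_continuous.
apply: Ck_local => x x0.
pose P y : E := (g y)^-1 *: y.
have Sp : boundary Om (P x) by exact: projection_boundary.
have [V [rho leq]] := smOm Sp.
have [oV Vp sm SV reg] := leq.
have cP : Ck k [set y | y != 0] P.
  apply/Ck_rVP => [|i]; first exact: open_nz.
  apply: (@Ck_eq _ _ _ k _ (fun y => (g y)^-1 * y 0 i)); first exact: open_nz.
    by move=> y _; rewrite mxE.
  apply: CkM; first exact: open_nz.
    by apply: CkV => //; [exact: open_nz|move=> y y0; rewrite gt_eqF ?gauge_gt0].
  by apply: Ck_coord; exact: open_nz.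
pose U := [set y : E | y != 0] `&` P @^-1` V.
have oU : open U.
  rewrite openE => y [y0 Vy]; apply: filterI.
    by apply: open_nbhs_nbhs; split => //; exact: open_nz.
  have := Ck_continuous cP y0; apply.
  exact: open_nbhs_nbhs.
have leqy y : U y -> local_equation (boundary Om) (P y) V rho by case=> y0 Vy; split.
exists U; split => //.
apply: (@Ck_intro _ _ _ k U g (fun v y => 'D_v rho (P y) / (\sum_i P y 0 i * 'D_(delta_mx 0 i) rho (P y)))).
- by move=> y _; exact: gauge_continuous.
- by [].
- move=> y v Uy; have [y0 _] := Uy; have lq := leqy _ Uy.
  have [_ Vy _ _ _] := lq.
  rewrite -(Ck_deriveE (P y) oV (sm 1%N) Vy).
  exact: gauge_is_derive lq.
- move=> v; have cPU : Ck k U P by apply: Ck_sub cP => y [].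
  have cD w : Ck k U (fun y => 'D_w rho (P y)).
    apply: (@Ck_comp _ _ _ k U V (fun y => 'D_w rho y) P) => //; first by move=> y [].
    exact: (Ck_derive w (sm k.+1)).
  apply: CkM => //; apply: CkV => //.
    move=> y Uy; have lq := leqy _ Uy; have [_ Vy _ _ _] := lq.
    rewrite -(Ck_deriveE (P y) oV (sm 1%N) Vy); apply: radial_transversal lq _.
    by apply: projection_boundary; case: Uy.
  apply: Ck_sum => // i; apply: CkM => //.
  exact: (Ck_rVP _ _ oU).1 cPU i.
Qed.

Lemma gauge_smooth : smooth_on [set x | x != 0] g.
Proof. exact: gauge_Ck. Qed.

End gauge_smooth.

(** * Newton tensors and symmetric functions *)

Section newton_tensors.
Context {R : realType} {n : nat}.
Implicit Types M N P : 'M[R]_n.+1.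

(** Newton tensors without eigenvalues: sigma_(j+1) is written tr(T_j M) / (j+1). The definition
    therefore applies to matrices that are not symmetric and is polynomial in the entries. *)
Fixpoint newton_mx M (j : nat) : 'M[R]_n.+1 :=
  match j with
  | 0 => 1%:M
  | j'.+1 => (\tr (newton_mx M j' *m M) / j'.+1%:R)%:M - newton_mx M j' *m M
  end.

Definition symf M (j : nat) : R :=
  if j is j'.+1 then \tr (newton_mx M j' *m M) / j'.+1%:R else 1.

Lemma newton_mxS M j : newton_mx M j.+1 = (symf M j.+1)%:M - newton_mx M j *m M.
Proof. by []. Qed.

Lemma newton_mx_comm M j : newton_mx M j *m M = M *m newton_mx M j.
Proof.
elim: j => [|j IH]; first by rewrite /= mul1mx mulmx1.
by rewrite newton_mxS mulmxBl mulmxBr mulmxA -IH !mul_scalar_mx !mul_mx_scalar.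
Qed.

Lemma trace_newton_mx M j : \tr (newton_mx M j *m M) = j.+1%:R * symf M j.+1.
Proof. by rewrite /symf mulrC divfK// pnatr_eq0. Qed.

Lemma newton_mx_conj M N P j : P \in unitmx -> P *m M = N *m P ->
  P *m newton_mx M j = newton_mx N j *m P /\ symf M j = symf N j.
Proof.
move=> uP PM.
have tr (A B : 'M[R]_n.+1) : P *m A = B *m P -> \tr A = \tr B.
  by move=> PA; rewrite -[A]mul1mx -(mulVmx uP) -mulmxA PA mxtrace_mulC mulmxK.
elim: j => [|j [IH1 IH2]]; first by rewrite /= mulmx1 mul1mx.
have PT : P *m (newton_mx M j *m M) = (newton_mx N j *m N) *m P.
  by rewrite mulmxA IH1 -!mulmxA PM.
have sE : symf M j.+1 = symf N j.+1 by rewrite /symf (tr _ _ PT).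
split=> //; rewrite !newton_mxS mulmxBr mulmxBl PT sE.
by rewrite mul_scalar_mx mul_mx_scalar.
Qed.

(** Generating polynomial of the elementary symmetric functions. Omitting a factor, as [esymp']
    does, gives those of the remaining variables, which are the diagonal entries of the Newton
    tensors of a diagonal matrix. *)
Definition esymp (I : finType) (d : I -> R) : {poly R} :=
  \prod_i (1 + d i *: 'X).

Definition esymp' (I : finType) (d : I -> R) (i : I) : {poly R} :=
  \prod_(l | l != i) (1 + d l *: 'X).

Lemma esymp_split (I : finType) (d : I -> R) i :
  esymp d = (1 + d i *: 'X) * esymp' d i.
Proof. by rewrite /esymp (bigD1 i). Qed.

Lemma deriv_esymp (I : finType) (d : I -> R) :
  (esymp d)^`() = \sum_i d i *: esymp' d i.
Proof.
have dF i : (1 + d i *: 'X)^`() = (d i)%:P.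
  by rewrite derivD derivZ derivX -[1]/(1%:P) derivC add0r alg_polyC.
suff H (s : seq I) : uniq s -> (\prod_(i <- s) (1 + d i *: 'X))^`() =
    \sum_(i <- s) d i *: \prod_(l <- s | l != i) (1 + d l *: 'X).
  by rewrite /esymp H ?index_enum_uniq.
elim: s => [|i s IH]; first by rewrite !big_nil -[1]/(1%:P) derivC.
move=> /= /andP[iNs us]; rewrite !big_cons derivM {}IH// dF eqxx /= mul_polyC.
congr (_ *: _ + _).
  by rewrite big_seq [RHS]big_seq_cond; apply: eq_bigl => l;
    case ls: (l \in s) => //=; apply/esym; apply: contraNneq iNs => <-.
rewrite mulr_sumr [LHS]big_seq [RHS]big_seq; apply: eq_bigr => l ls.
rewrite big_cons ifT -?scalerAr//.
by apply: contraNneq iNs => ->.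
Qed.

Lemma coef0_esymp (I : finType) (d : I -> R) (Q : pred I) :
  (\prod_(i | Q i) (1 + d i *: 'X))`_0 = 1.
Proof.
rewrite -horner_coef0 horner_prod big1// => i _.
by rewrite hornerD hornerZ hornerX -[1]/(1%:P) hornerC mulr0 addr0.
Qed.

Lemma coef_esymp (I : finType) (d : I -> R) j :
  (esymp d)`_j = \sum_(J : {set I} | #|J| == j) \prod_(i in J) d i.
Proof.
rewrite /esymp; under eq_bigr do rewrite addrC.
rewrite bigA_distr coef_sum [RHS]big_mkcond; apply: eq_bigr => J _.
rewrite (_ : \prod_i _ = (\prod_(i in J) d i) *: 'X^#|J|); last first.
  rewrite -big_mkcond /= scaler_prod; congr (_ *: _).
  by rewrite prodr_const.
by rewrite coefZ coefXn eq_sym; case: eqP; rewrite ?mulr1 ?mulr0.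
Qed.

(** The trace of T_j M is a coefficient of the derivative of the generating polynomial, which
    produces the factor j + 1; the recursion for T_(j+1) is the identity E = (1 + d_i X) E_i read
    coefficientwise. *)
Lemma symf_diag (d : 'rV[R]_n.+1) j :
  newton_mx (diag_mx d) j = diag_mx (\row_i (esymp' (d 0) i)`_j) /\
  symf (diag_mx d) j = (esymp (d 0))`_j.
Proof.
elim: j => [|j [IH1 IH2]].
  rewrite /symf /esymp coef0_esymp; split => //.
  apply/matrixP => a b; rewrite !mxE /=.
  by rewrite /esymp' coef0_esymp.
have prodE : newton_mx (diag_mx d) j *m diag_mx d =
    diag_mx (\row_i ((esymp' (d 0) i)`_j * d 0 i)).
  rewrite IH1; apply/matrixP => a b; rewrite mul_diag_mx !mxE.
  by case: eqP => [->|_]; rewrite ?mulr1n// !mulr0n mulr0.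
have sE : symf (diag_mx d) j.+1 = (esymp (d 0))`_j.+1.
  rewrite /symf prodE mxtrace_diag.
  apply: (@mulIf _ j.+1%:R); first by rewrite pnatr_eq0.
  rewrite divfK ?pnatr_eq0// mulr_natr -coef_deriv deriv_esymp coef_sum.
  by apply: eq_bigr => i _; rewrite mxE coefZ mulrC.
split=> //; rewrite newton_mxS sE prodE; apply/matrixP => a b.
rewrite !mxE (esymp_split (d 0) a) mulrDl mul1r coefD -scalerAl coefZ mulrC coefXM /=.
by case: eqP => [->|_]; rewrite ?mulr1n ?mulr0n ?subr0// mulrC addrK.
Qed.

(** A zero eigenvalue contributes the factor 1. This reconciles the n principal curvatures with
    ambient matrices of size n + 1. *)
Lemma esymp_consr0 (kap : 'rV[R]_n) : esymp ((consr 0 kap) 0) = esymp (kap 0).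
Proof.
rewrite /esymp big_ord_recl consr0 scale0r addr0 mul1r.
by apply: eq_bigr => i _; rewrite consrS.
Qed.

Lemma newton_mx_pow M j :
  newton_mx M j = \sum_(i < j.+1) ((-1) ^+ i * symf M (j - i)) *: M ^+ i.
Proof.
elim: j => [|j IH]; first by rewrite big_ord1 /= mulr1 scale1r.
rewrite newton_mxS IH [RHS]big_ord_recl mul1r subn0; congr (_ + _).
  by rewrite expr0 -scalemx1 idmxE.
rewrite mulmx_suml -sumrN; apply: eq_bigr => i _.
by rewrite exprS mulN1r mulNr scaleNr -scalemxAl mulmxE -exprSr subSS.
Qed.

Lemma symf_newton_identity M j :
  j.+1%:R * symf M j.+1 =
  \sum_(i < j.+1) (-1) ^+ i * symf M (j - i) * \tr (M ^+ i.+1).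
Proof.
rewrite -trace_newton_mx newton_mx_pow mulmx_suml raddf_sum.
by apply: eq_bigr => i _; rewrite -scalemxAl /= mxtraceZ mulmxE -exprSr.
Qed.

(* Linearizations of [newton_mx] and [symf] at M in the direction N. *)
Fixpoint dnewton_mx M N (j : nat) : 'M[R]_n.+1 :=
  match j with
  | 0 => 0
  | j'.+1 =>
    (\tr (dnewton_mx M N j' *m M + newton_mx M j' *m N) / j'.+1%:R)%:M
      - (dnewton_mx M N j' *m M + newton_mx M j' *m N)
  end.

Definition dsymf M N (j : nat) : R :=
  if j is j'.+1 then \tr (dnewton_mx M N j' *m M + newton_mx M j' *m N) / j'.+1%:R
  else 0.

Lemma dnewton_mxS M N j : dnewton_mx M N j.+1 =
  (dsymf M N j.+1)%:M - (dnewton_mx M N j *m M + newton_mx M j *m N).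
Proof. by []. Qed.

Fixpoint dpow_mx M N (i : nat) : 'M[R]_n.+1 :=
  if i is i'.+1 then dpow_mx M N i' * M + M ^+ i' * N else 0.

Lemma dpow_mxS M N i : dpow_mx M N i.+1 = dpow_mx M N i * M + M ^+ i * N.
Proof. by []. Qed.

(** Under the trace every term M^a N M^b of the linearized power has the same value, by
    cyclicity. *)
Lemma trace_dpow_mx M N i l :
  \tr (dpow_mx M N i.+1 * M ^+ l) = i.+1%:R * \tr (M ^+ (i + l) * N).
Proof.
elim: i l => [|i IH] l.
  by rewrite /= mul0r add0r expr0 !mul1r add0n -!mulmxE mxtrace_mulC.
rewrite dpow_mxS mulrDl raddfD /= -mulrA -exprS IH.
rewrite [X in _ + X](_ : _ = \tr (M ^+ (i.+1 + l) * N)).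
  by rewrite addnS -addSn -[in RHS]natr1 mulrDl mul1r.
by rewrite addnC exprD -!mulmxE [LHS]mxtrace_mulC mulmxA.
Qed.

Lemma dnewton_mx_pow M N j : dnewton_mx M N j =
  \sum_(i < j.+1) (-1) ^+ i *: (dsymf M N (j - i) *: M ^+ i + symf M (j - i) *: dpow_mx M N i).
Proof.
elim: j => [|j IH]; first by rewrite big_ord1 /= scale0r scaler0 addr0 scaler0.
rewrite dnewton_mxS IH newton_mx_pow [RHS]big_ord_recl.
rewrite expr0 scale1r subn0 scaler0 addr0; congr (_ + _).
  by rewrite expr0 -scalemx1 idmxE.
rewrite !mulmx_suml -big_split -sumrN; apply: eq_bigr => i _ /=.
rewrite /bump leq0n add1n add0n subSS exprS mulN1r scaleNr; congr (- _).
rewrite -!scalemxAl -scalerA -scalerDr mulmxDl -!scalemxAl -addrA -scalerDr.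
by rewrite !mulmxE -exprSr.
Qed.

(** Strong induction, comparing coefficients of tr(M^i N). Differentiating the powers of M
    contributes i + 1; differentiating the symmetric functions contributes j - i, by induction and
    Newton's identities. The sum j + 1 cancels the denominator. *)
Theorem dsymf_trace M N j : dsymf M N j.+1 = \tr (newton_mx M j *m N).
Proof.
elim/ltn_ind: j => j IH.
have j0 : (j.+1%:R : R) != 0 by rewrite pnatr_eq0.
apply: (mulfI j0); rewrite {1}/dsymf mulrC divfK//.
pose tau i := \tr (M ^+ i * N).
have trT l : \tr (newton_mx M l *m N) =
    \sum_(i < l.+1) (-1) ^+ i * symf M (l - i) * tau i.
  rewrite newton_mx_pow mulmx_suml raddf_sum; apply: eq_bigr => i _.
  by rewrite -scalemxAl /= mxtraceZ.
have -> : \tr (dnewton_mx M N j *m M + newton_mx M j *m N) =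
    \sum_(i < j.+1) (-1) ^+ i * symf M (j - i) * (i.+1%:R * tau i) +
    \sum_(i < j.+1) (-1) ^+ i * dsymf M N (j - i) * \tr (M ^+ i.+1).
  rewrite raddfD /= trT dnewton_mx_pow mulmx_suml raddf_sum -!big_split.
  apply: eq_bigr => i _ /=.
  rewrite -scalemxAl /= mxtraceZ mulmxDl -!scalemxAl raddfD /= !mxtraceZ !mulmxE -exprSr.
  have -> : \tr (dpow_mx M N i * M) = i%:R * tau i.
    case: (i : nat) => [|a]; first by rewrite /= !mul0r raddf0.
    by have := trace_dpow_mx M N a 1; rewrite expr1 addn1.
  by rewrite -natr1; ring.
(* The top term vanishes since [dsymf] at index 0 is 0. The others expand by induction into a double
   sum; in the other order of summation the inner sum is a Newton identity. *)
have -> : \sum_(i < j.+1) (-1) ^+ i * dsymf M N (j - i) * \tr (M ^+ i.+1) =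
    \sum_(l < j.+1) (-1) ^+ l * tau l * ((j - l)%:R * symf M (j - l)).
  rewrite big_ord_recr [RHS]big_ord_recr /= subnn mulr0 mul0r !mul0r mulr0 !addr0.
  transitivity (\sum_(i < j) \sum_(l < j | (l < j - i)%N)
      (-1) ^+ i * \tr (M ^+ i.+1) * ((-1) ^+ l * symf M (j - i.+1 - l) * tau l)).
    apply: eq_bigr => i _.
    have -> : (j - i = (j - i.+1).+1)%N by rewrite subnSK.
    rewrite IH; last by rewrite ltn_subrL /=; apply: leq_ltn_trans (ltn_ord i).
    rewrite trT (big_ord_widen_cond j xpredT (fun l => (-1) ^+ l * symf M (j - i.+1 - l) * tau l)).
      by rewrite mulrAC mulr_sumr.
    by rewrite subnSK// leq_subr.
  rewrite (exchange_big_dep xpredT)//=; apply: eq_bigr => l _.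
  have -> : (j - l = (j - l.+1).+1)%N by rewrite subnSK.
  rewrite symf_newton_identity mulr_sumr.
  rewrite (big_ord_widen_cond j xpredT (fun i => (-1) ^+ l * tau l * ((-1) ^+ i * symf M (j - l.+1 - i) * \tr (M ^+ i.+1)))); last first.
    by rewrite subnSK// leq_subr.
  apply: eq_big => [i|i _].
    by rewrite /= subnSK// !ltn_subRL addnC.
  have -> : (j - i.+1 - l = j - l.+1 - i)%N by rewrite -!subnDA addSnnS addnC.
  ring.
rewrite trT mulr_sumr -big_split; apply: eq_bigr => l _ /=.
have -> : (j.+1%:R : R) = l.+1%:R + (j - l)%:R.
  by rewrite -natrD addSn subnKC// -ltnS.
ring.
Qed.

End newton_tensors.

Lemma cvg_sumr {R : realType} (T : Type) (F : set_system T) (FF : Filter F) (I : Type)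
    (r : seq I) (f : I -> T -> R) (l : I -> R) : (forall i, f i t @[t --> F] --> l i) ->
  \sum_(i <- r) f i t @[t --> F] --> \sum_(i <- r) l i.
Proof.
move=> cf; elim: r => [|i r IH].
  by rewrite big_nil; under eq_fun do rewrite big_nil; exact: cvg_cst.
by rewrite big_cons; under eq_fun do rewrite big_cons; exact: cvgD.
Qed.

Section euclidean_vectors.
Context {R : realType} {d : nat}.
Implicit Types x y : 'rV[R]_d.

Lemma dotvE x y : dotv x y = (x *m y^T) ord0 ord0.
Proof. by rewrite mxE; apply: eq_bigr => i _; rewrite mxE. Qed.

Lemma dotvDr x y z : dotv x (y + z) = dotv x y + dotv x z.
Proof. exact: linearD. Qed.

Lemma dotvZr x c y : dotv x (c *: y) = c * dotv x y.
Proof. exact: linearZ. Qed.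

Lemma dotvBr x y z : dotv x (y - z) = dotv x y - dotv x z.
Proof. exact: linearB. Qed.

Lemma dotvDl x y z : dotv (x + y) z = dotv x z + dotv y z.
Proof. by rewrite ![dotv _ z]dotvC dotvDr. Qed.

Lemma dotvZl x c y : dotv (c *: x) y = c * dotv x y.
Proof. by rewrite ![dotv _ y]dotvC dotvZr. Qed.

Lemma dotvBl x y z : dotv (x - y) z = dotv x z - dotv y z.
Proof. by rewrite ![dotv _ z]dotvC dotvBr. Qed.

Lemma dotv0 x : dotv x 0 = 0. Proof. exact: linear0. Qed.

Lemma dotv0l x : dotv 0 x = 0. Proof. by rewrite dotvC dotv0. Qed.

Lemma dotv_ge0 x : 0 <= dotv x x.
Proof. by apply: sumr_ge0 => i _; rewrite -expr2 sqr_ge0. Qed.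

Lemma dotv_eq0 x : (dotv x x == 0) = (x == 0).
Proof.
apply/idP/eqP => [|->]; last by rewrite dotv0.
rewrite psumr_eq0 => [/allP h|i _]; last by rewrite -expr2 sqr_ge0.
apply/rowP => i; rewrite mxE; apply/eqP.
by have /implyP /(_ isT) := h i (mem_index_enum _); rewrite mulf_eq0 orbb.
Qed.

Lemma dotv_gt0 x : (0 < dotv x x) = (x != 0).
Proof. by rewrite lt_def dotv_ge0 andbT dotv_eq0. Qed.

Lemma enorm_sqr x : enorm x ^+ 2 = dotv x x.
Proof. by rewrite sqr_sqrtr// dotv_ge0. Qed.

Lemma enorm_ge0 x : 0 <= enorm x. Proof. exact: sqrtr_ge0. Qed.

Lemma enorm_gt0 x : (0 < enorm x) = (x != 0).
Proof. by rewrite sqrtr_gt0 dotv_gt0. Qed.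

Lemma enormZ c x : enorm (c *: x) = `|c| * enorm x.
Proof. by rewrite /enorm dotvZl dotvZr mulrA -expr2 sqrtrM ?sqr_ge0// sqrtr_sqr. Qed.

Lemma cauchy_schwarz x y : dotv x y ^+ 2 <= dotv x x * dotv y y.
Proof.
have [->|y0] := eqVneq y 0; first by rewrite !dotv0 mulr0 expr0n.
have yy : 0 < dotv y y by rewrite dotv_gt0.
have := dotv_ge0 (dotv y y *: x - dotv x y *: y).
rewrite dotvBl !dotvBr !dotvZl !dotvZr (dotvC y x) => h.
rewrite -subr_ge0 -(pmulr_rge0 _ yy); apply: le_trans h _.
by rewrite le_eqVlt; apply/orP; left; apply/eqP; ring.
Qed.

Lemma dotv_le_enorm x y : dotv x y <= enorm x * enorm y.
Proof.
rewrite -[X in X <= _]/(dotv x y); apply: le_trans (ler_norm _) _.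
rewrite -ler_sqr ?nnegrE ?normr_ge0 ?mulr_ge0 ?enorm_ge0//.
by rewrite real_normK ?num_real// exprMn !enorm_sqr cauchy_schwarz.
Qed.

Lemma dotv_cvg (T : Type) (F : set_system T) (FF : Filter F) (f g : T -> 'rV[R]_d) x y :
  f t @[t --> F] --> x -> g t @[t --> F] --> y -> dotv (f t) (g t) @[t --> F] --> dotv x y.
Proof.
move=> cf cg; apply: cvg_sumr => i.
by apply: cvgM; apply: coord_cvgP.
Qed.

Lemma dotv_sqr_continuous : continuous (fun x : 'rV[R]_d => dotv x x).
Proof. by move=> x; exact: (@dotv_cvg _ (nbhs x) _ id id x x cvg_id cvg_id). Qed.

Lemma enorm_continuous : continuous (@enorm R d).
Proof.
move=> x; apply: (@continuous_comp _ _ _ (fun y => dotv y y) Num.sqrt).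
  exact: dotv_sqr_continuous.
exact: sqrt_continuous.
Qed.

Lemma norm_le_enorm x : `|x| <= enorm x.
Proof.
apply/normrV_leP => [|i]; first exact: enorm_ge0.
rewrite -ler_sqr ?nnegrE ?normr_ge0 ?enorm_ge0// enorm_sqr real_normK ?num_real//.
by rewrite /dotv (bigD1 i)//= -expr2 lerDl sumr_ge0// => j _; rewrite -expr2 sqr_ge0.
Qed.

End euclidean_vectors.

(** * Spectral theorem on the orthogonal complement of the normal *)

Section eigenbasis.
Context {R : realType} {n : nat}.
Variable A : 'M[R]_n.+1.
Hypothesis symA : A^T = A.
Let f (x : 'rV[R]_n.+1) : R := dotv (x *m A) x.

Lemma mulmx_cvg (T : Type) (F : set_system T) (FF : Filter F) (p q : nat) (B : 'M[R]_(p, q))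
    (g : T -> 'rV[R]_p) (x : 'rV[R]_p) : g t @[t --> F] --> x -> g t *m B @[t --> F] --> x *m B.
Proof.
move=> cg; apply: cvg_rV => j.
rewrite (_ : (fun y => (g y *m B) ord0 j) = fun y => \sum_i g y ord0 i * B i j); last first.
  by apply/funext => y; rewrite mxE.
rewrite mxE; apply: cvg_sumr => i.
by apply: cvgM; [exact: coord_cvgP|exact: cvg_cst].
Qed.

Lemma dotv_symC x y : dotv (x *m A) y = dotv (y *m A) x.
Proof. by rewrite dotvC !dotvE trmx_mul symA mulmxA. Qed.

Lemma orthogonal_unit_vector m (E : 'M[R]_(m, n.+1)) : (m < n.+1)%N ->
  exists2 x : 'rV[R]_n.+1, dotv x x = 1 & x *m E^T = 0.
Proof.
move=> mn.
have : kermx E^T != 0.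
  rewrite kermx_eq0 /row_free; apply: contraL mn => /eqP <-.
  by rewrite -leqNgt rank_leq_col.
move=> /rowV0Pn[v /sub_kermxP vE v0].
have vv : 0 < enorm v by rewrite enorm_gt0.
exists ((enorm v)^-1 *: v); last by rewrite -scalemxAl vE scaler0.
rewrite dotvZl dotvZr -enorm_sqr; field; exact: lt0r_neq0.
Qed.

(** First-order optimality condition: for a small positive t the linear term would win. The value t
    = c / (|q| + 1) makes |t q| <= c. *)
Lemma quadratic_le0 (c q : R) : 0 <= c -> (forall t, 2 * t * c + t ^+ 2 * q <= 0) -> c = 0.
Proof.
move=> c0 H; apply/eqP; rewrite eq_le c0 andbT leNgt; apply/negP => cp.
have q1 : 0 < `|q| + 1 by rewrite ltr_wpDl.
have tp : 0 < c / (`|q| + 1) by rewrite divr_gt0.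
have := H (c / (`|q| + 1)).
set t := c / (`|q| + 1) in tp *.
have tq : `|t * q| <= c.
  rewrite normrM gtr0_norm// /t mulrAC ler_pdivrMr// ler_pM2l// lerDl//.
have := tq; rewrite ler_norml => /andP[tq1 _].
have : 0 < t * (2 * c + t * q) by rewrite mulr_gt0//; lra.
move=> h1 h2; lra.
Qed.

(* A maximizer of the Rayleigh quotient on the orthogonal complement of an invariant subspace
   is an eigenvector. *)
Lemma rayleigh m (E : 'M[R]_(m, n.+1)) (D : 'M[R]_m) : (m < n.+1)%N -> E *m A = D *m E ->
  exists (x : 'rV[R]_n.+1) (c : R), [/\ dotv x x = 1, x *m E^T = 0 & x *m A = c *: x].
Proof.
move=> mn EA.
pose S := [set x : 'rV[R]_n.+1 | dotv x x = 1 /\ x *m E^T = 0].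
have S0 : S !=set0 by have [x ? ?] := orthogonal_unit_vector E mn; exists x.
have cS : compact S.
  apply: (@subclosed_compact _ S (box 1 : set 'rV[R]_n.+1)); last 2 first.
  - exact: box_compact.
  - move=> x [x1 _]; rewrite boxE//=; apply: le_trans (norm_le_enorm _) _.
    by rewrite /enorm x1 sqrtr1.
  rewrite (_ : S = [set x | dotv x x = 1] `&` [set x | x *m E^T = 0]); last by [].
  apply: closedI.
    apply: (@closed_comp _ _ (fun x : 'rV[R]_n.+1 => dotv x x) [set t | t = 1]).
      by move=> x _; exact: dotv_sqr_continuous.
    exact: closed_eq.
  apply: (@closed_comp _ _ (fun x : 'rV[R]_n.+1 => x *m E^T) [set t | t = 0]).
    by move=> x _; exact: (@mulmx_cvg _ (nbhs x) _ _ _ _ id x cvg_id).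
  exact/(@accessible_closed_set1 _)/hausdorff_accessible/norm_hausdorff.
have cf : continuous f.
  by move=> x; exact: (@dotv_cvg _ _ _ (nbhs x) _ _ id _ x (@mulmx_cvg _ (nbhs x) _ _ _ A id x cvg_id) cvg_id).
have [x /set_mem[x1 xE] xmax] := EVT_max_rV S0 cS (continuous_subspaceT cf).
(* [w] is the defect in the eigenvector equation. It is orthogonal to [x] and, since the row space
   of [E] is invariant and [A] symmetric, to the rows of [E]; so [x + t *: w] is an admissible
   variation, whose first-order gain is 2 t |w|^2. *)
pose lam := f x; pose w := x *m A - lam *: x.
have wx : dotv w x = 0 by rewrite dotvBl dotvZl x1 mulr1 -/(f x) subrr.
have wE : w *m E^T = 0.
  rewrite mulmxBl -scalemxAl xE scaler0 subr0 -mulmxA.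
  by rewrite -{1}symA -trmx_mul EA trmx_mul mulmxA xE mul0mx.
have fle y : y *m E^T = 0 -> f y <= lam * dotv y y.
  move=> yE; have [->|y0] := eqVneq y 0.
    by rewrite /f mul0mx !dotv0 mulr0.
  have ey : 0 < enorm y by rewrite enorm_gt0.
  have : f ((enorm y)^-1 *: y) <= lam.
    apply: xmax; apply/mem_set; split; last by rewrite -scalemxAl yE scaler0.
    by rewrite dotvZl dotvZr -enorm_sqr; field; exact: lt0r_neq0.
  rewrite /f -scalemxAl dotvZl dotvZr mulrA -invfM -expr2 enorm_sqr.
  by rewrite mulrC ler_pdivrMr// dotv_gt0.
suff w0 : w = 0.
  by exists x, lam; split=> //; apply/eqP; rewrite -subr_eq0 -/w w0.
apply/eqP; rewrite -dotv_eq0; apply/eqP.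
apply: (@quadratic_le0 _ (f w - lam * dotv w w)) => [|t]; first exact: dotv_ge0.
have := fle (x + t *: w); rewrite mulmxDl -scalemxAl xE wE scaler0 addr0 => /(_ erefl).
have xAw : dotv (x *m A) w = dotv w w.
  by rewrite -{1}(subrK (lam *: x) (x *m A)) -/w dotvDl dotvZl (dotvC x) wx mulr0 addr0.
clearbody w; rewrite /f mulmxDl -scalemxAl !dotvDl !dotvDr !dotvZl !dotvZr xAw (dotv_symC w x) xAw.
by rewrite -/(f x) -/(f w) -/lam x1 (dotvC x w) wx => h; lra.
Qed.

(** Eigenvectors are added one at a time, each maximizing the Rayleigh quotient orthogonally to the
    previous ones and to [nu]. As [nu] itself is an eigenvector, with eigenvalue 0, the excluded
    subspace stays invariant. *)
Theorem symmetric_eigenbasis (nu : 'rV[R]_n.+1) : dotv nu nu = 1 -> nu *m A = 0 ->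
  exists (F : 'M[R]_(n, n.+1)) (kap : 'rV[R]_n),
    [/\ F *m F^T = 1%:M, F *m nu^T = 0 & F *m A = diag_mx kap *m F].
Proof.
move=> nu1 nuA.
suff H j : (j <= n)%N -> exists (F : 'M[R]_(j, n.+1)) (kap : 'rV[R]_j),
    [/\ F *m F^T = 1%:M, F *m nu^T = 0 & F *m A = diag_mx kap *m F] by exact: (H n).
elim: j => [_|j IH jn].
  by exists 0, 0; split; apply/matrixP => -[].
have [F [kap [FF Fnu FA]]] := IH (ltnW jn).
pose E : 'M[R]_(j + 1, n.+1) := col_mx F nu.
have EA : E *m A = block_mx (diag_mx kap) 0 0 0 *m E.
  by rewrite mul_col_mx mul_block_col nuA FA !mul0mx !addr0.
have j1n : (j + 1 < n.+1)%N by rewrite addn1.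
have [x [c [x1 xE xA]]] := rayleigh j1n EA.
have xx : x *m x^T = 1%:M.
  by apply/matrixP => a b; rewrite !ord1 -dotvE x1 mxE eqxx.
have [xF xnu] : x *m F^T = 0 /\ x *m nu^T = 0.
  move: xE; rewrite tr_col_mx mul_mx_row -[0]row_mx0 => /eq_row_mx.
  by case.
have Fx : F *m x^T = 0 by rewrite -[F]trmxK -trmx_mul xF trmx0.
pose G : 'M[R]_(1 + j, n.+1) := col_mx x F; pose kap' : 'rV[R]_(1 + j) := row_mx c%:M kap.
have GG : G *m G^T = 1%:M.
  by rewrite tr_col_mx mul_col_row xx xF Fx FF -scalar_mx_block.
have Gnu : G *m nu^T = 0 by rewrite mul_col_mx xnu Fnu col_mx0.
suff GA : G *m A = diag_mx kap' *m G by exists G, kap'.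
rewrite mul_col_mx FA xA /kap' diag_mx_row mul_block_col !mul0mx addr0 add0r.
congr col_mx.
by apply/matrixP => a b; rewrite !mxE !ord1 big_ord1 !mxE eqxx !mulr1n.
Qed.

End eigenbasis.

Lemma affine_continuous {R : realType} (V : normedModType R) (a : V) (c : R) :
  continuous (fun y => a + c *: y).
Proof. by move=> y; apply: cvgD; [exact: cvg_cst|apply: cvgZr; exact: cvg_id]. Qed.

Lemma continuous_cstB {R : realType} (V : topologicalType) (c : R) (f : V -> R) :
  continuous f -> continuous (fun x => c - f x).
Proof. by move=> cf x; apply: cvgB; [exact: cvg_cst|exact: cf]. Qed.

(** * The circumcenter is an interior point *)

Section circumcenter.
Context {R : realType} {n : nat}.
Local Notation E := 'rV[R]_n.+1.
Variable Om : set E.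
Hypothesis openOm : open Om.
Hypothesis convOm : convex_set Om.
Hypothesis bndOm : bounded_set Om.
Hypothesis Om_nonempty : Om !=set0.
Hypothesis smOm : smooth_hypersurface (boundary Om).
Local Notation Sigma := (boundary Om).

Lemma open_segment (z b : E) (A : set E) : open A -> A z ->
  exists2 t0 : R, 0 < t0 & forall t, `|t| <= t0 -> A (z + t *: b).
Proof.
move=> oA Az; have : nbhs z A by exact: open_nbhs_nbhs.
move=> /nbhs_ballP[e /= e0 eA].
have b1 : 0 < `|b| + 1 by rewrite ltr_wpDl.
exists (e / 2 / (`|b| + 1)); first by rewrite !divr_gt0.
move=> t tl; apply: eA; rewrite -ball_normE /= opprD addNKr normrN normrZ.
apply: (@le_lt_trans _ _ (e / 2)); last by rewrite ltr_pdivrMr// ltr_pMr// ltr1n.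
rewrite ler_pdivlMr// in tl; apply: le_trans tl.
by rewrite ler_wpM2l// lerDl.
Qed.

Lemma compact_closure : compact (closure Om).
Proof.
have [M [_ MO]] := bndOm.
pose M' := Num.max M 0 + 1.
have M'0 : 0 <= M' by rewrite addr_ge0// le_max lexx orbT.
have {}MO x : Om x -> `|x| <= M'.
  by apply: MO; rewrite /M' (le_lt_trans (_ : M <= Num.max M 0)) ?ltrDl// le_max lexx.
apply: (@subclosed_compact _ _ (box M' : set E)).
- exact: closed_closure.
- exact: box_compact.
- move=> x; rewrite -[box M' x]/((box M' : set E) x).
  have cl : closed (box M' : set E) by exact: box_closed.
  by move=> Ox; apply: cl; apply: closureS Ox => y Oy; rewrite boxE//=; exact: MO.
Qed.

Lemma compact_boundary : compact Sigma.
Proof.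
apply: (@subclosed_compact _ _ (closure Om)); [|exact: compact_closure|by move=> x []].
rewrite /boundary setDE; apply: closedI; first exact: closed_closure.
by apply: open_closedC; exact: open_interior.
Qed.

Lemma boundaryP x : Sigma x <-> closure Om x /\ ~ Om x.
Proof. by rewrite /boundary (interior_id _).1. Qed.

(** A point of the closure farthest from 0 cannot be interior, since it could be pushed outward; it
    is not 0, since a nonempty open set is not reduced to the origin. *)
Lemma boundary_nonzero : exists2 p, Sigma p & p != 0.
Proof.
have [q Oq] := Om_nonempty.
have c0 : closure Om !=set0 by exists q; exact: subset_closure.
have [p /set_mem cp pmax] := EVT_max_rV c0 compact_closure
  (continuous_subspaceT (@dotv_sqr_continuous R n.+1)).
have h : forall x, closure Om x -> dotv x x <= dotv p p by move=> x /mem_set; exact: pmax.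
have [p0|p0] := eqVneq p 0.
  have e1 : (delta_mx 0 0 : E) != 0.
    by apply/eqP => /rowP /(_ 0); rewrite !mxE eqxx => /eqP; rewrite oner_eq0.
  have all0 x : Om x -> x = 0.
    move=> Ox; apply/eqP; rewrite -dotv_eq0 eq_le dotv_ge0 andbT.
    by have := h x (subset_closure Ox); rewrite p0 dotv0.
  have [t t0 tO] := open_segment (delta_mx 0 0) openOm Oq.
  have := all0 _ (tO t _); rewrite gtr0_norm// => /(_ (lexx _)).
  rewrite (all0 _ Oq) add0r => /eqP; rewrite scaler_eq0 (negbTE e1) orbF.
  by rewrite gt_eqF.
exists p => //; apply/boundaryP; split => // Op.
have [t t0 tO] := open_segment p openOm Op.
have := h _ (subset_closure (tO t _)); rewrite gtr0_norm// => /(_ (lexx _)).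
have pp : 0 < dotv p p by rewrite dotv_gt0.
rewrite dotvDl !dotvDr !dotvZl !dotvZr; have : 0 < t * dotv p p by rewrite mulr_gt0.
have : 0 < t * (t * dotv p p) by rewrite !mulr_gt0.
lra.
Qed.

(** A narrow cone around [z] leaves the supporting half-space at [p], hence misses the
    hypersurface. *)
Lemma halfspace_transversal p V rho (h z : E) : local_equation Sigma p V rho -> Sigma p ->
  (forall x, Sigma x -> dotv h x <= dotv h p) -> 0 < dotv h z -> 'D_z rho p != 0.
Proof.
move=> leq Sp H hz; pose C := \sum_i `|h 0 i|.
have C1 : 0 < C + 1 by rewrite ltr_wpDl// sumr_ge0.
apply: (cone_transversal (d := dotv h z / (C + 1)) (tau := 1) leq Sp) => //.
  by rewrite divr_gt0.
move=> t b t0 _ bd /H; rewrite dotvDr gerDl dotvZr pmulr_rle0// dotvDr.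
have hb := dotv_bound h b.
have : `|dotv h b| < dotv h z.
  apply: le_lt_trans hb _; rewrite ltr_pdivlMr// in bd; apply: le_lt_trans bd.
  by rewrite mulrC ler_wpM2l// lerDl.
by rewrite ltr_norml => /andP[]; lra.
Qed.

Lemma closure_convex c x (t : R) : 0 <= t -> t <= 1 -> closure Om c -> Om x ->
  closure Om (t *: x + (1 - t) *: c).
Proof.
move=> t0 t1 cc Ox.
have : closed [set y | closure Om (t *: x + (1 - t) *: y)].
  apply: (@closed_comp _ _ (fun y : E => t *: x + (1 - t) *: y) (closure Om)).
    by move=> y _; exact: affine_continuous.
  exact: closed_closure.
apply; apply: closureS cc => y Oy; apply: subset_closure.
exact: (convex_setP convOm).
Qed.

(** If 0 is outside the closure, the nearest point of the closure serves as normal vector. Otherwise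
    0 is a boundary point: truncated cones from 0 around points q of [Om] lie inside [Om], so D_q
    rho(0) is nonzero; convexity makes its sign constant, and the gradient of [rho] separates up to
    sign. *)
Lemma separation : ~ Om 0 -> exists2 g : E, g != 0 & forall x, Om x -> 0 <= dotv g x.
Proof.
move=> O0; have [c0|c0] := pselect (closure Om 0); last first.
  have [q Oq] := Om_nonempty.
  have cn : closure Om !=set0 by exists q; exact: subset_closure.
  have [c /set_mem cc cmin] := EVT_min_rV cn compact_closure
    (continuous_subspaceT (@dotv_sqr_continuous R n.+1)).
  exists c; first by apply: contra_notN c0 => /eqP <-.
  move=> x Ox; rewrite leNgt; apply/negP => cx.
  pose q2 := dotv x x - 2 * dotv c x + dotv c c.
  have q20 : 0 <= q2.
    have := dotv_ge0 (x - c); rewrite dotvBl !dotvBr (dotvC x c) /q2; lra.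
  have cc0 := dotv_ge0 c.
  (* A step from [c] towards [x] with t |x - c|^2 <= - <c, x>, short enough to decrease the norm and
     contradict the choice of [c]. *)
  pose t := - dotv c x / (q2 - dotv c x).
  have d0 : 0 < q2 - dotv c x by lra.
  have t0 : 0 < t by rewrite divr_gt0// oppr_gt0.
  have t1 : t <= 1 by rewrite ler_pdivrMr// mul1r; lra.
  have := cmin _ (mem_set (closure_convex (ltW t0) t1 cc Ox)).
  rewrite !dotvDl !dotvDr !dotvZl !dotvZr (dotvC x c).
  have tq : t * q2 <= - dotv c x.
    rewrite /t mulrAC ler_pdivrMr//; nra.
  rewrite /q2 in tq; nra.
have S0 : Sigma 0 by apply/boundaryP.
have [V [rho leq]] := smOm S0.
have [oV V0 sm SV reg] := leq.
have D0 q : Om q -> 'D_q rho 0 != 0.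
  move=> Oq; have /nbhs_ballP[e /= e0 eO] : nbhs q Om by exact: open_nbhs_nbhs.
  apply: (cone_transversal (d := e / 2) (tau := 1) leq S0) => //; first by rewrite divr_gt0.
  move=> t b t0 t1 be /boundaryP[_]; apply; rewrite add0r.
  pose s := t / (1 - t); have t1' : 0 < 1 - t by rewrite subr_gt0.
  have s0 : 0 < s by rewrite divr_gt0.
  (* The apex 0 is only in the closure, so a nearby [y] in [Om] replaces it; the correction
     [s^-1 *: y] is absorbed by the ball around [q]. *)
  have [y [Oy]] := c0 _ (nbhsx_ballx _ _ (mulr_gt0 s0 (divr_gt0 e0 (ltr0Sn R 1)))).
  rewrite -ball_normE /= sub0r normrN => ys.
  have -> : t *: (q + b) = t *: (q + (b - s^-1 *: y)) + (1 - t) *: y.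
    rewrite addrA scalerBr [t *: (s^-1 *: y)]scalerA (_ : t * s^-1 = 1 - t) ?subrK//.
    by rewrite /s; field; rewrite !gt_eqF.
  apply: (convex_setP convOm) => //; [exact: ltW|exact: ltW|].
  apply: eO; rewrite -ball_normE /= opprD addNKr normrN.
  apply: le_lt_trans (ler_normB _ _) _; rewrite normrZ gtr0_norm ?invr_gt0//.
  have : s^-1 * `|y| < e / 2 by rewrite ltr_pdivrMl.
  lra.
pose g : E := \row_i 'D_(delta_mx 0 i) rho 0.
have gE v : 'D_v rho 0 = dotv g v.
  rewrite (Ck_deriveE (k := 0) _ oV (sm 1%N) V0) /dotv.
  by apply: eq_bigr => i _; rewrite !mxE mulrC.
have [q Oq] := Om_nonempty.
have g0 : g != 0 by apply: contraNneq (D0 _ Oq) => g0; rewrite gE g0 dotv0l.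
have same x y : Om x -> Om y -> 0 < dotv g x -> 0 < dotv g y.
  move=> Ox Oy gx; rewrite lt_def -gE D0//= leNgt; apply/negP; rewrite gE => gy.
  pose t := - dotv g y / (dotv g x - dotv g y).
  have d0 : 0 < dotv g x - dotv g y by lra.
  have /D0 : Om (t *: x + (1 - t) *: y).
    apply: (convex_setP convOm) => //; first by rewrite divr_ge0//; lra.
    by rewrite ler_pdivrMr//; lra.
  by rewrite gE dotvDr !dotvZr /t => /eqP[]; field; rewrite gt_eqF.
have [gq|gq] := ltP 0 (dotv g q).
  by exists g => // x Ox; apply/ltW; exact: same Oq Ox gq.
exists (- g); first by rewrite oppr_eq0.
move=> x Ox; rewrite -scaleN1r dotvZl mulN1r oppr_ge0 leNgt; apply/negP => gx.
by have := same _ _ Ox Oq gx; rewrite ltNge gq.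
Qed.

(** Otherwise the boundary lies in a half-space <g, x> >= 0, and moving the centre to eps g should
    shrink the sphere. Points with <g, x> > 0 come closer and points with |x| < r have slack; only
    points with <g, x> = 0 and |x| = r could obstruct, and smoothness excludes them. Compactness
    then bounds [phi] below by a positive constant. *)
Lemma circumcenter_in (r : R) : circumscribed Sigma 0 r -> Om 0.
Proof.
move=> [rS rmin]; apply: contrapT => O0.
have [g g0 gO] := separation O0.
have gg : 0 < dotv g g by rewrite dotv_gt0.
have gS x : Sigma x -> 0 <= dotv g x.
  move=> [cx _].
  have cl : closed [set y | 0 <= dotv g y].
    apply: (@closed_comp _ _ (dotv g) [set t | 0 <= t]); last exact: closed_ge.
    by move=> y _; exact: dotv_continuous.
  by apply: cl; apply: closureS cx => y; exact: gO.
have [p0 Sp0 p00] := boundary_nonzero.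
have r0 : 0 < r.
  by apply: lt_le_trans (rS _ Sp0); rewrite subr0 enorm_gt0.
have rS2 x : Sigma x -> dotv x x <= r ^+ 2.
  move=> /rS; rewrite subr0 -enorm_sqr => h.
  by rewrite ler_sqr ?nnegrE ?enorm_ge0// ltW.
pose phi (x : E) : R := Num.max (dotv g x) (r ^+ 2 - dotv x x).
have cphi : continuous phi.
  move=> x; apply: (@continuous_max _ _ (dotv g) (fun x => r ^+ 2 - dotv x x)).
    exact: dotv_continuous.
  by apply: continuous_cstB; exact: dotv_sqr_continuous.
have Sn : Sigma !=set0 by exists p0.
have [p /set_mem Sp pmin] := EVT_min_rV Sn compact_boundary (continuous_subspaceT cphi).
have {}pmin x : Sigma x -> phi p <= phi x by move=> /mem_set; exact: pmin.
have phip : 0 < phi p.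
  rewrite ltNge; apply/negP; rewrite ge_max => /andP[gp rp].
  have {}gp : dotv g p = 0 by apply/eqP; rewrite eq_le gp gS.
  have pp : dotv p p = r ^+ 2 by apply/eqP; rewrite eq_le rS2//; lra.
  have [V [rho leq]] := smOm Sp.
  (* At an obstructing point both the ball and the half-space support the boundary, with independent
     normals. Transversality then holds for [p - s *: g] with every [s], yet the linear functional D
     rho vanishes for a suitable [s]. *)
  have Dz (s : R) : 'D_(p - s *: g) rho p != 0.
    apply: (@halfspace_transversal _ V _ p) => // [x Sx|].
      rewrite pp; apply: le_trans (dotv_le_enorm _ _) _.
      rewrite [enorm p]/enorm pp sqrtr_sqr gtr0_norm// expr2 ler_pM2l//.
      by have := rS _ Sx; rewrite subr0.
    by rewrite dotvBr dotvZr (dotvC p g) gp mulr0 subr0 pp exprn_gt0.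
  have Dg : 'D_(- g) rho p != 0.
    apply: (@halfspace_transversal _ V _ (- g)) => // [x Sx|].
      by rewrite -scaleN1r !dotvZl gp; have := gS _ Sx; lra.
    by rewrite -scaleN1r dotvZl dotvZr mulN1r mulN1r opprK.
  have := Dz (- 'D_p rho p / 'D_(- g) rho p).
  rewrite (_ : p - _ = (- 'D_p rho p / 'D_(- g) rho p) *: (- g) + p); last first.
    by rewrite scalerN addrC.
  by rewrite (local_equation_deriveD _ _ _ leq) divfK// addNr eqxx.
set m := phi p in phip pmin.
(* The second bound gives eps |g|^2 <= m / 2, for points where <g, x> >= m; with eps <= 1/2 it also
   covers the points where r^2 - |x|^2 >= m. In both cases the squared distance drops by at least
   eps m. *)
pose eps := Num.min (2^-1) (m / 2 / (dotv g g + 1)).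
have gg1 : 0 < dotv g g + 1 by lra.
have e0 : 0 < eps by rewrite lt_min invr_gt0 ltr0n /= !divr_gt0.
have e1 : eps <= 2^-1 by rewrite ge_min lexx.
have e2 : eps * (dotv g g + 1) <= m / 2 by rewrite -ler_pdivlMr// ge_min lexx orbT.
have : r <= Num.sqrt (r ^+ 2 - eps * m).
  apply: (rmin (eps *: g)) => x Sx.
  rewrite /enorm; apply: ler_wsqrtr.
  rewrite dotvBl !dotvBr !dotvZl !dotvZr (dotvC x g).
  have := pmin _ Sx; have := rS2 _ Sx; have := gS _ Sx.
  set a := dotv g x; set b := dotv x x; set c := dotv g g in e2 gg gg1 *.
  move=> a0 br; rewrite /phi -/a -/b le_max => /orP[h|h].
    have : eps * m <= eps * a by rewrite ler_pM2l.
    have : eps * (eps * c) <= eps * (m / 2).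
      by rewrite ler_pM2l//; nra.
    nra.
  have : 0 <= eps * a by rewrite mulr_ge0// ltW.
  have : eps * (eps * c) <= 2^-1 * (m / 2).
    apply: ler_pM => //; [exact: ltW|by rewrite mulr_ge0// ltW|nra].
  have : eps * m <= 2^-1 * m by rewrite ler_pM2r.
  lra.
apply/negP; rewrite -ltNge -{2}(gtr0_norm r0) -sqrtr_sqr.
rewrite ltr_sqrt ?exprn_gt0// gtrBl mulr_gt0//.
Qed.

End circumcenter.

(** * The normal and the shape operator as ambient fields *)

Section matrix_calculus.
Context {R : realType} {V : normedModType R} {n : nat}.
Implicit Types (x v : V).

Lemma is_derive_sumr (I : Type) (r : seq I) (f : I -> V -> R) (D : I -> R) x v :
  (forall i, is_derive x v (f i) (D i)) ->
  is_derive x v (fun y => \sum_(i <- r) f i y) (\sum_(i <- r) D i).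
Proof.
move=> df; elim: r => [|i r IH].
  by rewrite big_nil; under eq_fun do rewrite big_nil; exact: is_derive_cst.
by rewrite big_cons; under eq_fun do rewrite big_cons; exact: is_deriveD.
Qed.

Lemma is_derive_mulr (f g : V -> R) x v a b : is_derive x v f a -> is_derive x v g b ->
  is_derive x v (fun y => f y * g y) (a * g x + f x * b).
Proof.
move=> df dg; rewrite (_ : a * g x + f x * b = f x *: b + g x *: a).
  exact: is_deriveM.
by rewrite addrC [a * _]mulrC.
Qed.

Lemma is_derive_cstr (c : R) x v : is_derive x v (fun=> c) 0.
Proof. exact: is_derive_cst. Qed.

Lemma is_derive_eqr (f : V -> R) x v a b : is_derive x v f a -> a = b -> is_derive x v f b.
Proof. by move=> df <-. Qed.

Lemma is_derive_mull (f : V -> R) (c : R) x v a : is_derive x v f a ->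
  is_derive x v (fun y => c * f y) (c * a).
Proof.
move=> df; apply: is_derive_eqr (is_derive_mulr (is_derive_cstr c x v) df) _.
by rewrite mul0r add0r.
Qed.

Variables (M : V -> 'M[R]_n.+1) (N : 'M[R]_n.+1) (x v : V).
Hypothesis dM : forall a b, is_derive x v (fun y => M y a b) (N a b).

Lemma is_derive_mulmx (p q s : nat) (A : V -> 'M[R]_(p, q)) (B : V -> 'M[R]_(q, s))
    (dA : 'M[R]_(p, q)) (dB : 'M[R]_(q, s)) :
  (forall a b, is_derive x v (fun y => A y a b) (dA a b)) ->
  (forall a b, is_derive x v (fun y => B y a b) (dB a b)) ->
  forall a b, is_derive x v (fun y => (A y *m B y) a b) ((dA *m B x + A x *m dB) a b).
Proof.
move=> hA hB a b; rewrite !mxE -big_split /=; under eq_fun do rewrite mxE.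
by apply: is_derive_sumr => c; exact: is_derive_mulr.
Qed.

Lemma is_derive_newton_mx j :
  (forall a b, is_derive x v (fun y => newton_mx (M y) j a b) (dnewton_mx (M x) N j a b)) /\
  is_derive x v (fun y => symf (M y) j) (dsymf (M x) N j).
Proof.
elim: j => [|j [IH1 IH2]].
  split=> [a b|]; last exact: is_derive_cst.
  by rewrite [dnewton_mx _ _ _ _ _]mxE; exact: is_derive_cst.
have dTM := is_derive_mulmx IH1 dM.
have ds : is_derive x v (fun y => symf (M y) j.+1) (dsymf (M x) N j.+1).
  rewrite /symf /dsymf /=; under eq_fun do rewrite mulrC.
  rewrite mulrC.
  by apply: is_derive_mull; apply: is_derive_sumr => i.
split=> // a b.
rewrite dnewton_mxS !mxE; under eq_fun do rewrite newton_mxS !mxE.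
apply: is_deriveB; last by move: (dTM a b); rewrite !mxE; under eq_fun do rewrite mxE.
case: (a == b) => /=; first by rewrite mulr1n; under eq_fun do rewrite mulr1n.
by rewrite mulr0n; under eq_fun do rewrite mulr0n; exact: is_derive_cst.
Qed.

End matrix_calculus.

Lemma Ck_newton_mx {R : realType} (V : normedModType R) (n k : nat) (U : set V)
    (M : V -> 'M[R]_n.+1) j : open U -> (forall a b, Ck k U (fun y => M y a b)) ->
  (forall a b, Ck k U (fun y => newton_mx (M y) j a b)) /\ Ck k U (fun y => symf (M y) j).
Proof.
move=> oU cM; elim: j => [|j [IH1 IH2]].
  by split=> [a b|]; exact: Ck_cst.
have cTM a b : Ck k U (fun y => (newton_mx (M y) j *m M y) a b).
  under eq_fun do rewrite mxE.
  by apply: Ck_sum => // c; exact: CkM.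
have cs : Ck k U (fun y => symf (M y) j.+1).
  by rewrite /symf; apply: CkM => //; [apply: Ck_sum|exact: Ck_cst].
split=> // a b; under eq_fun do rewrite newton_mxS !mxE.
apply: CkB => //; last by move: (cTM a b); under eq_fun do rewrite mxE.
case: (a == b) => /=; first by under eq_fun do rewrite mulr1n.
by under eq_fun do rewrite mulr0n; exact: Ck_cst.
Qed.

Section ambient_normal.
Context {R : realType} {n : nat}.
Local Notation E := 'rV[R]_n.+1.
Variable Om : set E.
Hypothesis openOm : open Om.
Hypothesis convOm : convex_set Om.
Hypothesis bndOm : bounded_set Om.
Hypothesis Om0 : Om 0.
Hypothesis smOm : smooth_hypersurface (boundary Om).
Local Notation g := (gauge Om).
Local Notation U := [set x : E | x != 0].
Local Notation dl := (delta_mx 0).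

Definition gauge_grad (x : E) : E := \row_i 'D_(dl i) g x.
Definition normal (x : E) : E := (enorm (gauge_grad x))^-1 *: gauge_grad x.
(** Row [a] is the derivative of the normal in direction [a]. The field is homogeneous of degree -1;
    it kills the position vector acting from the left and the normal on the right. *)
Definition weingarten (x : E) : 'M[R]_n.+1 :=
  \matrix_(a, b) 'D_(dl a) (fun y => normal y 0 b) x.

Let oU : open U := @open_nz R n.
Let smg : smooth_on U g := gauge_smooth openOm convOm bndOm Om0 smOm.

Lemma derive_gauge x v : x != 0 -> 'D_v g x = dotv (gauge_grad x) v.
Proof.
move=> x0; rewrite (Ck_deriveE _ oU (smg 1%N) x0); apply: eq_bigr => i _.
by rewrite mxE mulrC.
Qed.

Lemma gauge_is_derive_grad x v : x != 0 -> is_derive x v g (dotv (gauge_grad x) v).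
Proof. by move=> x0; rewrite -derive_gauge//; exact: Ck_is_derive (smg 1%N) x0. Qed.

Lemma scale_neq0 (c : R) (x : E) : 0 < c -> x != 0 -> c *: x != 0.
Proof. by move=> c0 x0; rewrite scaler_eq0 negb_or gt_eqF. Qed.

Lemma derive_homogeneous0 (f : E -> R) x : x != 0 -> Ck 1 U f ->
  (forall c y, 0 < c -> y != 0 -> f (c *: y) = f y) -> 'D_x f x = 0.
Proof.
move=> x0 cf hf; suff : is_derive x x f 0 by case.
apply: is_derive_of_small => e e0; exists 1 => // t t1.
rewrite -{1}[x]scale1r -scalerDl hf//; first by rewrite subrr scaler0 subr0 normr0 mulr_ge0// ltW.
by move: t1; rewrite ltr_norml; lra.
Qed.

Lemma derive_homogeneous (f : E -> R) (D : R) x v c : 0 < c -> x != 0 -> Ck 1 U f ->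
  (forall y, y != 0 -> f (c *: y) = D * f y) -> c * 'D_v f (c *: x) = D * 'D_v f x.
Proof.
move=> c0 x0 cf hf; have c00 : c != 0 by rewrite gt_eqF.
have := is_derive_scale c00 (Ck_is_derive v cf (scale_neq0 c0 x0)).
have h := is_derive_mull D (Ck_is_derive v cf x0).
move=> [_ <-].
have hn : \forall y \near x, D * f y = f (c *: y).
  by apply: (near_open oU x0) => y y0; rewrite hf.
by have [_] := is_derive_near hn h.
Qed.

Lemma gauge_grad_scale c x : 0 < c -> x != 0 -> gauge_grad (c *: x) = gauge_grad x.
Proof.
move=> c0 x0; apply/rowP => i; rewrite !mxE.
apply: (@mulfI _ c); first by rewrite gt_eqF.
apply: derive_homogeneous (smg 1%N) _ => // y y0; exact: gaugeZ.
Qed.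

Lemma gauge_grad_self x : x != 0 -> dotv (gauge_grad x) x = g x.
Proof.
move=> x0; have [_] := gauge_is_derive_grad x x0; rewrite -derive_gauge// => _.
suff : is_derive x x g (g x) by case.
apply: is_derive_of_small => e e0; exists 1 => // t t1.
rewrite -{1}[x]scale1r -scalerDl gaugeZ//; last by move: t1; rewrite ltr_norml; lra.
rewrite (_ : _ - _ = 0) ?normr0 ?mulr_ge0//; first exact: ltW.
by rewrite /GRing.scale /=; ring.
Qed.

(** Subadditivity bounds g(x + t y) - g(x) by t g(y); divide by t and let t tend to 0. *)
Lemma gauge_subgradient x y : x != 0 -> dotv (gauge_grad x) y <= g y.
Proof.
move=> x0; apply/ler_addgt0Pr => e e0.
have [r r0 H] := is_derive_small (gauge_is_derive_grad y x0) e0.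
pose t := r / 2; have t0 : 0 < t by rewrite divr_gt0.
have := H t; rewrite gtr0_norm// /t ltr_pdivrMr// ltr_pMr// ltr1n => /(_ isT).
rewrite -/t ler_norml => /andP[h _].
have := gaugeD openOm convOm Om0 x (t *: y); rewrite gaugeZ// => h2.
have {}h : - (e * t) <= g (x + t *: y) - g x - t * dotv (gauge_grad x) y by [].
rewrite -(ler_pM2l t0) mulrDr.
lra.
Qed.

Lemma gauge_grad_neq0 x : x != 0 -> gauge_grad x != 0.
Proof.
move=> x0; apply: contraTneq (gauge_gt0 openOm convOm bndOm Om0 x0) => h.
by rewrite -gauge_grad_self// h dotv0l ltxx.
Qed.

Lemma enorm_grad_gt0 x : x != 0 -> 0 < enorm (gauge_grad x).
Proof. by move=> x0; rewrite enorm_gt0 gauge_grad_neq0. Qed.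

Lemma normal_unit x : x != 0 -> dotv (normal x) (normal x) = 1.
Proof.
move=> x0; rewrite dotvZl dotvZr -enorm_sqr; field.
by rewrite gt_eqF// enorm_grad_gt0.
Qed.

Lemma normal_scale c x : 0 < c -> x != 0 -> normal (c *: x) = normal x.
Proof. by move=> c0 x0; rewrite /normal gauge_grad_scale. Qed.

Lemma gauge_gradE x : x != 0 -> gauge_grad x = enorm (gauge_grad x) *: normal x.
Proof. by move=> x0; rewrite scalerA divff ?scale1r// gt_eqF// enorm_grad_gt0. Qed.

Lemma gauge_grad_coord i : (fun x => gauge_grad x 0 i) = (fun x => 'D_(dl i) g x).
Proof. by apply/funext => x; rewrite mxE. Qed.

Lemma grad_Ck k i : Ck k U (fun x => gauge_grad x 0 i).
Proof. by rewrite gauge_grad_coord; apply: Ck_derive; exact: smg. Qed.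

Lemma grad_norm_Ck k : Ck k U (fun x => enorm (gauge_grad x)).
Proof.
apply: Ck_sqrt => // [x x0|]; first by rewrite dotv_gt0 gauge_grad_neq0.
by apply: Ck_sum => // i; apply: CkM => //; exact: grad_Ck.
Qed.

Lemma normal_Ck k i : Ck k U (fun x => normal x 0 i).
Proof.
rewrite (_ : (fun x => _) = fun x => (enorm (gauge_grad x))^-1 * gauge_grad x 0 i).
  apply: CkM => //; last exact: grad_Ck.
  apply: CkV => //; last exact: grad_norm_Ck.
  by move=> x /enorm_grad_gt0 /gt_eqF ->.
by apply/funext => x; rewrite mxE.
Qed.

Lemma normal_smooth : smooth_on U normal.
Proof. by move=> k; apply/Ck_rVP => // i; exact: normal_Ck. Qed.

Lemma weingarten_coord a b :
  (fun x => weingarten x a b) = (fun x => 'D_(dl a) (fun y => normal y 0 b) x).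
Proof. by apply/funext => x; rewrite mxE. Qed.

Lemma weingarten_Ck k a b : Ck k U (fun x => weingarten x a b).
Proof. by rewrite weingarten_coord; apply: Ck_derive; exact: normal_Ck. Qed.

Lemma derive_normal x v b : x != 0 ->
  'D_v (fun y => normal y 0 b) x = (v *m weingarten x) 0 b.
Proof.
move=> x0; rewrite (Ck_deriveE _ oU (normal_Ck 1 b) x0) mxE.
by apply: eq_bigr => i _; rewrite mxE.
Qed.

Lemma is_derive_normal x v : x != 0 -> is_derive x v normal (v *m weingarten x).
Proof.
move=> x0; apply/is_derive_rVP => i; rewrite -derive_normal//.
exact: Ck_is_derive (normal_Ck 1 i) x0.
Qed.

Lemma weingarten_scale c x : 0 < c -> x != 0 -> weingarten (c *: x) = c^-1 *: weingarten x.
Proof.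
move=> c0 x0; apply/matrixP => a b; rewrite !mxE.
apply: (@mulfI _ c); first by rewrite gt_eqF.
rewrite [RHS]mulVKf ?gt_eqF// -[RHS]mul1r.
apply: (@derive_homogeneous (fun y => normal y 0 b) 1 x (dl a) c c0 x0 (normal_Ck 1 b)).
by move=> y y0; rewrite normal_scale// mul1r.
Qed.

Lemma position_weingarten x : x != 0 -> x *m weingarten x = 0.
Proof.
move=> x0; apply/rowP => b; rewrite -derive_normal// mxE.
apply: (@derive_homogeneous0 (fun y => normal y 0 b) x x0 (normal_Ck 1 b)) => c y c0 y0.
by rewrite normal_scale.
Qed.

Lemma weingarten_normal x : x != 0 -> weingarten x *m (normal x)^T = 0.
Proof.
move=> x0; apply/colP => a; rewrite [RHS]mxE.
have h : is_derive x (dl a) (fun y => dotv (normal y) (normal y))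
    (\sum_i (weingarten x a i * normal x 0 i + normal x 0 i * weingarten x a i)).
  apply: is_derive_sumr => i; have := Ck_is_derive (dl a) (normal_Ck 1 i) x0.
  rewrite (_ : 'D_(dl a) _ x = weingarten x a i); last by rewrite mxE.
  by move=> h; apply: is_derive_mulr.
have h0 : is_derive x (dl a) (fun y => dotv (normal y) (normal y)) 0.
  have hn : \forall y \near x, (1 : R) = dotv (normal y) (normal y).
    by apply: (near_open oU x0) => y y0; rewrite normal_unit.
  exact: is_derive_near hn (@is_derive_cstr R _ 1 x (dl a)).
have : \sum_i (weingarten x a i * normal x 0 i + normal x 0 i * weingarten x a i) = 0.
  by case: h => _ <-; case: h0.
rewrite mxE big_split /=; under [X in _ + X]eq_bigr do rewrite mulrC.
under [in X in _ -> X]eq_bigr do rewrite [(normal x)^T _ _]mxE.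
lra.
Qed.

(* Equality of mixed partial derivatives of the normal. *)
Lemma weingarten_comm x a b c : x != 0 ->
  'D_(dl c) (fun y => weingarten y a b) x = 'D_(dl a) (fun y => weingarten y c b) x.
Proof.
move=> x0; rewrite !weingarten_coord.
exact: (derive_comm _ _ oU (normal_Ck 2 b) x0).
Qed.

Definition wein_hess (x : E) : 'M[R]_n.+1 := \matrix_(a, b) 'D_(dl a) (fun y => 'D_(dl b) g y) x.

Lemma wein_hess_sym x : x != 0 -> (wein_hess x)^T = wein_hess x.
Proof.
move=> x0; apply/matrixP => a b; rewrite !mxE.
exact: (derive_comm _ _ oU (smg 2) x0).
Qed.

(** The gradient is monotone: adding the subgradient inequalities at x and x + t v gives <grad g(x +
    t v) - grad g(x), v> >= 0, which a negative second derivative would contradict. *)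
Lemma wein_hess_ge0 x v : x != 0 -> 0 <= dotv (v *m wein_hess x) v.
Proof.
move=> x0.
have c1 : Ck 1 U (fun y => 'D_v g y) by apply: Ck_derive; exact: smg.
have -> : dotv (v *m wein_hess x) v = 'D_v (fun y => 'D_v g y) x.
  have h : is_derive x v (fun y => dotv v (gauge_grad y))
      (\sum_i v 0 i * (v *m wein_hess x) 0 i).
    apply: is_derive_sumr => i; apply: is_derive_mull.
    rewrite gauge_grad_coord.
    rewrite (_ : (v *m wein_hess x) 0 i = 'D_v (fun y => 'D_(dl i) g y) x).
      by apply: Ck_is_derive x0; apply: Ck_derive; exact: (smg 2).
    rewrite (Ck_deriveE (k := 0) _ oU _ x0); last by apply: Ck_derive; exact: (smg 2).
    by rewrite mxE; apply: eq_bigr => j _; rewrite mxE.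
  have hn : \forall y \near x, dotv v (gauge_grad y) = 'D_v g y.
    by apply: (near_open oU x0) => y y0; rewrite derive_gauge// dotvC.
  by have [_ ->] := is_derive_near hn h; rewrite dotvC.
have dd := Ck_is_derive v c1 x0.
set D := 'D_v _ x in dd *; rewrite leNgt; apply/negP => D0.
have e0 : 0 < - D / 2 by rewrite divr_gt0// oppr_gt0.
have [r r0 H] := is_derive_small dd e0.
have [t1 t10 tU] := open_segment v oU x0.
pose t := Num.min (r / 2) t1.
have t0 : 0 < t by rewrite lt_min divr_gt0.
have tr : t < r by rewrite gt_min ltr_pdivrMr// ltr_pMr// ltr1n.
have xt0 : x + t *: v != 0.
  by apply: tU; rewrite gtr0_norm// ge_min lexx orbT.
have := H t; rewrite gtr0_norm// => /(_ tr); rewrite ler_norml => /andP[_].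
rewrite !derive_gauge//.
set a := dotv _ v; set b := dotv _ v => h0.
have {h0}h : a - b - t * D <= - D / 2 * t by [].
have s1 : dotv (gauge_grad x) (x + t *: v) <= g (x + t *: v) by exact: gauge_subgradient.
have s2 : dotv (gauge_grad (x + t *: v)) x <= g x by exact: gauge_subgradient.
have s3 := gauge_grad_self xt0.
have s4 := gauge_grad_self x0.
rewrite -s3 !dotvDr !dotvZr s4 in s1.
rewrite -/a -/b in s1.
have h3 : t * b <= t * a by clear -s1 s2; lra.
rewrite ler_pM2l// in h3.
have tD : t * D < 0 by rewrite pmulr_rlt0.
by clear -h h3 tD; lra.
Qed.

Definition tproj (x : E) : 'M[R]_n.+1 := 1%:M - (normal x)^T *m normal x.
(** Projecting on the left sends the normal row to 0, as required of a shape operator, and restores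
    symmetry; tangential rows see no change. *)
Definition shape_mx (x : E) : 'M[R]_n.+1 := tproj x *m weingarten x.

Lemma normal_mulT x : x != 0 -> normal x *m (normal x)^T = 1%:M.
Proof.
by move=> x0; apply/matrixP => a b; rewrite !ord1 -dotvE normal_unit// mxE eqxx.
Qed.

(** In the product rule for grad g / |grad g| the derivative of the scalar factor multiplies grad g,
    which the tangential projection removes; and W is unchanged by this projection on the right.
    Hence [shape_mx] is P Hess(g) P / |grad g|, symmetric and nonnegative. *)
Lemma weingarten_hess x : x != 0 ->
  weingarten x = (enorm (gauge_grad x))^-1 *: (wein_hess x *m tproj x).
Proof.
move=> x0; pose c : 'cV[R]_n.+1 := \col_a 'D_(dl a) (fun y => (enorm (gauge_grad y))^-1) x.
have ME : weingarten x = c *m gauge_grad x + (enorm (gauge_grad x))^-1 *: wein_hess x.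
  apply/matrixP => a b; rewrite !mxE big_ord1 !mxE.
  have cV : Ck 1 U (fun y => (enorm (gauge_grad y))^-1).
    apply: CkV => //; last exact: grad_norm_Ck.
    by move=> y /enorm_grad_gt0 /gt_eqF ->.
  have [_] := is_derive_mulr (Ck_is_derive (dl a) cV x0) (Ck_is_derive (dl a) (grad_Ck 1 b) x0).
  rewrite -(gauge_grad_coord b) .
  rewrite (_ : 'D_(dl b) g x = gauge_grad x 0 b); last by rewrite mxE.
  move=> <-; congr ('D_ _ _ _).
  by apply/funext => y; rewrite !mxE.
have gT : gauge_grad x *m tproj x = 0.
  rewrite gauge_gradE// -scalemxAl mulmxBr mulmx1 mulmxA normal_mulT// mul1mx subrr.
  by rewrite scaler0.
rewrite -[LHS]mulmx1 -[1%:M](subrK ((normal x)^T *m normal x)) -/(tproj x).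
rewrite mulmxDr mulmxA weingarten_normal// mul0mx addr0 {1}ME mulmxDl -mulmxA gT.
by rewrite mulmx0 add0r scalemxAl.
Qed.

Lemma tproj_sym x : (tproj x)^T = tproj x.
Proof. by rewrite /tproj linearB /= trmx1 trmx_mul trmxK. Qed.

Lemma shape_mx_sym x : x != 0 -> (shape_mx x)^T = shape_mx x.
Proof.
move=> x0; rewrite /shape_mx weingarten_hess// -scalemxAr linearZ /=.
by rewrite !trmx_mul tproj_sym wein_hess_sym// mulmxA.
Qed.

Lemma normal_shape_mx x : x != 0 -> normal x *m shape_mx x = 0.
Proof.
by move=> x0; rewrite mulmxA mulmxBr mulmx1 mulmxA normal_mulT// mul1mx subrr mul0mx.
Qed.

Lemma mulmx_tproj (m : nat) (F : 'M[R]_(m, n.+1)) x : F *m (normal x)^T = 0 -> F *m tproj x = F.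
Proof. by move=> Fn; rewrite mulmxBr mulmx1 mulmxA Fn mul0mx subr0. Qed.

Lemma mulmx_shape (m : nat) (F : 'M[R]_(m, n.+1)) x : F *m (normal x)^T = 0 ->
  F *m shape_mx x = F *m weingarten x.
Proof. by move=> Fn; rewrite mulmxA mulmx_tproj. Qed.

Lemma shape_mx_ge0 x v : x != 0 -> v *m (normal x)^T = 0 -> 0 <= dotv (v *m shape_mx x) v.
Proof.
move=> x0 vn; rewrite mulmx_shape// weingarten_hess// -scalemxAr dotvZl.
rewrite mulr_ge0 ?invr_ge0 ?enorm_ge0// mulmxA dotvE -mulmxA.
have Pv : tproj x *m v^T = v^T by rewrite -[tproj x]tproj_sym -trmx_mul mulmx_tproj.
rewrite -!mulmxA Pv mulmxA -dotvE.
exact: wein_hess_ge0.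
Qed.

End ambient_normal.

Lemma row_diag_mulmx {R : nzRingType} (m n : nat) (d : 'rV[R]_m) (F : 'M[R]_(m, n)) i :
  row i (diag_mx d *m F) = d 0 i *: row i F.
Proof. by apply/rowP => j; rewrite mul_diag_mx !mxE. Qed.

(** * Identification of normal, shape operator and curvatures *)

Section boundary_geometry.
Context {R : realType} {n : nat}.
Local Notation E := 'rV[R]_n.+1.
Variable Om : set E.
Hypothesis openOm : open Om.
Hypothesis convOm : convex_set Om.
Hypothesis bndOm : bounded_set Om.
Hypothesis Om0 : Om 0.
Hypothesis smOm : smooth_hypersurface (boundary Om).
Local Notation g := (gauge Om).
Local Notation U := [set x : E | x != 0].
Local Notation Sigma := (boundary Om).
Local Notation nrm := (normal Om).
Local Notation wein := (weingarten Om).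
Local Notation grad := (gauge_grad Om).

Let oU : open U := @open_nz R n.
Let Sig := boundary_gauge openOm convOm Om0.

Lemma boundary_neq0 p : Sigma p -> p != 0.
Proof.
rewrite Sig /= => gp; apply/eqP => p0; have := gauge0 openOm convOm Om0.
by rewrite -p0 gp => /eqP; rewrite oner_eq0.
Qed.

Lemma gauge_boundary p : Sigma p -> g p = 1.
Proof. by rewrite Sig. Qed.

(** On the boundary the differential of any local equation is a nonzero multiple of that of the
    gauge, so the kernel does not depend on the equation. *)
Lemma tangentP p w : Sigma p -> tangent Sigma p w <-> dotv (nrm p) w = 0.
Proof.
move=> Sp; have p0 := boundary_neq0 Sp.
have wE : dotv (nrm p) w = 0 <-> 'D_w g p = 0.
  rewrite derive_gauge// /normal dotvZl; split=> [/eqP|->]; last by rewrite mulr0.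
  by rewrite mulf_eq0 invr_eq0 gt_eqF ?enorm_grad_gt0//= => /eqP.
rewrite wE; split=> [[V [rho [leq D0]]]|].
  by rewrite (derive_gauge_boundary openOm convOm bndOm Om0 w leq Sp) D0 mul0r.
have [V [rho leq]] := smOm Sp.
have Dp := radial_transversal openOm convOm Om0 leq Sp.
rewrite (derive_gauge_boundary openOm convOm bndOm Om0 w leq Sp) => /eqP.
rewrite mulf_eq0 invr_eq0 (negbTE Dp) orbF => /eqP D0.
by exists V, rho.
Qed.

Lemma support_normal p : Sigma p -> dotv p (nrm p) = (enorm (grad p))^-1.
Proof.
move=> Sp; rewrite dotvZr dotvC gauge_grad_self ?gauge_boundary ?mulr1//.
exact: boundary_neq0.
Qed.

(** A unit vector orthogonal to the tangent space is the gauge normal or its opposite; along the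
    opposite the gauge decreases to first order, so the segment enters the closure. This uniqueness
    determines the choice in [outer_normal]. *)
Lemma outer_unit_normalP p v : Sigma p -> is_outer_unit_normal Om p v <-> v = nrm p.
Proof.
move=> Sp; have p0 := boundary_neq0 Sp.
have gp := gauge_boundary Sp; have w0 := enorm_grad_gt0 openOm convOm bndOm Om0 smOm p0.
split=> [[v1 vt vo]|->]; last first.
  split; first exact: normal_unit.
    by move=> w /tangentP; apply.
  near=> t; rewrite (closure_gauge openOm convOm Om0) /=; apply/negP; rewrite -ltNge.
  have := gauge_subgradient openOm convOm bndOm Om0 smOm (p + t *: nrm p) p0.
  rewrite dotvDr gauge_grad_self// gp dotvZr; apply: lt_le_trans.
  rewrite ltrDl mulr_gt0//.
  by rewrite {1}gauge_gradE// dotvZl normal_unit// mulr1.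
pose c := dotv (nrm p) v.
have vE : v = c *: nrm p.
  apply/eqP; rewrite -subr_eq0 -dotv_eq0.
  have tw : dotv (nrm p) (v - c *: nrm p) = 0.
    by rewrite dotvBr dotvZr normal_unit// mulr1 subrr.
  have /vt h : tangent Sigma p (v - c *: nrm p) by apply/tangentP.
  by rewrite dotvBl h dotvZl tw mulr0 subrr.
have c2 : c * c = 1 by move: v1; rewrite vE dotvZl dotvZr normal_unit// mulr1.
have [c0|c0] := leP c 0; last first.
  have c1 : c = 1 by nra.
  by rewrite vE c1 scale1r.
have cN : c = -1 by nra.
have dg := gauge_is_derive_grad openOm convOm bndOm Om0 smOm v p0.
have D0 : dotv (grad p) v < 0.
  rewrite gauge_gradE// dotvZl vE dotvZr normal_unit// mulr1 cN mulrN1 oppr_lt0.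
  exact: w0.
have e0 : 0 < - dotv (grad p) v / 2 by rewrite divr_gt0// oppr_gt0.
have [s s0 sP] := is_derive_small dg e0.
have [t [tO [t0 ts]]] : exists t, ~ closure Om (p + t *: v) /\ (0 < t /\ t < s).
  exact: filter_ex (filterI vo (filterI (nbhs_right_gt 0) (nbhs_right_lt s0))).
exfalso; apply: tO; rewrite (closure_gauge openOm convOm Om0) /=.
have := sP t; rewrite gtr0_norm// => /(_ ts); rewrite ler_norml gp => /andP[_].
set D := dotv _ _ in D0 *; move=> h.
have {}h : g (p + t *: v) - 1 - t * D <= - D / 2 * t by [].
have tD : t * D < 0 by rewrite pmulr_rlt0.
by clear -h tD; lra.
Unshelve. all: by end_near. Qed.

Lemma outer_normalE p : Sigma p -> outer_normal Om p = nrm p.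
Proof.
move=> Sp; rewrite /outer_normal; apply/(outer_unit_normalP _ Sp).
apply: (@xgetPex _ 0 [set v | is_outer_unit_normal Om p v]).
by exists (nrm p); apply/(outer_unit_normalP _ Sp).
Qed.

Lemma support_funE p : Sigma p -> support_fun Om p = dotv p (nrm p).
Proof. by move=> Sp; rewrite /support_fun outer_normalE. Qed.

Let proj (y : E) : E := (g y)^-1 *: y.

Let proj_Ck k : Ck k U proj.
Proof.
apply/Ck_rVP => // i; rewrite (_ : (fun y => _) = fun y => (g y)^-1 * y 0 i).
  apply: CkM => //; last exact: Ck_coord.
  apply: CkV => //; last exact: gauge_smooth.
  by move=> x x0; rewrite gt_eqF// gauge_gt0.
by apply/funext => y; rewrite mxE.
Qed.

Let proj_is_derive p w : Sigma p -> dotv (nrm p) w = 0 -> is_derive p w proj w.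
Proof.
move=> Sp tw; have p0 := boundary_neq0 Sp; have gp := gauge_boundary Sp.
have dg0 : is_derive p w g 0.
  have := gauge_is_derive_grad openOm convOm bndOm Om0 smOm w p0.
  by rewrite gauge_gradE// dotvZl tw mulr0.
apply/is_derive_rVP => i; rewrite (_ : (fun y => _) = fun y => (g y)^-1 * y 0 i); last first.
  by apply/funext => y; rewrite mxE.
have dV : is_derive p w (fun y => (g y)^-1) 0.
  have gp0 : g p != 0 by rewrite gp oner_eq0.
  have [dg gw] := dg0.
  by split; [exact: derivableV|rewrite deriveV// gw scaler0].
apply: is_derive_eqr (is_derive_mulr dV (is_derive_coord p w i)) _.
by rewrite mul0r add0r gp invr1 mul1r.
Qed.

(** Near [p] the gauge normal is [N] composed with the radial projection, whose derivative at [p]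
    fixes tangent vectors. All local extensions of the normal thus share their tangential
    derivatives. *)
Lemma tangential_derive p w V (N : E -> E) : Sigma p -> dotv (nrm p) w = 0 ->
  open V -> V p -> smooth_on V N -> {in Sigma `&` V, N =1 outer_normal Om} ->
  'D_w N p = w *m wein p.
Proof.
move=> Sp tw oV Vp sN HN; have p0 := boundary_neq0 Sp.
have gp := gauge_boundary Sp.
have pp : proj p = p by rewrite /proj gp invr1 scale1r.
have cp : {for p, continuous proj} := Ck_continuous (proj_Ck 0) p0.
have NE : \forall y \near p, normal Om y = N (proj y).
  have h1 : \forall y \near p, V (proj y).
    by apply: cp; rewrite pp; exact: open_nbhs_nbhs.
  have h2 : \forall y \near p, y != 0 by exact: (near_open oU p0).
  apply: filterS2 h1 h2 => y Vy y0.
  have Sy : Sigma (proj y) by exact: projection_boundary.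
  rewrite HN ?outer_normalE//; last exact/mem_set.
  by rewrite normal_scale// invr_gt0 gauge_gt0.
have DN : is_derive p w N ('D_w N p).
  by apply/derivableP; exact: Ck_derivable (sN 1%N) Vp.
have h : is_derive p w (fun y => N (proj y)) ('D_w N p).
  apply/is_derive_rVP => i.
  have cNi : Ck 1 V (fun y => N y 0 i) by have /Ck_rVP := sN 1%N; apply.
  have := @is_derive_comp R n.+1 n.+1 0 V (fun y => N y 0 i) proj p w w oV cNi.
  rewrite pp => /(_ Vp (proj_is_derive Sp tw) (Ck_rV_differentiable oU (proj_Ck 1) p0)).
  rewrite -(Ck_deriveE _ oV cNi Vp).
  have [_ ->] := (is_derive_rVP _ _ _ _).1 DN i.
  by [].
have [_ <-] := is_derive_near NE (is_derive_normal openOm convOm bndOm Om0 smOm w p0).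
by case: h.
Qed.

Lemma shape_operatorP p A : Sigma p -> is_shape_operator Om p A <-> A = shape_mx Om p.
Proof.
move=> Sp; have p0 := boundary_neq0 Sp.
have tT w : dotv (nrm p) w = 0 <-> w *m (nrm p)^T = 0.
  rewrite dotvC dotvE; split=> [h|->]; last by rewrite mxE.
  by apply/matrixP => a b; rewrite !ord1 h mxE.
split=> [[nA [V [N [oV Vp sN HN wA]]]]|->]; last first.
  split; first by rewrite outer_normalE// normal_shape_mx.
  exists U, nrm; split=> //; first exact: normal_smooth.
    by move=> y /set_mem[Sy _]; rewrite outer_normalE.
  move=> w /(tangentP _ Sp) tw; rewrite mulmx_shape//; last exact/tT.
  by have [_ ->] := is_derive_normal openOm convOm bndOm Om0 smOm w p0.
rewrite outer_normalE// in nA.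
apply/row_matrixP => i; rewrite !rowE.
set v : E := delta_mx 0 i.
pose w : E := v - dotv (nrm p) v *: nrm p.
suff H c : (c *: nrm p + w) *m A = (c *: nrm p + w) *m shape_mx Om p.
  by have := H (dotv (nrm p) v); rewrite addrC subrK.
have tw : dotv (nrm p) w = 0 by rewrite dotvBr dotvZr normal_unit// mulr1 subrr.
rewrite mulmxDl [RHS]mulmxDl -[c *: _ *m A]scalemxAl -[c *: _ *m shape_mx _ _]scalemxAl nA normal_shape_mx// (wA w); last exact/(tangentP _ Sp).
rewrite mulmx_shape; last exact/tT.
by rewrite (tangential_derive Sp tw oV Vp sN HN).
Qed.

Lemma shape_opE p : Sigma p -> shape_op Om p = shape_mx Om p.
Proof.
move=> Sp; apply/(shape_operatorP _ Sp).
apply: (@xgetPex _ 0 [set A | is_shape_operator Om p A]).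
by exists (shape_mx Om p); apply/(shape_operatorP _ Sp).
Qed.

Lemma principal_curvP p : Sigma p -> exists F : 'M[R]_(n, n.+1),
  [/\ F *m F^T = 1%:M, F *m (nrm p)^T = 0 &
      F *m shape_mx Om p = diag_mx (principal_curv Om p) *m F].
Proof.
move=> Sp; have p0 := boundary_neq0 Sp.
have [F [FF Ft FA]] : is_principal_curvatures Om p (principal_curv Om p).
  apply: (@xgetPex _ 0 [set kap | is_principal_curvatures Om p kap]).
  have [F [kap [FF Fn FA]]] := symmetric_eigenbasis
    (shape_mx_sym openOm convOm bndOm Om0 smOm p0)
    (normal_unit openOm convOm bndOm Om0 smOm p0)
    (normal_shape_mx openOm convOm bndOm Om0 smOm p0).
  exists kap, F; split=> // i.
    apply/(tangentP _ Sp); rewrite dotvC dotvE -row_mul Fn.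
    by rewrite !mxE.
  by rewrite shape_opE// -row_mul FA row_diag_mulmx.
exists F; split=> //.
  apply/row_matrixP => i; rewrite row_mul row0; apply/matrixP => a b.
  by rewrite !ord1 -dotvE dotvC mxE; apply/(tangentP _ Sp).
by apply/row_matrixP => i; rewrite row_mul -shape_opE// FA row_diag_mulmx.
Qed.

(** Take the position vector and the principal directions as a basis: it is one because <p, nu> is
    nonzero. In it the Weingarten matrix is diagonal with entries 0 and the principal curvatures,
    and [symf] is invariant under conjugation. *)
Lemma sigma_curvE j p : Sigma p -> sigma_curv Om j p = symf (wein p) j.
Proof.
move=> Sp; have p0 := boundary_neq0 Sp.
have [F [FF Fn FA]] := principal_curvP Sp.
set kap := principal_curv Om p in FA *.
have FM : F *m wein p = diag_mx kap *m F by rewrite -mulmx_shape.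
pose P : 'M[R]_(1 + n) := col_mx p F.
pose Q : 'M[R]_(1 + n) := row_mx (nrm p)^T F^T.
have PQ : P *m Q = block_mx (p *m (nrm p)^T) (p *m F^T) 0 1%:M.
  by rewrite mul_col_row FF Fn.
have uP : P \in unitmx.
  have : \det (P *m Q) != 0.
    rewrite PQ det_ublock det1 mulr1 det_mx11 -dotvE support_normal// invr_eq0.
    by rewrite gt_eqF// enorm_grad_gt0.
  by rewrite det_mulmx mulf_eq0 negb_or => /andP[d0 _]; rewrite unitmxE unitfE.
have PM : P *m wein p = diag_mx (row_mx 0%:M kap : 'rV[R]_(1 + n)) *m P.
  rewrite mul_col_mx FM position_weingarten// diag_mx_row mul_block_col !mul0mx addr0 add0r.
  by congr col_mx; apply/matrixP => a b; rewrite !mxE big1// => i _; rewrite !mxE !ord1 mul0rn mul0r.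
have [_ ->] := newton_mx_conj j uP PM.
have [_ ->] := symf_diag (consr 0 kap) j.
by rewrite esymp_consr0 coef_esymp.
Qed.

Lemma principal_curv_ge0 p i : Sigma p -> 0 <= principal_curv Om p 0 i.
Proof.
move=> Sp; have p0 := boundary_neq0 Sp.
have [F [FF Fn FA]] := principal_curvP Sp.
have fn : row i F *m (nrm p)^T = 0 by rewrite -row_mul Fn row0.
have := shape_mx_ge0 openOm convOm bndOm Om0 smOm p0 fn.
rewrite -row_mul FA row_diag_mulmx dotvZl.
have -> : dotv (row i F) (row i F) = 1.
  have /matrixP /(_ i i) := FF; rewrite [RHS]mxE eqxx mulr1n => <-.
  by rewrite mxE; apply: eq_bigr => j _; rewrite !mxE.
by rewrite mulr1.
Qed.

Lemma mean_curv_ge0 j p : Sigma p -> 0 <= mean_curv Om j p.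
Proof.
move=> Sp; apply: divr_ge0 => //; apply: sumr_ge0 => I _; apply: prodr_ge0 => i _.
exact: principal_curv_ge0.
Qed.

(** One tensor is built on the symmetric shape operator, the other on the Weingarten matrix. They
    may differ as ambient matrices but act alike on tangential rows, which stay tangential; this
    second fact carries the induction. *)
Lemma mulmx_newton j p (w : E) : Sigma p -> w *m (nrm p)^T = 0 ->
  w *m newton Om j p = w *m newton_mx (wein p) j /\
  w *m newton_mx (wein p) j *m (nrm p)^T = 0.
Proof.
move=> Sp; have p0 := boundary_neq0 Sp; elim: j w => [|j IH] w wn.
  by rewrite /= mulmx1.
have [h1 h2] := IH _ wn.
rewrite [newton _ _ _]/= newton_mxS sigma_curvE// !mulmxBr !mul_mx_scalar.
rewrite !mulmxA h1 shape_opE// mulmx_shape//; split=> //.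
rewrite mulmxBl -scalemxAl wn scaler0 -mulmxA -mulmxA weingarten_normal//.
by rewrite !mulmx0 subr0.
Qed.

Lemma newton_shape_formE j p Y : Sigma p -> Y *m (nrm p)^T = 0 ->
  newton_shape_form Om j p Y = dotv (Y *m wein p *m newton_mx (wein p) j) Y.
Proof.
move=> Sp Yn; have p0 := boundary_neq0 Sp.
rewrite /newton_shape_form shape_opE// mulmx_shape//.
have wn : Y *m wein p *m (nrm p)^T = 0 by rewrite -mulmxA weingarten_normal// mulmx0.
by have [-> _] := mulmx_newton j Sp wn.
Qed.

End boundary_geometry.

(** * Charts and polar coordinates *)

Section gram.
Context {R : realType} {n : nat}.
Local Notation E := 'rV[R]_n.+1.

Lemma gram_unit (m : nat) (J : 'M[R]_(n, m)) : row_free J -> \det (J *m J^T) != 0.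
Proof.
move=> Jf; rewrite -unitfE -unitmxE -row_free_unit -kermx_eq0.
apply/negPn/negP => /rowV0Pn[v /sub_kermxP vJ v0].
have : dotv (v *m J) (v *m J) = 0.
  by rewrite dotvE trmx_mul mulmxA -(mulmxA v) vJ mul0mx mxE.
move/eqP; rewrite dotv_eq0 => /eqP vJ0.
by move/eqP: v0; apply; apply: (row_free_inj Jf); rewrite vJ0 mul0mx.
Qed.

(* Replacing the first row of [col_mx p J] by the unit normal of the span of J
   divides the determinant by <p, nu>. *)
Lemma gram_det (p nu : E) (J : 'M[R]_(n, n.+1)) : dotv nu nu = 1 -> J *m nu^T = 0 ->
  row_free J -> \det (J *m J^T) * dotv p nu ^+ 2 = \det (col_mx p J : 'M[R]_(1 + n)) ^+ 2.
Proof.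
move=> nu1 Jn Jf; set G := \det (J *m J^T).
have G0 : G != 0 := gram_unit Jf.
pose b := \det (col_mx p J : 'M[R]_(1 + n)); pose e := \det (col_mx nu J : 'M[R]_(1 + n)).
have ort (q : E) : (col_mx q J : 'M[R]_(1 + n)) *m (col_mx nu J : 'M[R]_(1 + n))^T =
    block_mx (q *m nu^T) (q *m J^T) 0 (J *m J^T).
  by rewrite tr_col_mx mul_col_row Jn.
have be : b * e = dotv p nu * G.
  by rewrite /b /e -[X in _ * X]det_tr -det_mulmx ort det_ublock det_mx11 -dotvE.
have ee : e * e = G.
  rewrite -{2}[e]det_tr -det_mulmx ort det_ublock det_mx11 -dotvE nu1 mul1r//.
have e0 : e != 0 by apply: contra_neq G0 => e0; rewrite -ee e0 mulr0.
have bE : b = dotv p nu * e by apply: (mulIf e0); rewrite be -ee mulrA.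
by rewrite -/b bE -ee; ring.
Qed.

(** Differential of [insr]: the standard basis without its [c]-th vector. *)
Definition selmx (c : 'I_n.+1) : 'M[R]_(n, n.+1) := \matrix_(i, j) (j == lift c i)%:R.

Lemma det_selmx (p : E) c : \det (col_mx p (selmx c) : 'M[R]_(1 + n)) ^+ 2 = p 0 c ^+ 2.
Proof.
have SS : selmx c *m (selmx c)^T = 1%:M.
  apply/matrixP => i j; rewrite !mxE (bigD1 (lift c i))//= !mxE eqxx mul1r.
  rewrite (inj_eq (@lift_inj _ _)) big1 ?addr0// => k ki.
  by rewrite !mxE (negbTE ki) mul0r.
have Se : selmx c *m (delta_mx 0 c : E)^T = 0.
  apply/colP => i; rewrite !mxE (bigD1 c)//= !mxE (negbTE (neq_lift c i)) mul0r.
  by rewrite big1 ?addr0// => k ki; rewrite !mxE (negbTE ki) andbF mulr0.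
have dd : dotv (delta_mx 0 c : E) (delta_mx 0 c) = 1 by rewrite dotv_delta mxE !eqxx.
rewrite -(gram_det p dd Se); first by rewrite SS det1 mul1r dotv_delta.
by apply/row_freeP; exists (selmx c)^T.
Qed.

End gram.

Section charts.
Context {R : realType} {n : nat}.
Local Notation E := 'rV[R]_n.+1.
Variable Om : set E.
Hypothesis openOm : open Om.
Hypothesis convOm : convex_set Om.
Hypothesis bndOm : bounded_set Om.
Hypothesis Om0 : Om 0.
Hypothesis smOm : smooth_hypersurface (boundary Om).
Local Notation g := (gauge Om).
Local Notation U := [set x : E | x != 0].
Local Notation Sigma := (boundary Om).
Local Notation nrm := (normal Om).
Local Notation grad := (gauge_grad Om).
Let oU : open U := @open_nz R n.
Let Sig := boundary_gauge openOm convOm Om0.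

Definition gproj (x : E) : E := (g x)^-1 *: x.

Lemma gproj_boundary x : x != 0 -> Sigma (gproj x).
Proof. exact: projection_boundary. Qed.

Lemma gproj_is_derive x w : x != 0 ->
  is_derive x w gproj ((g x)^-1 *: (w - dotv (grad x) w *: gproj x)).
Proof.
move=> x0; have gx := gauge_gt0 openOm convOm bndOm Om0 x0.
have gx0 : g x != 0 by rewrite gt_eqF.
have [dg gw] := gauge_is_derive_grad openOm convOm bndOm Om0 smOm w x0.
apply/is_derive_rVP => i; rewrite (_ : (fun y => _) = fun y => (g y)^-1 * y 0 i); last first.
  by apply/funext => y; rewrite mxE.
have dV : is_derive x w (fun y => (g y)^-1) (- (g x) ^- 2 * dotv (grad x) w).
  by split; [exact: derivableV|rewrite deriveV// gw].
apply: is_derive_eqr (is_derive_mulr dV (is_derive_coord x w i)) _.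
rewrite !mxE; field; exact: gx0.
Qed.

Lemma gproj_Ck k : Ck k U gproj.
Proof.
apply/Ck_rVP => // i; rewrite (_ : (fun y => _) = fun y => (g y)^-1 * y 0 i).
  apply: CkM => //; last exact: Ck_coord.
  apply: CkV => //; last exact: gauge_smooth.
  by move=> x x0; rewrite gt_eqF// gauge_gt0.
by apply/funext => y; rewrite mxE.
Qed.

Definition insr (c : 'I_n.+1) (eps : R) (y : 'rV[R]_n) : E :=
  \row_j (if unlift c j is Some i then y 0 i else eps).

Lemma insr_c c eps y : insr c eps y 0 c = eps.
Proof. by rewrite mxE unlift_none. Qed.

Lemma insr_lift c eps y i : insr c eps y 0 (lift c i) = y 0 i.
Proof. by rewrite mxE liftK. Qed.

Lemma insr_eq c (x x' : E) : x 0 c = x' 0 c ->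
  (forall i, x 0 (lift c i) = x' 0 (lift c i)) -> x = x'.
Proof.
move=> xc xl; apply/rowP => j; case: (unliftP c j) => [i ->|->//]; exact: xl.
Qed.

Lemma insr_consr eps (y : 'rV[R]_n) : insr ord0 eps y = consr eps y.
Proof.
apply: (@insr_eq ord0) => [|i]; first by rewrite insr_c consr0.
by rewrite insr_lift consrS.
Qed.

Variables (c : 'I_n.+1) (eps : R).
Hypothesis eps1 : eps ^+ 2 = 1.
Local Notation ins := (insr c eps).

Lemma insr_neq0 y : ins y != 0.
Proof.
apply/eqP => /rowP /(_ c); rewrite insr_c mxE => e0.
by move: eps1; rewrite e0 expr0n => /eqP; rewrite eq_sym oner_eq0.
Qed.

(** Central projection of the hyperplane x_c = eps, with eps = 1 or -1. It covers the boundary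
    points whose [c]-th coordinate has the sign of [eps]. *)
Definition chart (y : 'rV[R]_n) : E := gproj (ins y).

Lemma insr_Ck k : Ck k [set: 'rV[R]_n] ins.
Proof.
apply/Ck_rVP => [|j]; first exact: openT.
case: (unliftP c j) => [i|] ->.
  rewrite (_ : (fun y => _) = fun y : 'rV[R]_n => y 0 i); first exact: Ck_coord openT.
  by apply/funext => y; rewrite insr_lift.
rewrite (_ : (fun y : 'rV[R]_n => _) = fun=> eps); first exact: Ck_cst openT.
by apply/funext => y; rewrite insr_c.
Qed.

Lemma chart_smooth : smooth_on [set: 'rV[R]_n] chart.
Proof.
move=> k; apply/Ck_rVP => [|j]; first exact: openT.
apply: (@Ck_comp R _ _ k setT U (fun x => gproj x 0 j) ins) => //.
- exact: openT.
- by move=> y _; exact: insr_neq0.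
- by have /Ck_rVP := gproj_Ck k; apply.
- exact: insr_Ck.
Qed.

Lemma chart_boundary y : Sigma (chart y).
Proof. exact/gproj_boundary/insr_neq0. Qed.

Lemma gauge_ins_gt0 y : 0 < g (ins y).
Proof. by apply: gauge_gt0 => //; exact: insr_neq0. Qed.

Lemma chart_c y : chart y 0 c = (g (ins y))^-1 * eps.
Proof. by rewrite mxE insr_c. Qed.

Lemma chart_lift y i : chart y 0 (lift c i) = (g (ins y))^-1 * y 0 i.
Proof. by rewrite mxE insr_lift. Qed.

Lemma eps_norm : `|eps| = 1.
Proof. by apply/eqP; rewrite -sqr_norm_eq1 eps1. Qed.

Lemma chart_normc y : `|chart y 0 c| = (g (ins y))^-1.
Proof. by rewrite chart_c normrM eps_norm mulr1 gtr0_norm// invr_gt0 gauge_ins_gt0. Qed.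

Definition chart_inv (p : E) : 'rV[R]_n := \row_i (`|p 0 c|^-1 * p 0 (lift c i)).

Lemma chartK y : chart_inv (chart y) = y.
Proof.
apply/rowP => i; rewrite mxE chart_normc chart_lift invrK mulrA divff ?mul1r//.
by rewrite gt_eqF// gauge_ins_gt0.
Qed.

Definition half_boundary : set E := Sigma `&` [set p | 0 < eps * p 0 c].

Lemma chart_half y : half_boundary (chart y).
Proof.
split; first exact: chart_boundary.
by rewrite /= chart_c mulrCA -expr2 eps1 mulr1 invr_gt0 gauge_ins_gt0.
Qed.

Lemma chart_invK p : half_boundary p -> chart (chart_inv p) = p.
Proof.
move=> [Sp /= pc].
have eN : `|p 0 c| = eps * p 0 c.
  by rewrite -[LHS]mul1r -eps_norm -normrM gtr0_norm.
have insE : ins (chart_inv p) = `|p 0 c|^-1 *: p.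
  apply: (@insr_eq c) => [|i]; last by rewrite insr_lift !mxE.
  rewrite insr_c mxE eN.
  have pc0 : p 0 c != 0 by apply: contraTneq pc => ->; rewrite mulr0 ltxx.
  have e0 : eps != 0 by apply: contraTneq pc => ->; rewrite mul0r ltxx.
  by rewrite invfM mulrAC -mulrA divff// mulr1; apply: (mulfI e0); rewrite divff// -expr2.
have pn : 0 < `|p 0 c|^-1 by rewrite invr_gt0 eN.
rewrite /chart insE /gproj gaugeZ// gauge_boundary// mulr1 invrK scalerA divff ?scale1r//.
by rewrite eN gt_eqF.
Qed.

Let J y : 'M[R]_(n, n.+1) := 'J chart y.

Lemma chart_jacobian y : J y =
  (g (ins y))^-1 *: selmx c +
  (\col_i (- (g (ins y))^-1 * grad (ins y) 0 (lift c i))) *m chart y.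
Proof.
apply/row_matrixP => i; have x0 := insr_neq0 y.
rewrite rowE -deriveEjacobian; last first.
  exact: Ck_rV_differentiable openT (chart_smooth 1%N) _.
have h : is_derive y (delta_mx 0 i) chart
    ((g (ins y))^-1 *: (row i (selmx c) - dotv (grad (ins y)) (row i (selmx c)) *: chart y)).
  apply: (@is_derive_affine R _ _ _ ins gproj y (delta_mx 0 i) (row i (selmx c))).
    move=> h; apply: (@insr_eq c) => [|k].
      rewrite [RHS]mxE !insr_c (_ : (h *: row i (selmx c)) 0 c = 0) ?add0r//.
      by rewrite !mxE (negbTE (neq_lift c i)) mulr0.
    rewrite [RHS]mxE !insr_lift !mxE (inj_eq (@lift_inj _ _)) eqxx /=.
    by rewrite eq_sym.
  exact: gproj_is_derive.
have [_ ->] := h; apply/rowP => k; rewrite !mxE big_ord1 !mxE.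
have -> : dotv (grad (ins y)) (row i (selmx c)) = grad (ins y) 0 (lift c i).
  rewrite /dotv (bigD1 (lift c i))//= !mxE eqxx mulr1 big1 ?addr0// => l li.
  by rewrite !mxE (negbTE li) mulr0.
by rewrite [grad _ _ _]mxE; ring.
Qed.

Lemma chart_jacobian_normal y : J y *m (nrm (chart y))^T = 0.
Proof.
have x0 := insr_neq0 y; have gi : 0 < (g (ins y))^-1 by rewrite invr_gt0 gauge_ins_gt0.
have gE : grad (chart y) = grad (ins y) by exact: gauge_grad_scale.
suff : J y *m (grad (chart y))^T = 0.
  by rewrite /normal linearZ /= -scalemxAr => ->; rewrite scaler0.
have c0 : chart y != 0 by exact: scale_neq0.
have cg : chart y *m (grad (chart y))^T = 1%:M.
  apply/matrixP => a b; rewrite !ord1 -dotvE dotvC gauge_grad_self// mxE eqxx.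
  by rewrite (gauge_boundary openOm convOm Om0 (chart_boundary y)).
rewrite chart_jacobian mulmxDl -mulmxA cg mulmx1 -scalemxAl gE.
apply/colP => i; rewrite !mxE (bigD1 (lift c i))//= !mxE eqxx mul1r.
rewrite big1 ?addr0; last by move=> l li; rewrite !mxE (negbTE li) mul0r.
by rewrite mulNr subrr.
Qed.

(** Modulo multiples of the first row [chart y], the Jacobian is a multiple of [selmx c], so a block
    triangular factor reduces the determinant to a coordinate of [chart y]. *)
Lemma chart_det y : \det (col_mx (chart y) (J y) : 'M[R]_(1 + n)) ^+ 2 = ((g (ins y))^-1 ^+ n.+1) ^+ 2.
Proof.
set r := (g (ins y))^-1; set d : 'cV[R]_n := \col_i (- r * grad (ins y) 0 (lift c i)).
have -> : (col_mx (chart y) (J y) : 'M[R]_(1 + n)) =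
    (block_mx 1%:M 0 d r%:M : 'M[R]_(1 + n)) *m (col_mx (chart y) (selmx c) : 'M[R]_(1 + n)).
  rewrite mul_block_col mul1mx mul0mx addr0 mul_scalar_mx chart_jacobian addrC.
  by [].
rewrite det_mulmx det_lblock det1 mul1r det_scalar exprMn det_selmx chart_c -/r.
by rewrite exprMn eps1 mulr1 -exprMn -exprSr.
Qed.

Lemma chart_row_free y : row_free (J y).
Proof.
have : (col_mx (chart y) (J y) : 'M[R]_(1 + n)) \in unitmx.
  have : \det (col_mx (chart y) (J y) : 'M[R]_(1 + n)) ^+ 2 != 0.
    by rewrite chart_det !expf_eq0 /= invr_eq0 gt_eqF// gauge_ins_gt0.
  by rewrite expf_eq0 /= => d0; rewrite unitmxE unitfE.
move=> uP; apply/row_freeP.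
exists (rsubmx (invmx (col_mx (chart y) (J y) : 'M[R]_(1 + n)))).
have := mulmxV uP; set Q := invmx _.
rewrite -{1}[Q]hsubmxK mul_col_row -[1%:M]submxK => /eq_block_mx[_ _ _ ->].
by apply/matrixP => i j; rewrite !mxE /= -val_eqE /= eqn_add2l.
Qed.

Definition chart_weight (y : 'rV[R]_n) : R :=
  (g (ins y))^-1 ^+ n.+1 * enorm (grad (ins y)).

Lemma chart_weight_ge0 y : 0 <= chart_weight y.
Proof.
by rewrite mulr_ge0 ?enorm_ge0// exprn_ge0// invr_ge0; exact/ltW/gauge_ins_gt0.
Qed.

(** [gram_det] divides the determinant of [chart_det] by <p, nu>, which is 1 / |grad g| on the
    boundary. *)
Lemma chart_area y : Num.sqrt (\det (J y *m (J y)^T)) = chart_weight y.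
Proof.
have x0 := insr_neq0 y; have gi : 0 < (g (ins y))^-1 by rewrite invr_gt0 gauge_ins_gt0.
have c0 : chart y != 0 by exact: scale_neq0.
have := gram_det (chart y) (normal_unit openOm convOm bndOm Om0 smOm c0)
  (chart_jacobian_normal y) (chart_row_free y).
rewrite (support_normal openOm convOm bndOm Om0 smOm (chart_boundary y)) chart_det.
rewrite (_ : grad (chart y) = grad (ins y)); last exact: gauge_grad_scale.
have w0 := enorm_grad_gt0 openOm convOm bndOm Om0 smOm x0.
move=> h.
have -> : \det (J y *m (J y)^T) = chart_weight y ^+ 2.
  have w2 : (enorm (grad (ins y)))^-1 ^+ 2 != 0 by rewrite expf_eq0 /= invr_eq0 gt_eqF.
  apply: (mulIf w2); rewrite h /chart_weight exprMn -mulrA -[X in _ * X]exprMn.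
  by rewrite divff ?expr1n ?mulr1// gt_eqF.
by rewrite sqrtr_sqr ger0_norm// chart_weight_ge0.
Qed.

End charts.

Lemma continuous_cstM {R : realType} (V : topologicalType) (c : R) (f : V -> R) :
  continuous f -> continuous (fun x => c * f x).
Proof. by move=> cf x; apply: cvgM; [exact: cvg_cst|exact: cf]. Qed.

Lemma CkX {R : realType} (V : normedModType R) (k m : nat) (U : set V) (f : V -> R) :
  open U -> Ck k U f -> Ck k U (fun x => f x ^+ m).
Proof.
move=> oU cf; elim: m => [|m IH]; first exact: Ck_cst.
by rewrite (_ : (fun x => _) = fun x => f x * f x ^+ m); [exact: CkM|apply/funext => x; rewrite exprS].
Qed.

Lemma leb_hyperplane {R : realType} (d : nat) (i : 'I_d) :
  @leb R d [set x : 'rV[R]_d | x ord0 i = 0] = 0%E.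
Proof.
have mH e (j : 'I_e) : measurable ([set x : 'rV[R]_e | x ord0 j = 0] : set (borelType 'rV[R]_e)).
  apply: measurable_closed; apply: (@closed_comp _ _ (fun x : 'rV[R]_e => x ord0 j) [set t | t = 0]).
    by move=> x _; exact: coord_continuous.
  exact: closed_eq.
have iE e (j : 'I_e) : @leb R e [set x : 'rV[R]_e | x ord0 j = 0] =
    (\int[@leb R e]_x (\1_[set x : 'rV[R]_e | x ord0 j = 0] x)%:E)%E.
  by rewrite integral_indic ?setIT.
elim: d i => [[]//|d IH] i; rewrite iE.
have mf : measurable_fun setT
    (fun x : borelType 'rV[R]_d.+1 => (\1_[set x : 'rV[R]_d.+1 | x ord0 i = 0] x)%:E : \bar R).
  by apply/measurable_EFinP; apply: measurable_indic; exact: mH.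
case: (unliftP ord0 i) mf => [j ->|->] mf.
- rewrite (leb_tonelli1 mf) => [|x]; last by rewrite lee_fin.
  rewrite integral0_eq// => t _; rewrite -[RHS](IH j) iE.
  apply: eq_integral => x _; rewrite !indicE; congr ((nat_of_bool _)%:R%:E).
  by apply/idP/idP => /set_mem/= h; apply/mem_set => /=; move: h; rewrite consrS.
- rewrite (leb_tonelli2 mf) => [|x]; last by rewrite lee_fin.
  rewrite integral0_eq// => x _.
  rewrite (_ : (fun t => _) = (fun t : R => (\1_[set 0] t)%:E)).
    rewrite (@integral_indic _ _ _ lebesgue_measure setT measurableT [set (0 : R)])// setIT.
    exact: lebesgue_measure_set1.
  apply/funext => t; congr (_%:E); rewrite !indicE; congr ((nat_of_bool _)%:R).
  by apply/idP/idP => /set_mem/= h; apply/mem_set => /=; move: h; rewrite consr0.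
Qed.

(** * Area measure and polar coordinates *)

Section polar.
Context {R : realType} {n : nat}.
Local Notation E := 'rV[R]_n.+1.
Variable Om : set E.
Hypothesis openOm : open Om.
Hypothesis convOm : convex_set Om.
Hypothesis bndOm : bounded_set Om.
Hypothesis Om0 : Om 0.
Hypothesis smOm : smooth_hypersurface (boundary Om).
Variable mu : {measure set (borelType E) -> \bar R}.
Hypothesis area : area_measure (boundary Om) mu.
Local Notation g := (gauge Om).
Local Notation U := [set x : E | x != 0].
Local Notation Sigma := (boundary Om).
Local Notation nrm := (normal Om).
Local Notation grad := (gauge_grad Om).
Let oU : open U := @open_nz R n.

Lemma measurable_boundary : measurable (Sigma : set (borelType E)).
Proof.
apply: measurable_closed; rewrite /boundary setDE; apply: closedI; first exact: closed_closure.
by apply: open_closedC; exact: open_interior.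
Qed.

Lemma continuous_nz_measurable (f : E -> R) : (forall x, x != 0 -> {for x, continuous f}) ->
  measurable_fun setT (f : borelType E -> R).
Proof.
move=> cf; have mU : measurable (U : set (borelType E)) by exact: measurable_open.
have -> : [set: borelType E] = U `|` [set 0].
  by apply/seteqP; split => // x _ /=; have [->|] := eqVneq x 0; [right|left].
apply/measurable_funU => //.
  rewrite (_ : [set 0] = ~` U); first exact: measurableC.
  by apply/seteqP; split => x /=; [move=> ->; rewrite eqxx|move=> /negP/negPn/eqP].
split; first by apply: continuous_on_measurable.
exact: measurable_fun_set1.
Qed.

Lemma inv_grad_Ck k : Ck k U (fun x => (enorm (grad x))^-1).
Proof.
apply: CkV => //; last exact: grad_norm_Ck.
by move=> x x0; rewrite gt_eqF// enorm_grad_gt0.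
Qed.

Lemma measurable_inv_grad : measurable_fun setT ((fun x => (enorm (grad x))^-1) : borelType E -> R).
Proof.
by apply: continuous_nz_measurable => x x0; exact: Ck_continuous (inv_grad_Ck 0) x0.
Qed.

Section one_chart.
Variables (c : 'I_n.+1) (eps : R).
Hypothesis eps1 : eps ^+ 2 = 1.
Local Notation ins := (insr c eps).
Local Notation phi := (chart Om c eps).
Local Notation half := (half_boundary Om c eps).
Local Notation wt := (chart_weight Om c eps).

Lemma measurable_half : measurable (half : set (borelType E)).
Proof.
apply: measurableI; first exact: measurable_boundary.
apply: measurable_open; apply: (@open_comp _ _ (fun p : E => eps * p 0 c) [set t | 0 < t]).
  by move=> p _; apply: continuous_cstM; exact: coord_continuous.
exact: open_gt.
Qed.

Lemma measurable_chart : measurable_fun setT (phi : borelType 'rV[R]_n -> borelType E).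
Proof.
apply: borel_coord => i; apply: continuous_rV_measurable => y.
have /Ck_rVP : Ck 0 [set: 'rV[R]_n] phi by exact: chart_smooth.
by move=> /(_ openT i) h; exact: Ck_continuous h I.
Qed.

Lemma measurable_chart_preimage (A : set (borelType E)) : measurable A ->
  measurable (phi @^-1` A : set (borelType 'rV[R]_n)).
Proof. by move=> mA; rewrite -[_ @^-1` _]setTI; apply: measurable_chart. Qed.

Lemma measurable_chart_weight : measurable_fun setT (wt : borelType 'rV[R]_n -> R).
Proof.
apply: continuous_rV_measurable => y.
have cw : Ck 0 [set: 'rV[R]_n] (fun y => ((g (ins y))^-1 ^+ n.+1 * enorm (grad (ins y)))).
  apply: (@Ck_comp R _ _ 0 setT U (fun x => (g x)^-1 ^+ n.+1 * enorm (grad x)) ins) => //.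
  - exact: openT.
  - by move=> z _; exact: insr_neq0.
  - apply: CkM => //; last exact: grad_norm_Ck.
    apply: CkX => //; apply: CkV => //; last exact: gauge_smooth.
    by move=> x x0; rewrite gt_eqF// gauge_gt0.
  - exact: insr_Ck.
exact: Ck_continuous cw I.
Qed.

Lemma half_measure (A : set (borelType E)) : measurable A ->
  mu (A `&` half) = (\int[@leb R n]_y (\1_A (phi y) * wt y)%:E)%E.
Proof.
move=> mA; pose B : set (borelType 'rV[R]_n) := phi @^-1` A.
have mB : measurable B by exact: measurable_chart_preimage.
have -> : A `&` half = phi @` B.
  apply/seteqP; split => [p [Ap hp]|p [y By <-]].
    by exists (chart_inv c p); rewrite /B /= ?(chart_invK openOm convOm Om0 eps1 hp).
  by split => //; exact: chart_half.
have := @area setT phi openT (chart_smooth openOm convOm bndOm Om0 smOm c eps1) _ _ _ B mB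
  (fun _ _ => I).
move=> ->; last 3 first.
- move=> x y _ _ xy.
  by have := congr1 (chart_inv c) xy; rewrite !chartK.
- by move=> x _; exact: chart_row_free.
- by move=> _ [y _ <-]; exact: chart_boundary.
rewrite (_ : (fun x => _) = (fun y => (\1_A (phi y) * wt y)%:E)).
  apply: lebesgue_intE => [|y]; last by rewrite lee_fin mulr_ge0// chart_weight_ge0.
  apply/measurable_EFinP; apply: measurable_funM; last exact: measurable_chart_weight.
  rewrite (_ : (fun y => _) = \1_B); first exact: measurable_indic.
  by apply/funext => y; rewrite !indicE.
by apply/funext => y; rewrite chart_area// !indicE.
Qed.

Lemma half_integral (F : borelType E -> \bar R) : measurable_fun setT F ->
  (forall x, (0 <= F x)%E) ->
  (\int[mu]_(p in half) F p = \int[@leb R n]_y (F (phi y) * (wt y)%:E))%E.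
Proof.
move=> mF F0; apply: ge0_integral_transfer => //.
- exact: measurable_chart.
- exact: measurable_chart_weight.
- by move=> y; exact: chart_weight_ge0.
- exact: measurable_half.
- by move=> A mA; exact: half_measure.
Qed.

(** Sliding the ray from the chart hyperplane to the boundary produces g^(n+1), which cancels the
    power in the chart weight, while the factor 1 / |grad g| cancels the other one. *)
Lemma half_ray_integral (F : borelType E -> \bar R) : measurable_fun setT F ->
  (forall x, (0 <= F x)%E) ->
  (\int[mu]_(p in half) ((enorm (grad p))^-1%:E * ray_integral n F p) =
   \int[@leb R n]_y ray_integral n F (ins y))%E.
Proof.
move=> mF F0; rewrite half_integral//; last 2 first.
- apply: emeasurable_funM; last exact: measurable_ray_integral.
  by apply/measurable_EFinP; exact: measurable_inv_grad.
- by move=> x; rewrite mule_ge0 ?lee_fin ?invr_ge0 ?enorm_ge0// ray_integral_ge0.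
apply: eq_integral => y _; have x0 := insr_neq0 c eps1 y.
have gi : 0 < (g (ins y))^-1 by rewrite invr_gt0 gauge_gt0.
rewrite (ray_integral_scale n (ins y) mF F0 gi) -/(gproj _ _) -/(phi y).
have -> : grad (phi y) = grad (ins y) by exact: gauge_grad_scale.
rewrite muleAC -EFinM mulrCA mulVf ?mulr1//.
by rewrite gt_eqF// enorm_grad_gt0.
Qed.

End one_chart.


(** The area measure is known only through charts, and the two charts along the first coordinate
    miss the points with p_0 = 0. Every such point lies in a chart along another coordinate, where
    the equator becomes a coordinate hyperplane of the parameter space. *)
Lemma equator_null : mu (Sigma `&` [set p | p 0 0 = 0]) = 0%E.
Proof.
pose H : set (borelType E) := [set p : E | p 0 0 = 0].
have mH : measurable H.
  apply: measurable_closed; apply: (@closed_comp _ _ (fun x : E => x 0 0) [set t | t = 0]).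
    by move=> x _; exact: coord_continuous.
  exact: closed_eq.
have null c eps : eps ^+ 2 = 1 -> mu.-negligible (H `&` half_boundary Om c eps).
  move=> e1; exists (H `&` half_boundary Om c eps); split=> //.
    by apply: measurableI => //; exact: measurable_half.
  rewrite half_measure//.
  have mN := measurable_chart_preimage c e1 mH.
  case: (unliftP c 0) => [i ci|c0]; last first.
    rewrite integral0_eq// => y _; rewrite indicE memNset ?mul0r//.
    rewrite /H /= [X in _ X = _](_ : _ = c) ?chart_c//.
    move/eqP; rewrite mulf_eq0 invr_eq0 gt_eqF ?gauge_ins_gt0//= => /eqP e0.
    by move: e1; rewrite e0 expr0n => /eqP; rewrite eq_sym oner_eq0.
  have HE : chart Om c eps @^-1` H = [set y : 'rV[R]_n | y ord0 i = 0].
    apply/seteqP; split => y; rewrite /= /H /= ci chart_lift; last by move=> ->; rewrite mulr0.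
    by move/eqP; rewrite mulf_eq0 invr_eq0 gt_eqF ?gauge_ins_gt0//= => /eqP.
  rewrite (_ : (fun y => _) = (fun y => (chart_weight Om c eps y)%:E) \_ (chart Om c eps @^-1` H)).
    rewrite -integral_mkcond null_set_integral//; last by rewrite HE; exact: (@leb_hyperplane R n i).
    by apply/measurable_funTS/measurable_EFinP; exact: measurable_chart_weight.
  apply/funext => y; rewrite patchE indicE.
  have -> : (chart Om c eps y \in H) = (y \in chart Om c eps @^-1` H) by [].
  by case: (_ \in _); rewrite ?mul1r ?mul0r.
(* The union is indexed by natural numbers; [inord] lists the finitely many charts with
   repetition. *)
have : mu.-negligible (\bigcup_k ((H `&` half_boundary Om (inord k : 'I_n.+1) 1) `|`
    (H `&` half_boundary Om (inord k : 'I_n.+1) (-1)))).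
  apply: negligible_bigcup => k; apply: negligibleU; apply: null.
    by rewrite expr1n.
  by rewrite sqrrN expr1n.
move=> [B [mB B0 sB]]; apply/eqP; rewrite eq_le measure_ge0 andbT -B0.
apply: le_measure => //; rewrite ?inE//.
  by apply: measurableI => //; exact: measurable_boundary.
move=> p [Sp p0]; apply: sB.
have pn0 : p != 0 := boundary_neq0 openOm convOm Om0 Sp.
have [j pj] : exists j, p 0 j != 0.
  by apply/existsP; apply: contra_neqT pn0 => /existsPn h; apply/rowP => j;
    rewrite mxE; apply/eqP; have := h j; rewrite negbK.
exists j => //=; rewrite inord_val.
have [pj0|pj0|pj0] := ltgtP (p 0 j) 0.
- by right; split=> //; split=> //=; rewrite mulN1r oppr_gt0.
- by left; split=> //; split=> //=; rewrite mul1r.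
- by rewrite pj0 eqxx in pj.
Qed.

Lemma boundary_integral (F : borelType E -> \bar R) : measurable_fun setT F ->
  (forall x, (0 <= F x)%E) ->
  (\int[mu]_(p in Sigma) F p = \int[mu]_(p in half_boundary Om ord0 1) F p +
    \int[mu]_(p in half_boundary Om ord0 (-1)) F p)%E.
Proof.
move=> mF F0; have mS := measurable_boundary.
have mN : measurable (Sigma `&` [set p | p 0 0 = 0] : set (borelType E)).
  apply: measurableI => //.
  apply: measurable_closed; apply: (@closed_comp _ _ (fun x : E => x 0 0) [set t | t = 0]).
    by move=> x _; exact: coord_continuous.
  exact: closed_eq.
rewrite (ge0_negligible_integral mN)//; last 2 first.
- exact: measurable_funTS.
- exact: equator_null.
rewrite (_ : _ `\` _ = half_boundary Om ord0 1 `|` half_boundary Om ord0 (-1)).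
  apply: ge0_integral_setU; [exact: measurable_half|exact: measurable_half|exact: measurable_funTS|by move=> x _; exact: F0|].
  apply/disj_set2P/seteqP; split => // p [[_ /= h1] [_ /= h2]].
  by move: h1 h2; rewrite mul1r mulN1r oppr_gt0 => /lt_trans h /h; rewrite ltxx.
apply/seteqP; split => p.
  move=> [Sp /not_andP[//|/= /eqP p0]].
  have [pj0|pj0|pj0] := ltgtP (p 0 0) 0; last by rewrite pj0 eqxx in p0.
    by right; split => //=; rewrite mulN1r oppr_gt0.
  by left; split => //=; rewrite mul1r.
move=> [] [Sp /= p0]; split=> //= -[_ p00]; move: p0; rewrite p00 mulr0 ltxx//.
Qed.

(* Polar coordinates x = t p with p on the boundary: dx = t^n dt <p, nu> dmu. *)
Theorem polar_formula (F : borelType E -> \bar R) : measurable_fun setT F ->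
  (forall x, (0 <= F x)%E) ->
  (\int[@leb R n.+1]_x F x =
   \int[mu]_(p in Sigma) ((enorm (grad p))^-1%:E * ray_integral n F p))%E.
Proof.
move=> mF F0; rewrite boundary_integral//; last 2 first.
- apply: emeasurable_funM; last exact: measurable_ray_integral.
  by apply/measurable_EFinP; exact: measurable_inv_grad.
- by move=> x; rewrite mule_ge0 ?lee_fin ?invr_ge0 ?enorm_ge0// ray_integral_ge0.
have e1 : (1 : R) ^+ 2 = 1 by rewrite expr1n.
have eN : (-1 : R) ^+ 2 = 1 by rewrite sqrrN expr1n.
have hE eps (e : eps ^+ 2 = 1) := half_ray_integral ord0 e mF F0.
have iE eps : insr ord0 eps = @consr R n eps by apply/funext => y; exact: insr_consr.
by rewrite (leb_cone mF F0) (hE _ e1) (hE _ eN) !iE.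
Qed.

End polar.

(** * The weighted Minkowski formula *)

Section newton_divergence.
Context {R : realType} {n : nat}.
Implicit Types M N : 'M[R]_n.+1.

(** The linearization of the identity T_j M = M T_j. *)
Lemma dnewton_mx_comm M N j : dnewton_mx M N j *m M + newton_mx M j *m N =
  N *m newton_mx M j + M *m dnewton_mx M N j.
Proof.
elim: j => [|j IH]; first by rewrite /= mul0mx mulmx0 mul1mx mulmx1 add0r addr0.
have TM := newton_mx_comm M j.
rewrite dnewton_mxS newton_mxS !mulmxBl !mulmxBr {1}IH.
rewrite !mul_scalar_mx !mul_mx_scalar mulmxDl mulmxDr -!mulmxA TM.
have TMN : newton_mx M j *m (M *m N) = M *m (newton_mx M j *m N) by rewrite mulmxA TM mulmxA.
rewrite TMN; set a := _ *: M; set b := _ *: N.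
set X := N *m (M *m _); set Y := M *m (_ *m M); set Z := M *m (_ *m N).
by clearbody a b X Y Z; apply/matrixP => p q; rewrite !mxE; ring.
Qed.

(* If the partial derivatives N c of a matrix field M form a totally closed family
   (Codazzi), the rows of its Newton tensors are divergence free. *)
Lemma newton_mx_divergence M (N : 'I_n.+1 -> 'M[R]_n.+1) j b :
  (forall a b c, N c a b = N a c b) -> \sum_a dnewton_mx M (N a) j b a = 0.
Proof.
move=> cod; elim: j b => [|j IH] b; first by rewrite big1// => a _; rewrite mxE.
transitivity (\sum_a ((dsymf M (N a) j.+1)%:M b a -
    ((N a *m newton_mx M j) b a + (M *m dnewton_mx M (N a) j) b a))).
  by apply: eq_bigr => a _; rewrite dnewton_mxS dnewton_mx_comm !mxE.
rewrite sumrB big_split /=.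
rewrite [X in X - _](_ : _ = dsymf M (N b) j.+1); last first.
  rewrite (bigD1 b)//= mxE eqxx mulr1n big1 ?addr0// => a ab.
  by rewrite mxE eq_sym (negbTE ab) mulr0n.
rewrite [X in _ - (_ + X)](_ : _ = 0); last first.
  under eq_bigr do rewrite mxE.
  by rewrite exchange_big big1//= => c _; rewrite -mulr_sumr IH mulr0.
rewrite addr0 [X in _ - X](_ : _ = \tr (N b *m newton_mx M j)).
  by rewrite dsymf_trace mxtrace_mulC subrr.
apply: eq_bigr => a _; rewrite !mxE; apply: eq_bigr => c _.
by rewrite cod.
Qed.

Lemma newton_mx_ker M (v : 'rV[R]_n.+1) j : M *m v^T = 0 ->
  newton_mx M j *m v^T = symf M j *: v^T.
Proof.
move=> Mv; case: j => [|j]; first by rewrite /= mul1mx scale1r.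
by rewrite newton_mxS mulmxBl mul_scalar_mx -mulmxA Mv mulmx0 subr0.
Qed.

Lemma newton_mx_symf_scale c M i :
  newton_mx (c *: M) i = c ^+ i *: newton_mx M i /\ symf (c *: M) i = c ^+ i * symf M i.
Proof.
elim: i => [|i [IH1 IH2]]; first by rewrite scale1r /= mul1r.
have e : newton_mx (c *: M) i *m (c *: M) = c ^+ i.+1 *: (newton_mx M i *m M).
  by rewrite IH1 -scalemxAl -scalemxAr scalerA exprSr.
have s : symf (c *: M) i.+1 = c ^+ i.+1 * symf M i.+1.
  by rewrite /symf e mxtraceZ mulrA.
by split=> //; rewrite !newton_mxS e s scalerBr scale_scalar_mx.
Qed.

Lemma newton_mx_scale c M i : newton_mx (c *: M) i = c ^+ i *: newton_mx M i.
Proof. by have [] := newton_mx_symf_scale c M i. Qed.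

Lemma symf_scale c M i : symf (c *: M) i = c ^+ i * symf M i.
Proof. by have [] := newton_mx_symf_scale c M i. Qed.

End newton_divergence.

(** * A radial cutoff *)

Section bump.
Context {R : realType}.
Implicit Types t s : R.

Lemma is_derive_exprn t m : is_derive t 1 (fun s : R => s ^+ m) (m%:R * t ^+ m.-1).
Proof.
elim: m => [|m IH]; first by rewrite mul0r; exact: is_derive_cst.
rewrite (_ : (fun s => _) = fun s : R => s * s ^+ m); last by apply/funext => s; rewrite exprS.
apply: is_derive_eqr (is_derive_mulr (is_derive_id t 1) IH) _.
case: m {IH} => [|m] /=; first by rewrite !mul0r mulr0 addr0.
by rewrite !exprS -[in RHS]natr1; ring.
Qed.

Lemma is_derive_posq t : is_derive t 1 (fun s => Num.max 0 s ^+ 2) (2 * Num.max 0 t).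
Proof.
have [t0|t0|->] := ltgtP t 0.
- rewrite mulr0.
  have hn : \forall s \near t, (0 : R) = Num.max 0 s ^+ 2.
    near=> s; rewrite (max_idPl _) ?expr0n//; apply: ltW; near: s; exact: lt_nbhsl.
  exact: is_derive_near hn (is_derive_cstr 0 t 1).
- apply: (is_derive_near (f := fun s => s ^+ 2)).
    near=> s; rewrite (max_idPr _)//; apply: ltW; near: s; exact: lt_nbhsr.
  by apply: is_derive_eqr (is_derive_exprn t 2) _; rewrite expr1.
- rewrite mulr0; apply: is_derive_of_small => e e0.
  exists e => // s se; rewrite add0r [s *: 1]mulr1 (max_idPl (lexx 0)) expr0n subr0 scaler0 subr0.
  rewrite normrX expr2 ler_pM//.
    apply: le_trans (ltW se); case: (leP 0 s) => // _; by rewrite normr0.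
  by case: (leP 0 s) => // _; rewrite normr0.
Unshelve. all: by end_near. Qed.

(** Zero outside [1, 2] and positive inside. The integration by parts uses one continuous
    derivative, so the square of a positive part is smooth enough. *)
Definition bumpq s : R := (s - 1) * (2 - s).
Definition bump s : R := Num.max 0 (bumpq s) ^+ 2.
Definition dbump s : R := 2 * Num.max 0 (bumpq s) * (3 - 2 * s).

Lemma is_derive_bumpq t : is_derive t 1 bumpq (3 - 2 * t).
Proof.
have d1 : is_derive t 1 (fun s => s - 1) (1 - 0) by apply: is_deriveB.
have d2 : is_derive t 1 (fun s => 2 - s) (0 - 1) by apply: is_deriveB.
by apply: is_derive_eqr (is_derive_mulr d1 d2) _; ring.
Qed.

Lemma is_derive_bump t : is_derive t 1 bump (dbump t).
Proof. exact: is_derive_scomp (is_derive_posq _) (is_derive_bumpq t). Qed.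

Lemma continuous_bumpq : continuous bumpq.
Proof.
move=> t; apply/differentiable_continuous/derivable1_diffP.
by case: (is_derive_bumpq t).
Qed.

Lemma continuous_bump : continuous bump.
Proof.
move=> t; apply/differentiable_continuous/derivable1_diffP.
by case: (is_derive_bump t).
Qed.

Lemma continuous_dbump : continuous dbump.
Proof.
move=> t; apply: cvgM; last first.
  by apply: cvgB; [exact: cvg_cst|apply: cvgM; [exact: cvg_cst|exact: cvg_id]].
apply: cvgM; first exact: cvg_cst.
by apply: (@continuous_max _ _ (fun=> 0) bumpq); [exact: cvg_cst|exact: continuous_bumpq].
Qed.

Lemma bumpq_out t : t <= 1 \/ 2 <= t -> Num.max 0 (bumpq t) = 0.
Proof. by move=> h; apply/max_idPl; rewrite /bumpq; case: h => h; nra. Qed.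

Lemma bump_out t : t <= 1 \/ 2 <= t -> bump t = 0.
Proof. by move=> /bumpq_out h; rewrite /bump h expr0n. Qed.

Lemma dbump_out t : t <= 1 \/ 2 <= t -> dbump t = 0.
Proof. by move=> /bumpq_out h; rewrite /dbump h mulr0 mul0r. Qed.

Lemma bump_ge0 t : 0 <= bump t.
Proof. exact: sqr_ge0. Qed.

Lemma line_integrable (f : R -> R) (M : R) : continuous f -> (forall t, M < `|t| -> f t = 0) ->
  (@lebesgue_measure R).-integrable setT (EFin \o f).
Proof.
move=> cf f0.
have iM : (@lebesgue_measure R).-integrable `[- M, M] (EFin \o f).
  by apply: continuous_compact_integrable; [exact: segment_compact|exact: continuous_subspaceT].
have mI : measurable (`[- M, M]%classic : set (measurableTypeR R)) by exact: measurable_itv.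
have := (integrable_mkcond _ mI).1 iM; apply: eq_integrable => // t _.
rewrite patchE; case: ifPn => //; rewrite notin_setE /= in_itv /= => tM.
by rewrite /= f0//; rewrite ltNge; apply/negP; rewrite ler_norml => h; exact: tM.
Qed.

Lemma out_norm t : 2 < `|t| -> t <= 1 \/ 2 <= t.
Proof.
move=> h; have [t0|t0] := leP 0 t; last by left; lra.
by right; rewrite ger0_norm// in h; exact: ltW.
Qed.

Lemma bumpX_integrable m :
  (@lebesgue_measure R).-integrable setT (EFin \o (fun t => bump t * t ^+ m)).
Proof.
apply: (@line_integrable _ 2) => [t|t /out_norm h]; last by rewrite bump_out// mul0r.
by apply: cvgM; [exact: continuous_bump|exact: exprn_continuous].
Qed.

Definition bump_moment (m : nat) : R := Rintegral lebesgue_measure setT (fun t => bump t * t ^+ m).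

Lemma bump_momentE m : (\int[lebesgue_measure]_t (bump t * t ^+ m)%:E = (bump_moment m)%:E)%E.
Proof. by rewrite /bump_moment /Rintegral fineK// integrable_fin_num// bumpX_integrable. Qed.

Lemma bump_moment_gt0 m : 0 < bump_moment m.
Proof.
rewrite -lte_fin -bump_momentE.
(* On this middle half of the support, [bumpq] is at least its endpoint value 1/4 * 3/4 = 3/16 and
   t^m is at least 1. *)
have mI : measurable (`[5 / 4, 7 / 4]%classic : set R) by exact: measurable_itv.
apply: (@lt_le_trans _ _ (\int[lebesgue_measure]_t ((3 / 16) ^+ 2 * \1_`[(5 / 4 : R), 7 / 4] t)%:E)%E).
  under eq_integral do rewrite EFinM.
  rewrite ge0_integralZl_EFin//; last first.
    by apply/measurable_EFinP; exact: measurable_indic.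
  rewrite integral_indic// setIT [X in (_ * X)%E]lebesgue_measure_itv /= lte_fin.
  rewrite ifT; last lra.
  by rewrite -EFinB -EFinM lte_fin mulr_gt0//; lra.
have mb : measurable_fun setT (fun t => (bump t * t ^+ m)%:E).
  by have /integrableP[] := bumpX_integrable m.
apply: ge0_le_integral => //.
  by apply/measurable_EFinP; apply: measurable_funM => //; exact: measurable_indic.
move=> t _; rewrite lee_fin indicE; have [|tI] := boolP (t \in _); last first.
  rewrite mulr0; have [t1|t1] := leP t 1; last by rewrite mulr_ge0 ?bump_ge0// exprn_ge0//; lra.
  by rewrite bump_out ?mul0r//; left.
rewrite inE /= in_itv /= => /andP[t1 t2]; rewrite mulr1.
have q0 : 3 / 16 <= bumpq t by rewrite /bumpq; nra.
have tm : 1 <= t ^+ m by rewrite exprn_ege1//; lra.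
have b0 : (3 / 16) ^+ 2 <= bump t.
  rewrite /bump (max_idPr _) ?lerXn2r ?nnegrE//; lra.
by apply: le_trans b0 _; rewrite ler_peMr// bump_ge0.
Qed.

(* Integration by parts: \int bump' t^{m+1} = - (m+1) \int bump t^m. *)
Lemma bump_integral (a b : R) m :
  (\int[lebesgue_measure]_t (a * (bump t * t ^+ m) + b * (dbump t * t ^+ m.+1))%:E =
   ((a - m.+1%:R * b) * bump_moment m)%:E)%E.
Proof.
pose D t := dbump t * t ^+ m.+1 + bump t * (m.+1%:R * t ^+ m).
have cD : continuous D.
  move=> t; apply: cvgD; apply: cvgM; [exact: continuous_dbump|exact: exprn_continuous|
    exact: continuous_bump|].
  by apply: cvgM; [exact: cvg_cst|exact: exprn_continuous].
have D0 t : 2 < `|t| -> D t = 0.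
  by move=> /out_norm h; rewrite /D bump_out// dbump_out// !mul0r addr0.
have iD0 : (\int[lebesgue_measure]_t (D t)%:E = 0)%E.
  apply: (@integral_derive1_compact R (fun t => bump t * t ^+ m.+1) D 2) => //.
    move=> t; apply: is_derive_mulr; first exact: is_derive_bump.
    exact: (is_derive_exprn t m.+1).
  by move=> t /out_norm h; rewrite bump_out// mul0r.
pose c := a - m.+1%:R * b.
rewrite (_ : (fun t => _) = (fun t => (c * (bump t * t ^+ m))%:E + (b * D t)%:E)%E); last first.
  by apply/funext => t; rewrite -EFinD; congr _%:E; rewrite /c /D -natr1; ring.
rewrite integralD_EFin//; last 2 first.
- by have := integrableZl measurableT c (bumpX_integrable m).
- by have := integrableZl measurableT b (line_integrable cD D0).
under eq_integral do rewrite /= EFinM.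
rewrite (integralZl measurableT (bumpX_integrable m)) bump_momentE.
under [X in (_ + X)%E]eq_integral do rewrite /= EFinM.
by rewrite (integralZl measurableT (line_integrable cD D0)) iD0 mule0 adde0.
Qed.

End bump.

Lemma continuous_Nmax0 {R : realType} (V : topologicalType) (f : V -> R) : continuous f ->
  continuous (fun x => Num.max (- f x) 0).
Proof.
move=> cf x; apply: (@continuous_max _ _ (fun x => - f x) (fun=> 0)); last exact: cvg_cst.
by apply: cvgN; exact: cf.
Qed.

Lemma continuous_max0 {R : realType} (V : topologicalType) (f : V -> R) : continuous f ->
  continuous (fun x => Num.max (f x) 0).
Proof.
by move=> cf x; apply: (@continuous_max _ _ f (fun=> 0)); [exact: cf|exact: cvg_cst].
Qed.

Lemma continuous_ray {R : realType} (V : normedModType R) (f : V -> R) (p : V) :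
  continuous f -> continuous (fun t : R => f (t *: p)).
Proof.
move=> cf t; apply: (@continuous_comp _ _ _ (fun t : R => t *: p) f); last exact: cf.
by apply: cvgZl; exact: cvg_id.
Qed.

Lemma measurable_mul_pospow {R : realType} (n : nat) (f : R -> R) : continuous f ->
  measurable_fun setT (fun t => f t * pospow n t).
Proof.
move=> cf; apply: measurable_funM; last exact: measurable_pospow.
exact: continuous_measurable_fun.
Qed.

Section minkowski.
Context {R : realType} {n : nat}.
Local Notation E := 'rV[R]_n.+1.
Variable Om : set E.
Hypothesis openOm : open Om.
Hypothesis convOm : convex_set Om.
Hypothesis bndOm : bounded_set Om.
Hypothesis Om0 : Om 0.
Hypothesis smOm : smooth_hypersurface (boundary Om).
Variable mu : {measure set (borelType E) -> \bar R}.
Hypothesis area : area_measure (boundary Om) mu.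
Local Notation g := (gauge Om).
Local Notation U := [set x : E | x != 0].
Local Notation Sigma := (boundary Om).
Local Notation nrm := (normal Om).
Local Notation grad := (gauge_grad Om).
Local Notation wein := (weingarten Om).
Local Notation dl := (delta_mx 0).
Let oU : open U := @open_nz R n.

Definition height (x : E) : R := (enorm (grad x))^-1.
Local Notation hgt := height.

Lemma hgt_gt0 x : x != 0 -> 0 < hgt x.
Proof. by move=> x0; rewrite invr_gt0 enorm_grad_gt0. Qed.

Lemma hgt_Ck k : Ck k U hgt.
Proof. exact: inv_grad_Ck. Qed.

Lemma hgt_scale c x : 0 < c -> x != 0 -> hgt (c *: x) = hgt x.
Proof. by move=> c0 x0; rewrite /height gauge_grad_scale. Qed.

Lemma support_fun_hgt p : Sigma p -> support_fun Om p = hgt p.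
Proof. by move=> Sp; rewrite support_funE// support_normal. Qed.

Lemma pos_scale_integrable (F : E -> R) M p : continuous F -> (forall x, ~ box M x -> F x = 0) ->
  0 <= M -> p != 0 ->
  (@lebesgue_measure R).-integrable setT (fun t => (F (t *: p) * pospow n t)%:E).
Proof.
move=> cF F0 M0 p0; have np : 0 < `|p| by rewrite normr_gt0.
have cR : continuous (fun t : R => F (t *: p)) by exact: continuous_ray.
have i1 : (@lebesgue_measure R).-integrable setT (EFin \o (fun t => F (t *: p) * t ^+ n)).
  apply: (@line_integrable _ _ (M / `|p|)) => [t|t].
    by apply: cvgM; [exact: cR|exact: exprn_continuous].
  rewrite ltr_pdivrMr// => h; rewrite F0 ?mul0r//.
  by rewrite boxE//= normrZ; apply/negP; rewrite -ltNge.
apply: (le_integrable measurableT _ _ i1).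
  by apply/measurable_EFinP; exact: measurable_mul_pospow.
move=> t _ /=; rewrite lee_fin !normrM ler_wpM2l// /pospow.
by case: (0 < t); rewrite ?normr1 ?normr0 ?mul1r ?mul0r.
Qed.

Lemma measurable_hgt : measurable_fun setT (hgt : borelType E -> R).
Proof. exact: measurable_inv_grad. Qed.

Lemma polar_ge0 (F : E -> R) M : continuous F -> (forall x, ~ box M x -> F x = 0) ->
  0 <= M -> (forall x, 0 <= F x) ->
  mu.-integrable Sigma (fun p => (hgt p * fine (ray_integral n (EFin \o F) p))%:E) /\
  (\int[mu]_(p in Sigma) (hgt p * fine (ray_integral n (EFin \o F) p))%:E =
   \int[@leb R n.+1]_x (F x)%:E)%E.
Proof.
move=> cF F0 M0 Fge.
have mF : measurable_fun setT (EFin \o F : borelType E -> \bar R).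
  by apply/measurable_EFinP; exact: continuous_rV_measurable.
have Fge' x : (0 <= (EFin \o F) x)%E by rewrite lee_fin.
have mS := measurable_boundary Om.
have rE p : Sigma p -> (ray_integral n (EFin \o F) p) =
    (fine (ray_integral n (EFin \o F) p))%:E.
  move=> Sp; rewrite fineK//.
  have p0 := boundary_neq0 openOm convOm Om0 Sp.
  exact: integrable_fin_num (pos_scale_integrable cF F0 M0 p0).
have pE := polar_formula openOm convOm bndOm Om0 smOm area mF Fge'.
have E1 : (\int[mu]_(p in Sigma) (hgt p * fine (ray_integral n (EFin \o F) p))%:E =
   \int[@leb R n.+1]_x (F x)%:E)%E.
  rewrite pE; apply: eq_integral => p /set_mem Sp.
  by rewrite EFinM -(rE _ Sp).
split=> //; apply/integrableP; split.
  apply/measurable_EFinP; apply: measurable_funM.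
    by apply: measurable_funTS; exact: measurable_hgt.
  by apply/measurable_funTS; apply: measurableT_comp => //; exact: measurable_ray_integral.
rewrite (eq_integral (fun p : borelType E => (hgt p * fine (ray_integral n (EFin \o F) p))%:E)).
  rewrite E1; have := integrable_lty measurableT (compact_support_integrable M0 cF F0).
  by [].
move=> p /set_mem Sp; rewrite gee0_abs// lee_fin mulr_ge0// ?fine_ge0 ?ray_integral_ge0//.
by apply/ltW/hgt_gt0; exact: boundary_neq0 Sp.
Qed.

(** The polar formula concerns nonnegative functions, so it is applied to positive and negative
    parts separately; the prescribed ray integral [K] only has to be known for their difference. *)
Lemma polar_signed (F K : E -> R) M : continuous F -> (forall x, ~ box M x -> F x = 0) ->
  0 <= M -> (forall p, Sigma p ->
    (\int[lebesgue_measure]_t (F (t *: p) * pospow n t)%:E = (K p)%:E)%E) ->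
  (\int[mu]_(p in Sigma) (hgt p * K p)%:E = \int[@leb R n.+1]_x (F x)%:E)%E.
Proof.
move=> cF F0 M0 KE; have mS := measurable_boundary Om.
pose Fp x := Num.max (F x) 0; pose Fm x := Num.max (- F x) 0.
have cFp : continuous Fp by exact: continuous_max0.
have cFm : continuous Fm by exact: continuous_Nmax0.
have Fp0 x : ~ box M x -> Fp x = 0 by move=> /F0; rewrite /Fp => ->; rewrite maxxx.
have Fm0 x : ~ box M x -> Fm x = 0 by move=> /F0; rewrite /Fm => ->; rewrite oppr0 maxxx.
have Fpge x : 0 <= Fp x by rewrite le_max lexx orbT.
have Fmge x : 0 <= Fm x by rewrite le_max lexx orbT.
have FE x : F x = Fp x - Fm x.
  rewrite /Fp /Fm; case: (leP (F x) 0) => h.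
    by rewrite (max_idPl _) ?oppr_ge0// sub0r opprK.
  by rewrite (max_idPr _) ?subr0// oppr_le0 ltW.
have [ip pE] := polar_ge0 cFp Fp0 M0 Fpge.
have [im mE] := polar_ge0 cFm Fm0 M0 Fmge.
rewrite (_ : (fun x => (F x)%:E) = fun x => ((Fp x)%:E - (Fm x)%:E)%E); last first.
  by apply/funext => x; rewrite FE EFinB.
rewrite (integralB_EFin measurableT (compact_support_integrable M0 cFp Fp0)
  (compact_support_integrable M0 cFm Fm0)).
rewrite -pE -mE -(integralB_EFin mS ip im); apply: eq_integral => p /set_mem Sp.
have p0 := boundary_neq0 openOm convOm Om0 Sp.
rewrite -EFinB -mulrBr; congr (_ * _)%:E; apply: EFin_inj.
have jp := pos_scale_integrable cFp Fp0 M0 p0.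
have jm := pos_scale_integrable cFm Fm0 M0 p0.
rewrite EFinB -KE// !fineK; [|exact: integrable_fin_num jm|exact: integrable_fin_num jp].
rewrite -(integralB_EFin measurableT jp jm); apply: eq_integral => t _.
by rewrite -EFinB FE mulrBl.
Qed.

(** The ray integrals of bump(g) are constant, so the polar formula makes the integral of [height]
    finite; and [height] is bounded below by a positive number on the compact boundary. *)
Lemma measure_boundary_fin : (mu Sigma < +oo)%E.
Proof.
have [M0 M00 HM] := norm_le_gauge openOm convOm bndOm Om0.
have M2 : 0 <= 2 * M0 by rewrite mulr_ge0// ltW.
pose F (x : E) := bump (g x).
have cF : continuous F.
  move=> x; apply: (@continuous_comp _ _ _ g bump); last exact: continuous_bump.
  exact: gauge_continuous.
have F0 x : ~ box (2 * M0) x -> F x = 0.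
  rewrite boxE//= => h; apply: bump_out; right; rewrite leNgt; apply/negP => gx; apply: h.
  by apply: le_trans (HM x) _; rewrite mulrC ler_wpM2r ?ltW.
have [i1 _] := polar_ge0 cF F0 M2 (fun x => bump_ge0 (g x)).
have mS := measurable_boundary Om.
have rE p : Sigma p -> ray_integral n (EFin \o F) p = (bump_moment n)%:E.
  move=> Sp; rewrite -bump_momentE; apply: eq_integral => t _; rewrite /= /F /pospow -EFinM.
  congr _%:E; have [t0|t0] := ltP 0 t.
    by rewrite gaugeZ// (gauge_boundary openOm convOm Om0 Sp) mulr1 mul1r.
  by rewrite mul0r mulr0 bump_out ?mul0r//; left; apply: le_trans t0 _.
have cmpS : compact Sigma := compact_boundary bndOm.
have [S0|/set0P Sn] := eqVneq Sigma set0; first by rewrite S0 measure0 ltry.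
have ch : {within Sigma, continuous hgt}.
  apply: continuous_in_subspaceT => p /set_mem Sp.
  by apply: Ck_continuous (hgt_Ck 0) _; exact: boundary_neq0 Sp.
have [p1 /set_mem Sp1 hmin] := EVT_min_rV Sn cmpS ch.
have h1 : 0 < hgt p1 by apply: hgt_gt0; exact: boundary_neq0 Sp1.
pose c := hgt p1 * bump_moment n.
have c0 : 0 < c by rewrite mulr_gt0// bump_moment_gt0.
have : (c%:E * mu Sigma < +oo)%E.
  rewrite -integral_cst//; apply: le_lt_trans (integrable_lty mS i1).
  apply: ge0_le_integral => //.
  - by move=> p _; rewrite lee_fin ltW.
  - by have /integrableP[] := i1.
  move=> p Sp; rewrite lee_fin (rE _ Sp) [fine _]/=; apply: ler_wpM2r.
    exact/ltW/bump_moment_gt0.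
  by apply: hmin; exact: mem_set.
move=> h; rewrite ltey; apply: contraTneq h => ->.
by rewrite gt0_muley ?ltxx// lte_fin.
Qed.

Lemma boundary_integrable (f : E -> R) : (forall x, x != 0 -> {for x, continuous f}) ->
  mu.-integrable Sigma (EFin \o f).
Proof.
move=> cf; have mS := measurable_boundary Om.
apply: measurable_bounded_integrable => //.
- exact: measure_boundary_fin.
- by apply: measurable_funTS; exact: (continuous_nz_measurable cf).
have cmpS : compact Sigma := compact_boundary bndOm.
have [S0|/set0P Sn] := eqVneq Sigma set0.
  by exists 0; split => // x _ y; rewrite S0.
have ch : {within Sigma, continuous (fun p => `|f p|)}.
  apply: continuous_in_subspaceT => p /set_mem Sp.
  apply: continuous_comp; last exact: norm_continuous.
  by apply: cf; exact: boundary_neq0 Sp.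
have [p1 _ hmax] := EVT_max_rV Sn cmpS ch.
exists `|f p1|; split; first by rewrite num_real.
by move=> x px p Sp; apply: le_trans (hmax _ (mem_set Sp)) (ltW px).
Qed.

End minkowski.

Lemma for_continuousD {R : realType} (V : topologicalType) (f h : V -> R) x :
  {for x, continuous f} -> {for x, continuous h} -> {for x, continuous (fun y => f y + h y)}.
Proof. by move=> cf ch; apply: cvgD. Qed.

Lemma for_continuousM {R : realType} (V : topologicalType) (f h : V -> R) x :
  {for x, continuous f} -> {for x, continuous h} -> {for x, continuous (fun y => f y * h y)}.
Proof. by move=> cf ch; apply: cvgM. Qed.

Lemma for_continuous_comp {R : realType} (V : topologicalType) (f : V -> R) (phi : R -> R) x :
  {for x, continuous f} -> {for f x, continuous phi} -> {for x, continuous (fun y => phi (f y))}.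
Proof. by move=> cf ch; apply: continuous_comp. Qed.

Lemma for_continuous_near {R : realType} (V : topologicalType) (f : V -> R) x (c : R) :
  (\forall y \near x, f y = c) -> {for x, continuous f}.
Proof.
move=> fc; have fx : f x = c by exact: nbhs_singleton fc.
rewrite /prop_for /continuous_at fx; apply: cvg_near_cst.
by apply: filterS fc => y ->.
Qed.

Lemma for_continuous_sum {R : realType} (V : topologicalType) (I : Type) (r : seq I)
    (f : I -> V -> R) x : (forall i, {for x, continuous (f i)}) ->
  {for x, continuous (fun y => \sum_(i <- r) f i y)}.
Proof. by move=> cf; apply: cvg_sumr => i; exact: cf. Qed.

(** * Divergence of the Newton flux *)

Section weighted_minkowski.
Context {R : realType} {n : nat}.
Local Notation E := 'rV[R]_n.+1.
Variable Om : set E.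
Hypothesis openOm : open Om.
Hypothesis convOm : convex_set Om.
Hypothesis bndOm : bounded_set Om.
Hypothesis Om0 : Om 0.
Hypothesis smOm : smooth_hypersurface (boundary Om).
Variable mu : {measure set (borelType E) -> \bar R}.
Hypothesis area : area_measure (boundary Om) mu.
Local Notation g := (gauge Om).
Local Notation U := [set x : E | x != 0].
Local Notation Sigma := (boundary Om).
Local Notation nrm := (normal Om).
Local Notation grad := (gauge_grad Om).
Local Notation wein := (weingarten Om).
Local Notation hgt := (height Om).
Local Notation dl := (delta_mx 0).
Let oU : open U := @open_nz R n.

(** The cone formula for volume: each ray meets [Om] exactly for t < 1 and contributes 1 / (n+1). It
    makes I_{-1} an integral of the support function, like the other Minkowski integrals. *)
Lemma volume_formula : n.+1%:R * volume Om = Rintegral mu Sigma hgt.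
Proof.
have mO : measurable (Om : set (borelType E)) by exact: measurable_open.
have mF : measurable_fun setT (fun x : borelType E => (\1_(Om : set (borelType E)) x)%:E : \bar R).
  by apply/measurable_EFinP; exact: measurable_indic.
have F0 x : (0 <= (\1_(Om : set (borelType E)) x)%:E :> \bar R)%E by rewrite lee_fin.
have rE p : Sigma p -> ray_integral n (fun x => (\1_Om x)%:E) p = (n.+1%:R^-1)%:E.
  move=> Sp; have gp := gauge_boundary openOm convOm Om0 Sp.
  have n0 : (n.+1%:R : R) != 0 by rewrite pnatr_eq0.
  have dF (t : R) : is_derive t 1 (fun t : R => n.+1%:R^-1 * t ^+ n.+1) (t ^+ n).
    by apply: is_derive_eqr (is_derive_mull _ (is_derive_exprn t n.+1)) _; rewrite mulKf.
  have cF : continuous (fun t : R => n.+1%:R^-1 * t ^+ n.+1).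
    by move=> t; apply/differentiable_continuous/derivable1_diffP; case: (dF t).
  have := @continuous_FTC2 R (fun t => t ^+ n) (fun t => n.+1%:R^-1 * t ^+ n.+1) 0 1 ltr01.
  rewrite expr1n mulr1 expr0n mulr0 sube0 => <-; last 3 first.
  - by apply: continuous_subspaceT; exact: exprn_continuous.
  - split.
    + by move=> t _; case: (dF t).
    + by apply: cvg_at_right_filter; exact: cF.
    + by apply: cvg_at_left_filter; exact: cF.
  - by move=> t _; rewrite derive1E; case: (dF t).
  rewrite integral_itv_bndoo; last first.
    by apply: measurable_funTS; apply/measurable_EFinP; exact: exprn_measurable.
  rewrite [RHS]integral_mkcond; apply: eq_integral => t _.
  rewrite patchE -EFinM /pospow indicE; case: ifPn => [|]; rewrite ?notin_setE ?inE /= in_itv /=.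
    move=> /andP[t0 t1]; rewrite t0 mem_set ?mul1r//.
    by apply/(gauge_lt1 openOm convOm Om0); rewrite gaugeZ// gp mulr1.
  move=> /negP; rewrite negb_and -!leNgt; have [t0|//] := ltP 0 t; last by rewrite mul0r mulr0.
  move=> /= t1; rewrite memNset ?mul0r// => /(gauge_lt1 openOm convOm Om0).
  by rewrite gaugeZ// gp mulr1 ltNge t1.
rewrite /volume /Rintegral (lebesgue_intE mF F0).
rewrite (polar_formula openOm convOm bndOm Om0 smOm area mF F0).
rewrite [X in _ * fine X = _](_ : _ = \int[mu]_(p in Sigma) ((n.+1%:R^-1)%:E * (hgt p)%:E))%E; last first.
  by apply: eq_integral => p /set_mem Sp; rewrite muleC rE.
have ih : mu.-integrable Sigma (EFin \o hgt).
  apply: boundary_integrable => // x x0.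
  by apply: Ck_continuous x0; exact: (hgt_Ck openOm convOm bndOm Om0 smOm 0).
have mS := measurable_boundary Om.
rewrite (integralZl mS ih) fineM//; last exact: integrable_fin_num ih.
by rewrite /= mulrA divff ?mul1r// pnatr_eq0.
Qed.

Section flux.
Variable j : nat.

Definition flux (x : E) : E := nrm x *m newton_mx (wein x) j.

Let dwein (x w : E) : 'M[R]_n.+1 := \matrix_(a, b) 'D_w (fun y => wein y a b) x.

Lemma is_derive_wein x w : x != 0 ->
  forall a b, is_derive x w (fun y => wein y a b) (dwein x w a b).
Proof.
move=> x0 a b; rewrite mxE.
exact: Ck_is_derive (weingarten_Ck openOm convOm bndOm Om0 smOm 1 a b) x0.
Qed.

Lemma is_derive_flux x w a : x != 0 -> is_derive x w (fun y => flux y 0 a)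
  ((w *m wein x *m newton_mx (wein x) j) 0 a +
   (nrm x *m dnewton_mx (wein x) (dwein x w) j) 0 a).
Proof.
move=> x0; have [dT _] := is_derive_newton_mx (is_derive_wein w x0) j.
have dN (i : 'I_1) b : is_derive x w (fun y => nrm y i b) ((w *m wein x) i b).
  rewrite ord1.
  exact: (is_derive_rVP _ _ _ _).1 (is_derive_normal openOm convOm bndOm Om0 smOm w x0) b.
by have := is_derive_mulmx dN dT 0 a; rewrite mxE.
Qed.

Lemma flux_Ck k a : Ck k U (fun x => flux x 0 a).
Proof.
rewrite (_ : (fun x => _) = fun x => \sum_b nrm x 0 b * newton_mx (wein x) j b a).
  apply: Ck_sum => // b; apply: CkM => //; first exact: normal_Ck.
  have [+ _] := Ck_newton_mx j oU (fun a b => weingarten_Ck openOm convOm bndOm Om0 smOm k a b).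
  by apply.
by apply/funext => x; rewrite mxE.
Qed.

(** Derivatives falling on the normal give tr(W T_j) = (j+1) sigma_(j+1); those falling on T_j
    cancel by [newton_mx_divergence], whose closedness condition is [weingarten_comm]. *)
Lemma flux_divergence x : x != 0 ->
  \sum_a 'D_(dl a) (fun y => flux y 0 a) x = j.+1%:R * symf (wein x) j.+1.
Proof.
move=> x0; transitivity (\sum_a ((wein x *m newton_mx (wein x) j) a a +
    \sum_b nrm x 0 b * dnewton_mx (wein x) (dwein x (dl a)) j b a)).
  apply: eq_bigr => a _; have [_ ->] := is_derive_flux (dl a) a x0.
  by rewrite -mulmxA -rowE [row a _ 0 a]mxE [(nrm x *m _) 0 a]mxE.
rewrite big_split /= [X in _ + X](_ : _ = 0) ?addr0.
  by rewrite -trace_newton_mx newton_mx_comm.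
rewrite exchange_big big1//= => b _; rewrite -mulr_sumr newton_mx_divergence ?mulr0//.
have dE w a' b' : dwein x w a' b' = 'D_w (fun y => wein y a' b') x by rewrite mxE.
move=> a' b' c; apply: etrans (dE _ _ _) _; apply: etrans (esym (dE _ _ _)).
exact: (weingarten_comm openOm convOm bndOm Om0 smOm).
Qed.

Lemma dotv_normal x : x != 0 -> dotv x (nrm x) = g x * hgt x.
Proof. by move=> x0; rewrite dotvZr dotvC gauge_grad_self// mulrC. Qed.

(** Differentiate <y, nu> = g times [height]; the terms <w, nu> and [height] <grad g, w> are equal
    and cancel. *)
Lemma derive_hgt x w : x != 0 -> g x * 'D_w hgt x = dotv (w *m wein x) x.
Proof.
move=> x0.
have dL : is_derive x w (fun y => dotv y (nrm y))
    (\sum_i (w 0 i * nrm x 0 i + x 0 i * (w *m wein x) 0 i)).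
  apply: is_derive_sumr => i; apply: is_derive_mulr; first exact: is_derive_coord.
  exact: (is_derive_rVP _ _ _ _).1 (is_derive_normal openOm convOm bndOm Om0 smOm w x0) i.
have dR := is_derive_mulr (gauge_is_derive_grad openOm convOm bndOm Om0 smOm w x0)
  (Ck_is_derive w (hgt_Ck openOm convOm bndOm Om0 smOm 1) x0).
have hn : \forall y \near x, g y * hgt y = dotv y (nrm y).
  by apply: (near_open oU x0) => y y0; rewrite dotv_normal.
have [_ e1] := is_derive_near hn dR; have [_ e2] := dL.
move: e1; rewrite e2 big_split /= -/(dotv w (nrm x)) -/(dotv x (w *m wein x)).
rewrite [dotv (grad x) w]dotvC {1}[nrm x]/normal dotvZr mulrC => h.
by rewrite dotvC; move: h => /addrI.
Qed.

(** The normal is in the right kernel of W, so T_j acts on it as sigma_j. *)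
Lemma flux_grad x : x != 0 -> hgt x * dotv (flux x) (grad x) = symf (wein x) j.
Proof.
move=> x0; rewrite -dotvZr -/(nrm x) dotvE -mulmxA newton_mx_ker ?weingarten_normal//.
by rewrite -scalemxAr mxE -dotvE normal_unit// mulr1.
Qed.

(** Up to the factor -[height], this is the quadratic form of the theorem at X^T
    ([newton_shape_flux]). *)
Definition flux_pos (x : E) : R := dotv (flux x *m wein x) x.

(* Divergence theorem for the compactly supported field bump(g) psi(hgt) flux. *)
Variables psi dpsi : R -> R.
Hypothesis dpsiP : forall t : R, 0 < t -> is_derive t 1 psi (dpsi t).
Hypothesis cdpsi : forall t : R, 0 < t -> {for t, continuous dpsi}.

Let cpsi t : 0 < t -> {for t, continuous psi}.
Proof.
move=> t0; apply/differentiable_continuous/derivable1_diffP.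
by case: (dpsiP t0).
Qed.

Let W a (x : E) : R := bump (g x) * (psi (hgt x) * flux x 0 a).
Let G a (x : E) : R :=
  (dbump (g x) * dotv (grad x) (dl a)) * (psi (hgt x) * flux x 0 a) +
  bump (g x) * ((dpsi (hgt x) * 'D_(dl a) hgt x) * flux x 0 a +
    psi (hgt x) * 'D_(dl a) (fun y => flux y 0 a) x).

Let near0 : \forall y \near (0 : E), g y < 1.
Proof.
have : open (g @^-1` [set t : R | t < 1]).
  by apply: open_comp => [y _|]; [exact: gauge_continuous|exact: open_lt].
by move=> /near_open; apply=> //=; rewrite gauge0.
Qed.

Let G0 a y : g y < 1 -> G a y = 0.
Proof.
by move=> gy; rewrite /G bump_out ?dbump_out ?mul0r ?addr0//; left; exact: ltW.
Qed.

(** Off the origin this is the product rule; near the origin g < 1, so the cutoff vanishes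
    identically and hides the singularity of the normal. *)
Let W_derive a x : is_derive x (dl a) (W a) (G a x).
Proof.
have [->|x0] := eqVneq x 0.
  rewrite G0 ?gauge0//.
  have hn : \forall y \near (0 : E), (0 : R) = W a y.
    apply: filterS near0 => y gy; rewrite /W bump_out ?mul0r//; left; exact: ltW.
  exact: is_derive_near hn (@is_derive_cstr R _ 0 0 (dl a)).
have dh := Ck_is_derive (dl a) (hgt_Ck openOm convOm bndOm Om0 smOm 1) x0.
have dg := gauge_is_derive_grad openOm convOm bndOm Om0 smOm (dl a) x0.
have df := Ck_is_derive (dl a) (flux_Ck 1 a) x0.
apply: is_derive_mulr; first exact: is_derive_scomp (is_derive_bump _) dg.
apply: is_derive_mulr df; apply: is_derive_scomp dh.
by apply: dpsiP; exact: hgt_gt0.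
Qed.

Let G_continuous a : continuous (G a).
Proof.
move=> x; have [->|x0] := eqVneq x 0.
  by apply: (@for_continuous_near R E _ _ 0); apply: filterS near0 => y; exact: G0.
have h0 : 0 < hgt x by exact: hgt_gt0.
have cg : {for x, continuous g} by exact: gauge_continuous.
have ch : {for x, continuous hgt} := Ck_continuous (hgt_Ck openOm convOm bndOm Om0 smOm 0) x0.
have cf : {for x, continuous (fun y => flux y 0 a)} := Ck_continuous (flux_Ck 0 a) x0.
have cpf : {for x, continuous (fun y => psi (hgt y) * flux y 0 a)}.
  apply: (@for_continuousM R E) => //; apply: (@for_continuous_comp R E) => //; exact: cpsi.
apply: (@for_continuousD R E).
  apply: (@for_continuousM R E) => //; apply: (@for_continuousM R E).
    by apply: (@for_continuous_comp R E) => //; exact: continuous_dbump.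
  rewrite (_ : (fun y => _) = fun y => grad y 0 a); last by apply/funext => y; rewrite dotv_delta.
  exact: Ck_continuous (grad_Ck openOm convOm bndOm Om0 smOm 0 a) x0.
apply: (@for_continuousM R E).
  by apply: (@for_continuous_comp R E) => //; exact: continuous_bump.
apply: (@for_continuousD R E).
  apply: (@for_continuousM R E) => //; apply: (@for_continuousM R E).
    by apply: (@for_continuous_comp R E) => //; exact: cdpsi.
  exact: Ck_continuous (Ck_derive _ (hgt_Ck openOm convOm bndOm Om0 smOm 1)) x0.
apply: (@for_continuousM R E).
  by apply: (@for_continuous_comp R E) => //; exact: cpsi.
exact: Ck_continuous (Ck_derive _ (flux_Ck 1 a)) x0.
Qed.

Let F x := \sum_a G a x.

Let F_integral : exists2 M : R, 0 <= M & (forall x, ~ box M x -> F x = 0) /\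
  (\int[@leb R n.+1]_x (F x)%:E = 0)%E.
Proof.
have [M0 M00 HM] := norm_le_gauge openOm convOm bndOm Om0.
have M2 : 0 <= 2 * M0 by rewrite mulr_ge0// ltW.
have out x : ~ box (2 * M0) x -> g x <= 1 \/ 2 <= g x.
  rewrite boxE//= => h; right; rewrite leNgt; apply/negP => gx; apply: h.
  by apply: le_trans (HM x) _; rewrite mulrC ler_wpM2r ?ltW.
have Wout a x : ~ box (2 * M0) x -> W a x = 0.
  by move=> /out h; rewrite /W bump_out// mul0r.
have Gout a x : ~ box (2 * M0) x -> G a x = 0.
  by move=> /out h; rewrite /G bump_out// dbump_out// !mul0r addr0.
exists (2 * M0) => //; split=> [x bx|]; first by rewrite /F big1// => a _; exact: Gout.
rewrite (_ : (fun x => _) = fun x => (\sum_a (G a x)%:E)%E); last first.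
  by apply/funext => x; rewrite sumEFin.
rewrite integral_sum//; last first.
  by move=> a; exact: compact_support_integrable M2 (@G_continuous a) (Gout a).
by rewrite big1// => a _; exact: leb_derive0 M2 (W_derive a) (@G_continuous a) (Wout a) (Gout a).
Qed.

Let F_continuous : continuous F.
Proof.
by move=> x; apply: (@for_continuous_sum R E) => a; exact: G_continuous.
Qed.

Lemma hgt_derive_flux x : x != 0 ->
  g x * \sum_a 'D_(dl a) hgt x * flux x 0 a = flux_pos x.
Proof.
move=> x0; rewrite mulr_sumr /flux_pos.
transitivity (\sum_a flux x 0 a * dotv (dl a *m wein x) x).
  by apply: eq_bigr => a _; rewrite mulrA derive_hgt// mulrC.
transitivity (dotv (\sum_a flux x 0 a *: (dl a *m wein x)) x).
  rewrite dotvC [RHS]linear_sum; apply: eq_bigr => a _ /=.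
  by rewrite dotvZr dotvC.
congr (dotv _ x); rewrite {2}[flux x]row_sum_delta mulmx_suml.
by apply: eq_bigr => a _; rewrite scalemxAl.
Qed.

Let F_E x : x != 0 -> F x =
  dbump (g x) * (psi (hgt x) * symf (wein x) j / hgt x) +
  bump (g x) * (dpsi (hgt x) * flux_pos x / g x + psi (hgt x) * (j.+1%:R * symf (wein x) j.+1)).
Proof.
move=> x0; have h0 : hgt x != 0 by rewrite gt_eqF// hgt_gt0.
have g0 : g x != 0 by rewrite gt_eqF// gauge_gt0.
rewrite /F big_split /=; congr (_ + _).
  rewrite -(flux_grad x0) (_ : psi (hgt x) * (hgt x * dotv (flux x) (grad x)) / hgt x =
    psi (hgt x) * dotv (flux x) (grad x)); last by field.
  rewrite [dotv (flux x) _]/dotv !mulr_sumr; apply: eq_bigr => a _.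
  by rewrite dotv_delta; ring.
rewrite -mulr_sumr big_split /=; congr (_ * (_ + _)); last first.
  by rewrite -mulr_sumr flux_divergence.
rewrite -hgt_derive_flux//; under eq_bigr do rewrite -mulrA.
by rewrite -mulr_sumr; field.
Qed.

Lemma flux_pos_scale c x : 0 < c -> x != 0 -> flux_pos (c *: x) = c^-1 ^+ j * flux_pos x.
Proof.
move=> c0 x0; have fE : flux (c *: x) = c^-1 ^+ j *: flux x.
  by rewrite /flux normal_scale// weingarten_scale// newton_mx_scale -scalemxAr.
rewrite /flux_pos fE weingarten_scale// -scalemxAl -scalemxAr !dotvZl dotvZr.
have c00 : c != 0 by rewrite gt_eqF.
by set z := c^-1 ^+ j; field.
Qed.

Hypothesis jn : (j < n)%N.

(** Result of integrating along a ray. The two parts of the divergence have degrees -j and -(j+1),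
    so with the density t^n they leave bump' t^(n-j) and bump t^(n-j-1); integration by parts turns
    the first into -(n-j) times the same moment. The assumption j < n keeps the exponents true
    differences. *)
Let K (p : E) : R := ((dpsi (hgt p) * flux_pos p + psi (hgt p) * (j.+1%:R * symf (wein p) j.+1))
  - (n - j)%:R * (psi (hgt p) * symf (wein p) j / hgt p)) * bump_moment (n - j.+1).

Let F_ray p : Sigma p ->
  (\int[lebesgue_measure]_t (F (t *: p) * pospow n t)%:E = (K p)%:E)%E.
Proof.
move=> Sp; have p0 := boundary_neq0 openOm convOm Om0 Sp.
have gp := gauge_boundary openOm convOm Om0 Sp.
have nj : (n - j = (n - j.+1).+1)%N by rewrite subnSK.
rewrite /K nj -bump_integral; apply: eq_integral => t _; congr _%:E.
rewrite /pospow; have [t0|t0] := ltP 0 t; last first.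
  by rewrite mul0r mulr0 bump_out ?dbump_out; [ring|left; exact: le_trans t0 _..].
have t00 : t != 0 by rewrite gt_eqF.
rewrite mul1r F_E ?scale_neq0// gaugeZ// gp mulr1 hgt_scale// flux_pos_scale//.
rewrite weingarten_scale// !symf_scale.
have -> : t ^+ n = t ^+ (n - j.+1) * t ^+ j.+1 by rewrite -exprD subnK.
rewrite !exprVn !exprS; have h0 : hgt p != 0 by rewrite gt_eqF// hgt_gt0.
have tj : t ^+ j != 0 by rewrite expf_neq0.
by field; rewrite tj h0 t00.
Qed.

Lemma flux_pos_Ck k : Ck k U flux_pos.
Proof.
rewrite (_ : flux_pos = fun x => \sum_b (\sum_a flux x 0 a * wein x a b) * x 0 b).
  apply: Ck_sum => // b; apply: CkM => //; last exact: Ck_coord.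
  by apply: Ck_sum => // a; apply: CkM => //; [exact: flux_Ck|exact: weingarten_Ck].
by apply/funext => x; apply: eq_bigr => b _; rewrite mxE.
Qed.

Lemma symf_continuous i x : x != 0 -> {for x, continuous (fun y => symf (wein y) i)}.
Proof.
move=> x0; have [_ cs] := Ck_newton_mx i oU
  (fun a b => weingarten_Ck openOm convOm bndOm Om0 smOm 0 a b).
exact: Ck_continuous cs x0.
Qed.

(** The divergence has total integral 0. In polar coordinates its ray integrals all carry the same
    positive moment of the cutoff, which is divided out. *)
Theorem weighted_minkowski :
  j.+1%:R * Rintegral mu Sigma (fun p => psi (hgt p) * (hgt p * symf (wein p) j.+1))
  - (n - j)%:R * Rintegral mu Sigma (fun p => psi (hgt p) * symf (wein p) j)
  = Rintegral mu Sigma (fun p => dpsi (hgt p) * - (hgt p * flux_pos p)).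
Proof.
have mS := measurable_boundary Om.
have [M M0 [Fout iF]] := F_integral.
have := polar_signed openOm convOm bndOm Om0 smOm area F_continuous Fout M0 F_ray.
rewrite iF => iK.
have ch x : x != 0 -> {for x, continuous hgt}.
  by move=> x0; exact: Ck_continuous (hgt_Ck openOm convOm bndOm Om0 smOm 0) x0.
have cph x : x != 0 -> {for x, continuous (fun y => psi (hgt y))}.
  move=> x0; apply: (@for_continuous_comp R E); first exact: ch.
  by apply: cpsi; exact: hgt_gt0.
have cdh x : x != 0 -> {for x, continuous (fun y => dpsi (hgt y))}.
  move=> x0; apply: (@for_continuous_comp R E); first exact: ch.
  by apply: cdpsi; exact: hgt_gt0.
pose f1 p := psi (hgt p) * (hgt p * symf (wein p) j.+1).
pose f2 p := psi (hgt p) * symf (wein p) j.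
pose f3 p := dpsi (hgt p) * - (hgt p * flux_pos p).
have bi := boundary_integrable openOm convOm bndOm Om0 smOm area.
have i1 : mu.-integrable Sigma (EFin \o f1).
  apply: bi => x x0; apply: (@for_continuousM R E); first exact: cph.
  by apply: (@for_continuousM R E); [exact: ch|exact: symf_continuous].
have i2 : mu.-integrable Sigma (EFin \o f2).
  by apply: bi => x x0; apply: (@for_continuousM R E); [exact: cph|exact: symf_continuous].
have i3 : mu.-integrable Sigma (EFin \o f3).
  apply: bi => x x0; apply: (@for_continuousM R E); first exact: cdh.
  rewrite (_ : (fun y => _) = fun y => (- hgt y) * flux_pos y); last first.
    by apply/funext => y; rewrite mulNr.
  apply: (@for_continuousM R E); last exact: Ck_continuous (flux_pos_Ck 0) x0.
  by apply: (@for_continuous_comp R E _ -%R); [exact: ch|exact: opp_continuous].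
have Rc0 : Rintegral mu Sigma (fun p => hgt p * K p) = 0 by rewrite /Rintegral iK.
have cm := bump_moment_gt0 (R := R) (n - j.+1).
have : bump_moment (n - j.+1) * (j.+1%:R * Rintegral mu Sigma f1
    - (n - j)%:R * Rintegral mu Sigma f2 - Rintegral mu Sigma f3) = 0.
  have i1' : mu.-integrable Sigma (EFin \o (fun p => j.+1%:R * f1 p)).
    by have := integrableZl mS j.+1%:R i1.
  have i2' : mu.-integrable Sigma (EFin \o (fun p => (n - j)%:R * f2 p)).
    by have := integrableZl mS (n - j)%:R i2.
  have i12 : mu.-integrable Sigma (EFin \o (fun p => j.+1%:R * f1 p - (n - j)%:R * f2 p)).
    by have := integrableB mS i1' i2'.
  rewrite -(RintegralZl _ mS i1) -(RintegralZl _ mS i2) -(RintegralB mS i1' i2').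
  rewrite -(RintegralB mS i12 i3) -RintegralZl//; last by have := integrableB mS i12 i3.
  rewrite -[RHS]Rc0; apply: eq_Rintegral => p /set_mem Sp.
  have h0 : hgt p != 0 by rewrite gt_eqF// hgt_gt0//; exact: boundary_neq0 Sp.
  by rewrite /f1 /f2 /f3 /K; field.
move/eqP; rewrite mulf_eq0 gt_eqF//= subr_eq0 => /eqP.
by [].
Qed.

End flux.

(** The position vector is annihilated by W, so X^T W = -[height] nu W; the normal part of the
    second argument pairs to 0 because W kills the normal on the right. *)
Lemma newton_shape_flux j p : Sigma p ->
  newton_shape_form Om j p (tangential Om p) = - (hgt p * flux_pos j p).
Proof.
move=> Sp; have p0 := boundary_neq0 openOm convOm Om0 Sp.
have gp := gauge_boundary openOm convOm Om0 Sp.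
have Mn := weingarten_normal openOm convOm bndOm Om0 smOm p0.
have tE : tangential Om p = p - hgt p *: nrm p.
  by rewrite /tangential support_fun_hgt// outer_normalE.
rewrite newton_shape_formE//; last first.
  apply/matrixP => a b; rewrite !ord1 -dotvE mxE tE dotvBl dotvZl normal_unit// mulr1.
  by rewrite dotv_normal// gp mul1r subrr.
rewrite tE mulmxBl position_weingarten// sub0r -scalemxAl mulNmx -scalemxAl.
rewrite -scaleN1r !dotvZl mulN1r; congr (- (_ * _)).
rewrite -mulmxA -newton_mx_comm mulmxA -/(flux j p) dotvBr dotvZr.
have -> : dotv (flux j p *m wein p) (nrm p) = 0 by rewrite dotvE -mulmxA Mn mulmx0 mxE.
by rewrite mulr0 subr0.
Qed.
End weighted_minkowski.

(** * Jensen inequalities and the case of equality *)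

Section one_variable.
Context {R : realType}.
Implicit Types (a r t x y : R).

(** Subtracting the quadratic polynomial leaves a function with zero derivative at [a] and second
    derivative phi2 - c; the mean value theorem is applied twice. The last intermediate point lies
    strictly between [a] and [x], so a strict bound on the open interval is enough for
    strictness. *)
Lemma taylor_lower (phi phi1 phi2 : R -> R) (c r : R) :
  (forall t, 0 < t -> is_derive t 1 phi (phi1 t)) ->
  (forall t, 0 < t -> is_derive t 1 phi1 (phi2 t)) ->
  (forall t, 0 < t -> t <= r -> c <= phi2 t) ->
  forall a x, 0 < a -> a <= r -> 0 < x -> x <= r ->
    phi a + phi1 a * (x - a) + c / 2 * (x - a) ^+ 2 <= phi x /\
    ((forall t, 0 < t -> t < r -> c < phi2 t) -> x != a ->
     phi a + phi1 a * (x - a) + c / 2 * (x - a) ^+ 2 < phi x).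
Proof.
move=> d1 d2 cb a x a0 ar x0 xr.
pose h t := phi t - (c / 2 * (t - a) ^+ 2 + phi1 a * (t - a)).
pose h1 t := phi1 t - phi1 a - c * (t - a).
have dsub t : is_derive t 1 (fun t => t - a) 1.
  apply: is_derive_eqr (is_deriveB (is_derive_id t 1) (is_derive_cstr a t 1)) _.
  by rewrite subr0.
have dh t : 0 < t -> is_derive t 1 h (h1 t).
  move=> t0; have dq : is_derive t 1 (fun t => (t - a) ^+ 2) (2 * (t - a)).
    rewrite (_ : (fun t => _) = fun t => (t - a) * (t - a)); last first.
      by apply/funext => s; rewrite expr2.
    by apply: is_derive_eqr (is_derive_mulr (dsub t) (dsub t)) _; ring.
  apply: is_derive_eqr (is_deriveB (d1 _ t0) (is_deriveD (is_derive_mull (c / 2) dq)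
    (is_derive_mull (phi1 a) (dsub t)))) _.
  by rewrite /h1; field.
have dh1 t : 0 < t -> is_derive t 1 h1 (phi2 t - c).
  move=> t0; apply: is_derive_eqr (is_deriveB (is_deriveB (d2 _ t0) (is_derive_cstr (phi1 a) t 1))
    (is_derive_mull c (dsub t))) _.
  by ring.
have mvt (f f1 : R -> R) s t : (forall t, 0 < t -> is_derive t 1 f (f1 t)) -> 0 < s -> s < t ->
    exists c, [/\ s < c, c < t & f t - f s = f1 c * (t - s)].
  move=> df s0 st; have [|//|z] := @MVT R f f1 s t st.
  - by move=> z; rewrite in_itv /= => /andP[sz _]; apply: df; exact: lt_trans sz.
  - apply: continuous_in_subspaceT => z; rewrite inE /= in_itv /= => /andP[sz _].
    apply/differentiable_continuous/derivable1_diffP.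
    by have [] := df z (lt_le_trans s0 sz).
  - by rewrite in_itv /= => /andP[z1 z2] zE; exists z.
have h1a : h1 a = 0 by rewrite /h1; ring.
have hx : h x = phi x - (c / 2 * (x - a) ^+ 2 + phi1 a * (x - a)) by [].
have ha : h a = phi a by rewrite /h; ring.
suff key : h a <= h x /\ ((forall t, 0 < t -> t < r -> c < phi2 t) -> x != a -> h a < h x).
  have [k1 k2] := key; split=> [|st xa]; first by rewrite ha hx in k1; lra.
  by have := k2 st xa; rewrite ha hx; lra.
have [xa|ax|->] := ltgtP x a; last by split.
- have [z [xz za zE]] := mvt h h1 x a dh x0 xa.
  have z0 : 0 < z by exact: lt_trans xz.
  have [w [zw wa wE]] := mvt h1 _ z a dh1 z0 za.
  rewrite h1a sub0r in wE.
  have w0 : 0 < w by exact: lt_trans zw.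
  have wr : w < r by exact: lt_le_trans wa ar.
  have dx : 0 < a - x by rewrite subr_gt0.
  have dz : 0 < a - z by rewrite subr_gt0.
  split=> [|st _].
    have c1 : 0 <= (phi2 w - c) * (a - z) by rewrite mulr_ge0 ?subr_ge0 ?cb// ltW.
    have : 0 <= - h1 z * (a - x) by apply: mulr_ge0; [rewrite wE|exact: ltW].
    lra.
  have c1 : 0 < (phi2 w - c) * (a - z) by rewrite mulr_gt0// subr_gt0 st.
  have : 0 < - h1 z * (a - x) by apply: mulr_gt0; [rewrite wE|].
  lra.
- have [z [az zx zE]] := mvt h h1 a x dh a0 ax.
  have z0 : 0 < z by exact: lt_trans az.
  have [w [aw wz wE]] := mvt h1 _ a z dh1 a0 az.
  rewrite h1a subr0 in wE.
  have w0 : 0 < w by exact: lt_trans aw.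
  have wr : w < r by apply: lt_le_trans (lt_trans wz zx) xr.
  have dx : 0 < x - a by rewrite subr_gt0.
  have dz : 0 < z - a by rewrite subr_gt0.
  split=> [|st _].
    have c1 : 0 <= (phi2 w - c) * (z - a) by rewrite mulr_ge0 ?subr_ge0 ?cb// ltW.
    have : 0 <= h1 z * (x - a) by apply: mulr_ge0; [rewrite wE|exact: ltW].
    lra.
  have c1 : 0 < (phi2 w - c) * (z - a) by rewrite mulr_gt0// subr_gt0 st.
  have : 0 < h1 z * (x - a) by apply: mulr_gt0; [rewrite wE|].
  lra.
Qed.

Variable m : R.
Hypothesis m0 : 0 < m.

Definition wgt t : R := (1 + t `^ m)^-1.

Lemma wgt_den t : 0 < 1 + t `^ m.
Proof. by rewrite ltr_wpDr// powR_ge0. Qed.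

Definition dwgt t : R := - (m * t `^ (m - 1)) / (1 + t `^ m) ^+ 2.

Lemma is_derive_wgt t : 0 < t -> is_derive t 1 wgt (dwgt t).
Proof.
move=> t0; have d0 : 1 + t `^ m != 0 by rewrite gt_eqF// wgt_den.
have dp : is_derive t 1 (fun t => 1 + t `^ m) (m * t `^ (m - 1)).
  apply: is_derive_eqr (is_deriveD (is_derive_cstr 1 t 1) (is_derive1_powR m t0)) _.
  by rewrite add0r.
have [dd dE] := dp; split; first exact: derivableV.
by rewrite deriveV// dE /dwgt /GRing.scale /=; field.
Qed.

Lemma continuous_wgt t : 0 < t -> {for t, continuous wgt}.
Proof.
move=> t0; apply/differentiable_continuous/derivable1_diffP.
by case: (is_derive_wgt t0).
Qed.

Lemma wgt_ge0 t : 0 <= wgt t.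
Proof. by rewrite invr_ge0 ltW// wgt_den. Qed.

Lemma wgt_le1 t : wgt t <= 1.
Proof. by rewrite invf_le1 ?wgt_den// lerDl powR_ge0. Qed.

(** The function G. Leaving 0 out of the interval restricts the continuity of [wgt] to positive
    arguments. *)
Definition primw x : R := Rintegral lebesgue_measure `]0, x] wgt.

Lemma is_derive_primw t : 0 < t -> is_derive t 1 primw (wgt t).
Proof.
move=> t0.
have iw : (@lebesgue_measure R).-integrable [set` Interval (BRight 0) (BRight (t + 1))] (EFin \o wgt).
  apply: measurable_bounded_integrable.
  - exact: measurable_itv.
  - by rewrite [X in (X < _)%E]lebesgue_measure_itv /=; case: ifP => _; rewrite ?ltry// -EFinB ltry.
  - apply: (@measurable_funS _ _ (measurableTypeR R) R `]0, +oo[%classic).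
    + exact: measurable_itv.
    + by move=> s /=; rewrite !in_itv /= andbT => /andP[].
    rewrite set_itvoy; apply: open_continuous_measurable_fun; first exact: open_gt.
    by move=> s /set_mem /= s0; exact: continuous_wgt.
  - exists 1; split => // s s1 u _; apply: le_trans (ltW s1).
    by rewrite ger0_norm ?wgt_ge0 ?wgt_le1.
have t1 : t < t + 1 by rewrite ltrDl.
have [|dF FE] := continuous_FTC1 t1 iw _ (continuous_wgt t0).
  first [exact: t0|by []|by rewrite lteBSide].
by split; [exact: dF|rewrite -derive1E].
Qed.

Definition gfun t : R := t * primw t.
Definition gfun1 t : R := primw t + t * wgt t.
Definition gfun2 t : R := (2 + (2 - m) * t `^ m) / (1 + t `^ m) ^+ 2.

Lemma is_derive_gfun t : 0 < t -> is_derive t 1 gfun (gfun1 t).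
Proof.
move=> t0; apply: is_derive_eqr (is_derive_mulr (is_derive_id t 1) (is_derive_primw t0)) _.
by rewrite mul1r.
Qed.

Lemma is_derive_gfun1 t : 0 < t -> is_derive t 1 gfun1 (gfun2 t).
Proof.
move=> t0; have d0 : 1 + t `^ m != 0 by rewrite gt_eqF// wgt_den.
apply: is_derive_eqr (is_deriveD (is_derive_primw t0)
  (is_derive_mulr (is_derive_id t 1) (is_derive_wgt t0))) _.
by rewrite /gfun2 /dwgt /wgt -(mulr_powRB1 (ltW t0) m0); rewrite -(mulr_powRB1 (ltW t0) m0) in d0; field.
Qed.

(** With y = s^m and z = t^m, clearing denominators factors the difference as (z - y) (2 (2 + y + z)
    + (2 - m) (y z - 1)); for 0 < m <= 2 the negative part -(2 - m) is absorbed by the constant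
    4. *)
Lemma gfun2_decr (s t : R) : m <= 2 -> 0 < s -> s < t -> gfun2 t < gfun2 s.
Proof.
move=> m2 s0 st; rewrite /gfun2.
have yz : s `^ m < t `^ m by apply: gt0_ltr_powR => //; rewrite nnegrE ltW//; exact: lt_trans st.
have y0 : 0 < s `^ m by exact: powR_gt0.
set y := s `^ m in y0 yz *; set z := t `^ m in yz *.
have z0 : 0 < z by exact: lt_trans yz.
have c0 : 0 <= 2 - m by rewrite subr_ge0.
have y1 : 0 < (1 + y) ^+ 2 by rewrite exprn_gt0// addr_gt0.
have z1 : 0 < (1 + z) ^+ 2 by rewrite exprn_gt0// addr_gt0.
rewrite ltr_pdivrMr// mulrAC ltr_pdivlMr// -subr_gt0.
have -> : (2 + (2 - m) * y) * (1 + z) ^+ 2 - (2 + (2 - m) * z) * (1 + y) ^+ 2 =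
  (z - y) * (2 * (2 + y + z) + (2 - m) * (y * z - 1)) by ring.
rewrite mulr_gt0 ?subr_gt0//.
have h : 0 <= (2 - m) * (y * z) by rewrite !mulr_ge0// ltW.
have -> : 2 * (2 + y + z) + (2 - m) * (y * z - 1) = (2 + m + 2 * y + 2 * z) + (2 - m) * (y * z).
  by ring.
by apply: ltr_pwDl h; rewrite !addr_gt0// mulr_gt0.
Qed.

Lemma dwgt_le0 t : 0 < t -> 0 <= - dwgt t.
Proof.
move=> t0; rewrite /dwgt mulNr opprK divr_ge0 ?sqr_ge0// mulr_ge0 ?powR_ge0//; exact: ltW.
Qed.

(** Write -G'' as m / ((1 + t^m)^2 t^(1-m)). As 1 - m >= 0, both factors of the denominator are
    nondecreasing, so the minimum is at r. *)
Lemma dwgt_bound t r : m <= 1 -> 0 < t -> t <= r ->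
  m / ((1 + r `^ m) ^+ 2 * r `^ (1 - m)) <= - dwgt t.
Proof.
move=> m1 t0 tr; have r0 : 0 < r by exact: lt_le_trans tr.
have tE : t `^ (m - 1) = (t `^ (1 - m))^-1 by rewrite -powRN opprB.
rewrite /dwgt mulNr opprK tE.
have p1 : t `^ m <= r `^ m by apply: ge0_ler_powR; rewrite ?nnegrE// ltW.
have p2 : t `^ (1 - m) <= r `^ (1 - m) by apply: ge0_ler_powR; rewrite ?nnegrE ?subr_ge0// ltW.
have q1 : 0 < t `^ (1 - m) by exact: powR_gt0.
have q2 : 0 < t `^ m by exact: powR_gt0.
rewrite [X in _ <= X](_ : _ = m / ((1 + t `^ m) ^+ 2 * t `^ (1 - m))); last first.
  by rewrite -mulrA -invfM [t `^ (1 - m) * _]mulrC.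
apply: ler_wpM2l; first exact: ltW.
rewrite lef_pV2 ?posrE; last 2 first.
- by rewrite mulr_gt0 ?powR_gt0// exprn_gt0// wgt_den.
- by rewrite mulr_gt0 ?powR_gt0// exprn_gt0// wgt_den.
apply: ler_pM => //; [exact: sqr_ge0|exact: ltW|].
by apply: lerXn2r; rewrite ?nnegrE ?lerD2l//; exact/ltW/wgt_den.
Qed.

End one_variable.

(** * Recognition of centered spheres *)

Section spheres.
Context {R : realType} {n : nat}.
Local Notation E := 'rV[R]_n.+1.
Variable Om : set E.
Hypothesis openOm : open Om.
Hypothesis convOm : convex_set Om.
Hypothesis bndOm : bounded_set Om.
Hypothesis Om0 : Om 0.
Hypothesis smOm : smooth_hypersurface (boundary Om).
Local Notation g := (gauge Om).
Local Notation U := [set x : E | x != 0].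
Local Notation Sigma := (boundary Om).
Local Notation nrm := (normal Om).
Local Notation grad := (gauge_grad Om).
Local Notation hgt := (height Om).

Lemma is_derive_min (f : E -> R) (x v : E) (D : R) :
  is_derive x v f D -> (forall y, f x <= f y) -> D = 0.
Proof.
move=> df fmin; apply/eqP; rewrite -normr_le0 leNgt; apply/negP => D0.
have e0 : 0 < `|D| / 2 by rewrite divr_gt0.
have [r r0 H] := is_derive_small df e0.
have [s s0 sr] : exists2 s, 0 < s & s < r.
  by exists (r / 2); rewrite ?divr_gt0// ltr_pdivrMr// ltr_pMr// ltr1n.
have key (t : R) : `|t| = s -> t * D = - (s * `|D|) -> False.
  move=> ts tD; have := H t; rewrite ts => /(_ sr); rewrite ler_norml => /andP[_ h].
  have {}h : f (x + t *: v) - f x - t * D <= `|D| / 2 * s by [].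
  have := fmin (x + t *: v); rewrite tD in h.
  have : 0 < s * `|D| by rewrite mulr_gt0.
  lra.
have [D1|D1] := leP 0 D.
  apply: (key (- s)); first by rewrite normrN gtr0_norm.
  by rewrite ger0_norm ?mulNr.
apply: (key s); first by rewrite gtr0_norm.
by rewrite ltr0_norm ?mulrN ?opprK.
Qed.

(* Where the gauge ball touches a round ball, grad g is radial. *)
Lemma contact_grad (c : R) p : Sigma p -> (forall x, dotv x x <= c * g x ^+ 2) ->
  dotv p p = c -> p = c *: grad p.
Proof.
move=> Sp H pc; have p0 := boundary_neq0 openOm convOm Om0 Sp.
have gp := gauge_boundary openOm convOm Om0 Sp.
apply/eqP; rewrite -subr_eq0 -dotv_eq0; apply/eqP; set w := p - _.
have dg := gauge_is_derive_grad openOm convOm bndOm Om0 smOm w p0.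
have dd : is_derive p w (fun x => dotv x x) (\sum_i (w 0 i * p 0 i + p 0 i * w 0 i)).
  by apply: is_derive_sumr => i; apply: is_derive_mulr; exact: is_derive_coord.
have df := is_deriveB (is_derive_mull c (is_derive_mulr dg dg)) dd.
have fmin y : (fun x => c * (g x * g x) - dotv x x) p <= (fun x => c * (g x * g x) - dotv x x) y.
  by rewrite /= gp !mulr1 pc subrr subr_ge0 -expr2.
have := is_derive_min df fmin.
rewrite big_split /= -/(dotv w p) -/(dotv p w) gp mul1r mulr1 (dotvC w p) => h.
rewrite /w dotvBl dotvZl -/w; lra.
Qed.

Lemma gauge_enorm_ge a x : 0 < a -> (forall p, Sigma p -> a <= enorm p) -> a * g x <= enorm x.
Proof.
move=> a0 H; have [->|x0] := eqVneq x 0.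
  by rewrite (gauge0 openOm convOm Om0) mulr0 enorm_ge0.
have gx := gauge_gt0 openOm convOm bndOm Om0 x0.
have := H _ (gproj_boundary openOm convOm bndOm Om0 x0).
by rewrite /gproj enormZ gtr0_norm ?invr_gt0// mulrC ler_pdivlMr.
Qed.

Lemma gauge_enorm_le a x : (forall p, Sigma p -> enorm p <= a) -> enorm x <= a * g x.
Proof.
move=> H; have [->|x0] := eqVneq x 0.
  by rewrite (gauge0 openOm convOm Om0) mulr0 /enorm dotv0 sqrtr0.
have gx := gauge_gt0 openOm convOm bndOm Om0 x0.
have := H _ (gproj_boundary openOm convOm bndOm Om0 x0).
by rewrite /gproj enormZ gtr0_norm ?invr_gt0// mulrC ler_pdivrMr.
Qed.

Lemma gauge_enorm_le2 a x : (forall p, Sigma p -> enorm p <= a) ->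
  dotv x x <= a ^+ 2 * g x ^+ 2.
Proof.
move=> H; rewrite -enorm_sqr -exprMn; have h := gauge_enorm_le x H.
by rewrite lerXn2r ?nnegrE ?enorm_ge0//; exact: le_trans (enorm_ge0 x) h.
Qed.

Lemma hgt_le_enorm p : Sigma p -> hgt p <= enorm p.
Proof.
move=> Sp; have p0 := boundary_neq0 openOm convOm Om0 Sp.
rewrite /height -(support_normal openOm convOm bndOm Om0 smOm Sp).
apply: le_trans (dotv_le_enorm _ _) _.
by rewrite [X in _ * X]/enorm normal_unit// sqrtr1 mulr1.
Qed.

Lemma hgt_grad p : Sigma p -> enorm (grad p) = (hgt p)^-1.
Proof. by move=> _; rewrite /height invrK. Qed.

Lemma sphere_of_hgt a : 0 < a -> Om !=set0 -> (forall p, Sigma p -> hgt p = a) ->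
  Sigma = esphere 0 a.
Proof.
move=> a0 On H.
have lower p : Sigma p -> a <= enorm p by move=> Sp; rewrite -(H _ Sp); exact: hgt_le_enorm.
have [q Sq q0] := boundary_nonzero openOm bndOm On.
have Sn : Sigma !=set0 by exists q.
have [p /set_mem Sp pmax] := EVT_max_rV Sn (compact_boundary bndOm)
  (continuous_subspaceT (@enorm_continuous R n.+1)).
have upper x : Sigma x -> enorm x <= enorm p by move=> Sx; apply: pmax; exact: mem_set.
have pE : p = enorm p ^+ 2 *: grad p.
  apply: contact_grad => //; last by rewrite enorm_sqr.
  by move=> x; exact: gauge_enorm_le2.
have ep : 0 < enorm p by exact: lt_le_trans (lower _ Sp).
(* Take norms in p = |p|^2 grad g, using |grad g| = 1 / a. *)
have pa : enorm p = a.
  have := congr1 enorm pE; rewrite enormZ ger0_norm ?sqr_ge0// hgt_grad// (H _ Sp) => h.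
  apply: (mulfI (lt0r_neq0 ep)); apply: (mulIf (lt0r_neq0 (_ : 0 < a^-1))); rewrite ?invr_gt0//.
  by rewrite -expr2 -h mulfK ?gt_eqF.
apply/seteqP; split => x; rewrite /esphere /= subr0.
  by move=> Sx; apply/eqP; rewrite eq_le lower// -pa upper.
move=> xa; have x0 : x != 0 by rewrite -enorm_gt0 xa.
have h1 := gauge_enorm_ge x a0 lower.
have h2 : enorm x <= a * g x by rewrite -pa; exact: gauge_enorm_le.
rewrite (boundary_gauge openOm convOm Om0) /=.
apply/eqP; rewrite eq_le; apply/andP; split.
  by rewrite -(ler_pM2l a0) mulr1 -{2}xa.
by rewrite -(ler_pM2l a0) mulr1 -{1}xa.
Qed.

Lemma sphere_normal s p : 0 < s -> Sigma = esphere 0 s -> Sigma p ->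
  hgt p = s /\ tangential Om p = 0.
Proof.
move=> s0 SE Sp; have p0 := boundary_neq0 openOm convOm Om0 Sp.
have ns x : Sigma x -> enorm x = s by rewrite SE /esphere /= subr0.
have pE : p = s ^+ 2 *: grad p.
  apply: contact_grad => //; last by rewrite -enorm_sqr ns.
  by move=> x; apply: gauge_enorm_le2 => y Sy; rewrite ns.
have ss : s ^+ 2 != 0 by rewrite expf_neq0// gt_eqF.
have gE : grad p = (s ^+ 2)^-1 *: p by rewrite {2}pE scalerA mulVf// scale1r.
have hs : hgt p = s.
  rewrite /height gE enormZ ns// gtr0_norm ?invr_gt0 ?exprn_gt0//.
  by field; rewrite gt_eqF.
split=> //; rewrite /tangential support_fun_hgt// outer_normalE// hs.
rewrite /normal -/(height Om p) hs scalerA -expr2 -pE subrr//.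
Qed.

End spheres.

Section positivity.
Context {R : realType} {n : nat}.
Local Notation E := 'rV[R]_n.+1.
Variable Om : set E.
Hypothesis openOm : open Om.
Hypothesis convOm : convex_set Om.
Hypothesis bndOm : bounded_set Om.
Hypothesis Om0 : Om 0.
Hypothesis smOm : smooth_hypersurface (boundary Om).
Variable mu : {measure set (borelType E) -> \bar R}.
Hypothesis area : area_measure (boundary Om) mu.
Local Notation g := (gauge Om).
Local Notation U := [set x : E | x != 0].
Local Notation Sigma := (boundary Om).
Local Notation hgt := (height Om).

Lemma leb_integral_gt0 (d : nat) (F : 'rV[R]_d -> R) x : continuous F -> (forall y, 0 <= F y) ->
  0 < F x -> (0 < \int[@leb R d]_y (F y)%:E)%E.
Proof.
move=> cF F0 Fx; pose V := F @^-1` [set t | F x / 2 < t].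
have oV : open V.
  by apply: open_comp => [y _|]; [exact: cF|exact: open_gt].
have Vx : V x by rewrite /V /= ltr_pdivrMr// ltr_pMr// ltr1n.
have mV : measurable (V : set (borelType 'rV[R]_d)) by exact: measurable_open.
have mF : measurable_fun setT (EFin \o F : borelType 'rV[R]_d -> \bar R).
  by apply/measurable_EFinP; exact: continuous_rV_measurable.
have Fge (y : borelType 'rV[R]_d) : setT y -> (0 <= (EFin \o F) y)%E by rewrite lee_fin.
apply: (@lt_le_trans _ _ ((F x / 2)%:E * @leb R d V)%E).
  by rewrite mule_gt0 ?lte_fin ?divr_gt0//; exact: leb_open_gt0 Vx.
rewrite -integral_cst//; apply: (@le_trans _ _ (\int[@leb R d]_(y in V) (F y)%:E)%E).
  apply: ge0_le_integral => //.
  - by move=> y _; rewrite lee_fin divr_ge0// ltW.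
  - exact: measurable_funTS.
  by move=> y Vy; rewrite lee_fin ltW.
exact: ge0_subset_integral.
Qed.

(** Positivity is imported from Lebesgue measure: extend [w] radially, multiply by the cutoff, and
    read the integral over the whole space in polar coordinates; [height] is bounded above by
    compactness. *)
Lemma boundary_integral_gt0 (w : E -> R) p :
  (forall x, x != 0 -> {for x, continuous w}) -> (forall q, Sigma q -> 0 <= w q) ->
  Sigma p -> 0 < w p -> 0 < Rintegral mu Sigma w.
Proof.
move=> cw w0 Sp wp; have mS := measurable_boundary Om.
have [M0 M00 HM] := norm_le_gauge openOm convOm bndOm Om0.
have M2 : 0 <= 2 * M0 by rewrite mulr_ge0// ltW.
pose F (x : E) := Num.max (w (gproj Om x)) 0 * bump (g x).
have cF : continuous F.
  move=> x; have [->|x0] := eqVneq x 0.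
    apply: (@for_continuous_near _ _ _ _ 0).
    have cg : {for (0 : E), continuous g} by exact: gauge_continuous.
    have g1 : \forall y \near (0 : E), g y < 1.
      by apply: (cg [set t : R | t < 1]); apply: lt_nbhsl; rewrite (gauge0 openOm convOm Om0).
    by apply: filterS g1 => y gy; rewrite /F bump_out ?mulr0//; left; exact: ltW.
  apply: (@for_continuousM _ _ (fun y => Num.max (w (gproj Om y)) 0) (fun y => bump (g y))); last first.
    by apply: (@for_continuous_comp _ _ g bump); [exact: gauge_continuous|exact: continuous_bump].
  apply: (@for_continuous_comp _ _ (fun y => w (gproj Om y)) (fun t => Num.max t 0)); last first.
    by apply: continuous_max0 => t; exact: cvg_id.
  apply: (@continuous_comp E E R (gproj Om) w).
    exact: Ck_continuous (gproj_Ck openOm convOm bndOm Om0 smOm 0) x0.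
  by apply: cw; exact: boundary_neq0 (gproj_boundary openOm convOm bndOm Om0 x0).
have F0 x : ~ box (2 * M0) x -> F x = 0.
  rewrite boxE//= => h; rewrite /F bump_out ?mulr0//; right; rewrite leNgt; apply/negP => gx; apply: h.
  by apply: le_trans (HM x) _; rewrite mulrC ler_wpM2r ?ltW.
have Fge x : 0 <= F x by rewrite mulr_ge0 ?bump_ge0// le_max lexx orbT.
have p0 := boundary_neq0 openOm convOm Om0 Sp.
have gp := gauge_boundary openOm convOm Om0 Sp.
have gpZ t q : Sigma q -> 0 < t -> g (t *: q) = t.
  by move=> Sq t0; rewrite gaugeZ// (gauge_boundary openOm convOm Om0 Sq) mulr1.
have gprojZ t q : Sigma q -> 0 < t -> gproj Om (t *: q) = q.
  by move=> Sq t0; rewrite /gproj gpZ// scalerA mulVf ?scale1r// gt_eqF.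
(* The factor 3/2 is the midpoint of the support of [bump]. *)
have Fp : 0 < F ((3 / 2) *: p).
  rewrite /F gprojZ// gpZ//; apply: mulr_gt0; first by rewrite lt_max wp.
  by rewrite /bump /bumpq exprn_gt0// lt_max; apply/orP; right; lra.
have [i1 E1] := polar_ge0 openOm convOm bndOm Om0 smOm area cF F0 M2 Fge.
have rE q : Sigma q -> ray_integral n (EFin \o F) q = (w q * bump_moment n)%:E.
  move=> Sq; rewrite EFinM -bump_momentE -(integralZl measurableT (bumpX_integrable n)).
  apply: eq_integral => t _; rewrite /= /F /pospow -!EFinM; congr _%:E; have [t0|t0] := ltP 0 t.
    rewrite gpZ// gprojZ// (max_idPl _) ?w0// mul1r.
    by rewrite -[LHS]mulrA.
  rewrite mul0r mulr0 bump_out ?mul0r ?mulr0//; left; apply: le_trans t0 _; exact: ler01.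
have hp q : Sigma q -> 0 < hgt q.
  move=> Sq; apply: (hgt_gt0 openOm convOm bndOm Om0 smOm).
  exact: (boundary_neq0 openOm convOm Om0 Sq).
have cmpS : compact Sigma := compact_boundary bndOm.
have ch : {within Sigma, continuous hgt}.
  apply: continuous_in_subspaceT => q /set_mem Sq.
  by apply: Ck_continuous (hgt_Ck openOm convOm bndOm Om0 smOm 0) _; exact: (boundary_neq0 openOm convOm Om0 Sq).
have Sn : Sigma !=set0 by exists p.
have [p1 /set_mem Sp1 hmax] := EVT_max_rV Sn cmpS ch.
pose c := hgt p1 * bump_moment n.
have c0 : 0 < c by rewrite mulr_gt0// ?hp// bump_moment_gt0.
have iw : mu.-integrable Sigma (EFin \o w) by exact: boundary_integrable.
suff : 0 < Rintegral mu Sigma w * c by rewrite pmulr_lgt0.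
rewrite -lte_fin EFinM /Rintegral fineK ?integrable_fin_num// muleC -(integralZl mS iw).
apply: lt_le_trans (leb_integral_gt0 cF Fge Fp) _; rewrite -E1.
apply: ge0_le_integral => //.
- move=> q Sq; rewrite rE// [fine _]/= lee_fin; apply: mulr_ge0; first exact/ltW/hp.
  by apply: mulr_ge0; [exact: w0|exact/ltW/bump_moment_gt0].
- by have /integrableP[] := i1.
- by apply: measurable_funeM; have /integrableP[] := iw.
move=> q Sq; rewrite rE// -EFinM lee_fin [fine _]/=.
have -> : c * w q = hgt p1 * (w q * bump_moment n) by rewrite /c; ring.
apply: ler_wpM2r; last by apply: hmax; exact: mem_set.
by apply: mulr_ge0; [exact: w0|exact/ltW/bump_moment_gt0].
Qed.

End positivity.

(** Here X = G(a), Y = G(b), and Z is the integral of H_(k-1). Equality in the sum forces equality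
    in each summand; only the one for t G(t) is kept. *)
Lemma collect_jensen {R : realFieldType} (f u v G P X Y Z : R) :
  f <= Z * (X - Y) -> X * Z + u <= G -> -1 * Y * Z + v <= -1 * P ->
  f + u + v <= G - P /\ (f + u + v = G - P -> G = X * Z + u).
Proof. by move=> h1 h2 h3; split=> [|h4]; lra. Qed.

Section concavity.
Context {R : realType}.
Variable m : R.
Hypothesis m0 : 0 < m.

Lemma is_derive_Nprimw (t : R) : 0 < t -> is_derive t 1 (fun t => -1 * primw m t) (-1 * wgt m t).
Proof. by move=> t0; apply: is_derive_mull; exact: is_derive_primw. Qed.

Lemma is_derive_Nwgt (t : R) : 0 < t -> is_derive t 1 (fun t => -1 * wgt m t) (-1 * dwgt m t).
Proof. by move=> t0; apply: is_derive_mull; exact: is_derive_wgt. Qed.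

Lemma primw_concave (a b : R) : 0 < a -> 0 < b -> wgt m a * (a - b) <= primw m a - primw m b.
Proof.
move=> a0 b0; have dw0 t : 0 < t -> t <= Num.max a b -> 0 <= -1 * dwgt m t.
  by move=> t0 _; rewrite mulN1r; exact: dwgt_le0.
have ar : a <= Num.max a b by rewrite le_max lexx.
have br : b <= Num.max a b by rewrite le_max lexx orbT.
have [+ _] := taylor_lower is_derive_Nprimw is_derive_Nwgt dw0 a0 ar b0 br.
by rewrite mul0r mul0r addr0; lra.
Qed.

End concavity.

(** * Curvature integrals and the main inequality *)

Section curvature_integrals.
Context {R : realType} {n : nat}.
Local Notation E := 'rV[R]_n.+1.
Variable Om : set E.
Hypothesis openOm : open Om.
Hypothesis convOm : convex_set Om.
Hypothesis bndOm : bounded_set Om.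
Hypothesis Om0 : Om 0.
Hypothesis smOm : smooth_hypersurface (boundary Om).
Variable mu : {measure set (borelType E) -> \bar R}.
Hypothesis area : area_measure (boundary Om) mu.
Local Notation Sigma := (boundary Om).
Local Notation hgt := (height Om).
Local Notation wein := (weingarten Om).
Local Notation cpos f := (forall t : R, 0 < t -> {for t, continuous f}).
Let mS := measurable_boundary Om.
Implicit Types (f h : R -> R) (j : nat) (c al be ga s : R) (p x : E).

(* The integral of f(<X, nu>) H_j over the boundary. *)
Definition curv_int (j : nat) (f : R -> R) : R :=
  Rintegral mu Sigma (fun p => f (hgt p) * (symf (wein p) j / ('C(n, j))%:R)).

Lemma mean_curvE j p : Sigma p -> mean_curv Om j p = symf (wein p) j / ('C(n, j))%:R.
Proof. by move=> Sp; rewrite /mean_curv sigma_curvE. Qed.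

Lemma hgt_pos p : Sigma p -> 0 < hgt p.
Proof.
move=> Sp; apply: (hgt_gt0 openOm convOm bndOm Om0 smOm).
exact: (boundary_neq0 openOm convOm Om0 Sp).
Qed.

Lemma hgt_comp_continuous (f : R -> R) x : cpos f -> x != 0 ->
  {for x, continuous (fun p : E => f (hgt p))}.
Proof.
move=> cf x0; apply: (@for_continuous_comp _ _ hgt f).
  exact: Ck_continuous (hgt_Ck openOm convOm bndOm Om0 smOm 0) x0.
by apply: cf; exact: (hgt_gt0 openOm convOm bndOm Om0 smOm).
Qed.

Lemma curv_density_continuous j f x : cpos f -> x != 0 ->
  {for x, continuous (fun p : E => f (hgt p) * (symf (wein p) j / ('C(n, j))%:R))}.
Proof.
move=> cf x0; apply: for_continuousM; first exact: hgt_comp_continuous.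
apply: (@for_continuousM _ _ (fun p : E => symf (wein p) j) (fun=> ('C(n, j))%:R^-1)).
  exact: (symf_continuous openOm convOm bndOm Om0 smOm).
exact: (@cst_continuous E R).
Qed.

Lemma curv_integrable j f : cpos f ->
  mu.-integrable Sigma (EFin \o (fun p => f (hgt p) * (symf (wein p) j / ('C(n, j))%:R))).
Proof.
move=> cf; apply: boundary_integrable => // x x0.
exact: curv_density_continuous.
Qed.

Lemma curv_intD j f h : cpos f -> cpos h ->
  curv_int j (fun t => f t + h t) = curv_int j f + curv_int j h.
Proof.
move=> cf ch; rewrite -(RintegralD mS (curv_integrable j cf) (curv_integrable j ch)).
by apply: eq_Rintegral => p _; rewrite mulrDl.
Qed.

Lemma curv_intZ j c f : cpos f -> curv_int j (fun t => c * f t) = c * curv_int j f.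
Proof.
move=> cf; rewrite -(RintegralZl c mS (curv_integrable j cf)).
by apply: eq_Rintegral => p _; rewrite -[LHS]mulrA.
Qed.

Lemma eq_curv_int j f h : (forall p, Sigma p -> f (hgt p) = h (hgt p)) ->
  curv_int j f = curv_int j h.
Proof. by move=> fh; apply: eq_Rintegral => p /set_mem Sp; rewrite fh. Qed.

Lemma curv_density_ge0 j p : Sigma p -> 0 <= symf (wein p) j / ('C(n, j))%:R.
Proof. by move=> Sp; rewrite -mean_curvE//; exact: mean_curv_ge0. Qed.

Lemma curv_int_ge0 j f : (forall p, Sigma p -> 0 <= f (hgt p)) -> 0 <= curv_int j f.
Proof.
move=> f0; apply: Rintegral_ge0 => p Sp.
by apply: mulr_ge0; [exact: f0|exact: curv_density_ge0].
Qed.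

Lemma curv_int_gt0 j f p : cpos f -> (forall q, Sigma q -> 0 <= f (hgt q)) ->
  Sigma p -> 0 < mean_curv Om j p -> 0 < f (hgt p) -> 0 < curv_int j f.
Proof.
move=> cf f0 Sp Hp fp; apply: (boundary_integral_gt0 openOm convOm bndOm Om0 smOm area (p := p)) => //.
- by move=> x x0; exact: curv_density_continuous.
- by move=> q Sq; apply: mulr_ge0; [exact: f0|exact: curv_density_ge0].
- by apply: mulr_gt0 => //; rewrite -mean_curvE.
Qed.

(** Passing from sigma_j to H_j balances the coefficients because (j+1) C(n, j+1) = (n-j) C(n,
    j). *)
Lemma minkowski_flux j (psi dpsi : R -> R) : (j < n)%N ->
  (forall t : R, 0 < t -> is_derive t 1 psi (dpsi t)) -> cpos dpsi ->
  curv_int j.+1 (fun t => t * psi t) - curv_int j psi =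
  (j.+1%:R * ('C(n, j.+1))%:R)^-1 *
    Rintegral mu Sigma (fun p => dpsi (hgt p) * newton_shape_form Om j p (tangential Om p)).
Proof.
move=> jn dpsiP cd.
have cpsi : cpos psi.
  move=> t t0; apply/differentiable_continuous/derivable1_diffP.
  by case: (dpsiP t t0).
have cid : cpos (fun t : R => t) by move=> t _; exact: cvg_id.
have cip : cpos (fun t : R => t * psi t).
  by move=> t t0; apply: for_continuousM; [exact: cid|exact: cpsi].
have C1 : ('C(n, j.+1))%:R != 0 :> R by rewrite pnatr_eq0 -lt0n bin_gt0.
have C0 : ('C(n, j))%:R != 0 :> R by rewrite pnatr_eq0 -lt0n bin_gt0 ltnW.
have J0 : j.+1%:R != 0 :> R by rewrite pnatr_eq0.
have CE : j.+1%:R * ('C(n, j.+1))%:R = (n - j)%:R * ('C(n, j))%:R :> R.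
  by rewrite -!natrM mul_bin_left.
rewrite (@eq_Rintegral _ _ _ mu Sigma (fun p : borelType E => dpsi (hgt p) * - (hgt p * flux_pos Om j p))); last first.
  by move=> p /set_mem Sp; rewrite newton_shape_flux.
rewrite -(weighted_minkowski openOm convOm bndOm Om0 smOm area dpsiP cd jn).
have -> : Rintegral mu Sigma (fun p => psi (hgt p) * (hgt p * symf (wein p) j.+1)) =
    ('C(n, j.+1))%:R * curv_int j.+1 (fun t => t * psi t).
  rewrite -(RintegralZl _ mS (curv_integrable j.+1 cip)).
  by apply: eq_Rintegral => p _; field.
have -> : Rintegral mu Sigma (fun p => psi (hgt p) * symf (wein p) j) =
    ('C(n, j))%:R * curv_int j psi.
  rewrite -(RintegralZl _ mS (curv_integrable j cpsi)).
  by apply: eq_Rintegral => p _; field.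
by rewrite !mulrA -CE -mulrBr mulrA mulVf ?mul1r// mulf_neq0.
Qed.

Lemma minkowski_id j : (j < n)%N -> curv_int j.+1 (fun t => t) = curv_int j (fun=> 1).
Proof.
move=> jn; have := @minkowski_flux j (fun=> 1) (fun=> 0) jn.
rewrite (eq_curv_int _ (h := fun t => t)); last by move=> p _; rewrite mulr1.
move=> H; apply/eqP; rewrite -subr_eq0 H.
- rewrite (@eq_Rintegral _ _ _ mu Sigma (fun=> 0)); last by move=> p _; exact: mul0r.
  by rewrite /Rintegral integral0 mulr0.
- by move=> t _; exact: cvg_cst.
Qed.

Lemma Icurv_nat j : Icurv Om mu (Posz j) = curv_int j (fun=> 1).
Proof. by apply: eq_Rintegral => p /set_mem Sp; rewrite mul1r -mean_curvE. Qed.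

(** For j > 0 this is the Minkowski formula with constant weight; for j = 0 it is the cone formula,
    so I_{-1} needs no separate treatment later. *)
Lemma curv_int_id j : (j <= n)%N -> curv_int j (fun t => t) = Icurv Om mu (j%:Z - 1).
Proof.
case: j => [_|j jn]; last by rewrite minkowski_id// -Icurv_nat intS addrAC subrr add0r.
rewrite sub0r /= (volume_formula openOm convOm bndOm Om0 smOm area).
by apply: eq_Rintegral => p _; rewrite bin0 divr1 mulr1.
Qed.

Lemma delta2_sqr j s : delta2 Om mu j s ^+ 2 = curv_int j (fun t => (t - s) ^+ 2).
Proof.
rewrite sqr_sqrtr; last first.
  apply: Rintegral_ge0 => p Sp; apply: mulr_ge0; first exact: sqr_ge0.
  exact: mean_curv_ge0.
by apply: eq_Rintegral => p /set_mem Sp; rewrite mean_curvE// support_fun_hgt.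
Qed.

Lemma curv_int_quadratic j f al be ga s : cpos f ->
  curv_int j (fun t => f t - (al + be * (t - s) + ga * (t - s) ^+ 2)) =
  curv_int j f - (al * curv_int j (fun=> 1) +
    be * (curv_int j (fun t => t) - s * curv_int j (fun=> 1)) +
    ga * curv_int j (fun t => (t - s) ^+ 2)).
Proof.
move=> cf.
have c1 c : cpos (fun=> c : R) by move=> t _; exact: cvg_cst.
have cid : cpos (fun t : R => t) by move=> t _; exact: cvg_id.
have cM (h k : R -> R) : cpos h -> cpos k -> cpos (fun t => h t * k t).
  by move=> ch ck t t0; apply: for_continuousM; [exact: ch|exact: ck].
have cD (h k : R -> R) : cpos h -> cpos k -> cpos (fun t => h t + k t).
  by move=> ch ck t t0; apply: for_continuousD; [exact: ch|exact: ck].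
have cs1 : cpos (fun t => t - s) by exact: (cD (fun t => t) (fun=> - s) cid (c1 _)).
have cs : cpos (fun t => (t - s) ^+ 2).
  by rewrite (_ : (fun t => _) = fun t => (t - s) * (t - s)); [exact: (cM _ _ cs1 cs1)|].
rewrite (eq_curv_int _ (h := fun t => f t + ((s * be - al) * 1 + (- be * t + - ga * (t - s) ^+ 2)))); last first.
  by move=> p _; ring.
have k0 : cpos (fun=> (s * be - al) * 1) by exact: (cM _ _ (c1 _) (c1 1)).
have k1 : cpos (fun t => - be * t) by exact: (cM _ _ (c1 _) cid).
have k2 : cpos (fun t => - ga * (t - s) ^+ 2) by exact: (cM _ _ (c1 _) cs).
have k3 := cD _ _ k1 k2; have k4 := cD _ _ k0 k3.
rewrite (curv_intD j cf k4) (curv_intD j k0 k3) (curv_intD j k1 k2).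
rewrite (curv_intZ j _ (c1 1)) (curv_intZ j _ cid) (curv_intZ j _ cs).
ring.
Qed.

Section jensen.
Variables (r : R) (j : nat).
Hypothesis hgt_le : forall p, Sigma p -> hgt p <= r.

(* Second-order Jensen inequality for the weight H_j, expanded at the mean height s. *)
Lemma jensen_remainder (phi phi1 phi2 : R -> R) (c s : R) :
  (forall t : R, 0 < t -> is_derive t 1 phi (phi1 t)) ->
  (forall t : R, 0 < t -> is_derive t 1 phi1 (phi2 t)) ->
  (forall t : R, 0 < t -> t <= r -> c <= phi2 t) ->
  0 < s -> s <= r -> curv_int j (fun t => t) = s * curv_int j (fun=> 1) ->
  phi s * curv_int j (fun=> 1) + c / 2 * curv_int j (fun t => (t - s) ^+ 2) <= curv_int j phi /\
  ((forall t : R, 0 < t -> t < r -> c < phi2 t) -> (forall p, Sigma p -> 0 < mean_curv Om j p) ->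
   curv_int j phi = phi s * curv_int j (fun=> 1) + c / 2 * curv_int j (fun t => (t - s) ^+ 2) ->
   forall p, Sigma p -> hgt p = s).
Proof.
move=> d1 d2 cb s0 sr sE.
have cphi : cpos phi.
  move=> t t0; apply/differentiable_continuous/derivable1_diffP.
  by case: (d1 t t0).
pose rem t := phi t - (phi s + phi1 s * (t - s) + c / 2 * (t - s) ^+ 2).
have remE := curv_int_quadratic j (phi s) (phi1 s) (c / 2) s cphi.
(* The linear term integrates to 0 because [s] is the mean of the support function for the weight
   H_j. *)
rewrite -/rem sE subrr mulr0 addr0 in remE.
have tl p : Sigma p -> 0 <= rem (hgt p) /\
    ((forall t : R, 0 < t -> t < r -> c < phi2 t) -> hgt p != s -> 0 < rem (hgt p)).
  move=> Sp; have [h1 h2] := taylor_lower d1 d2 cb s0 sr (hgt_pos Sp) (hgt_le Sp).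
  by rewrite /rem subr_ge0 subr_gt0.
have rem0 p : Sigma p -> 0 <= rem (hgt p) by move=> /tl[].
split; first by rewrite -subr_ge0 -remE; exact: curv_int_ge0.
move=> st H0 phiE p Sp; apply/eqP; apply: contraT => ps.
have crem : cpos rem.
  move=> t t0; apply: for_continuousD; first exact: cphi.
  apply: continuousN; apply/differentiable_continuous/derivable1_diffP.
  by apply: ex_derive.
have := @curv_int_gt0 j rem p crem rem0 Sp (H0 _ Sp) ((tl _ Sp).2 st ps).
by rewrite remE phiE subrr ltxx.
Qed.

End jensen.

Lemma curv_int_id_le r j : (forall p, Sigma p -> hgt p <= r) ->
  curv_int j (fun t => t) <= r * curv_int j (fun=> 1).
Proof.
move=> hr; have cid : cpos (fun t : R => t) by move=> t _; exact: cvg_id.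
have c1 : cpos (fun=> 1 : R) by move=> t _; exact: cvg_cst.
rewrite -subr_ge0 -(curv_intZ j r c1) -[X in _ - X]mul1r -mulNr -(curv_intZ j _ cid).
rewrite -curv_intD.
- by apply: curv_int_ge0 => p Sp; rewrite mulr1 mulN1r subr_ge0 hr.
- by move=> t _; exact: cvg_cst.
- by move=> t _; apply: cvgM; [exact: cvg_cst|exact: cvg_id].
Qed.

(** Positivity climbs from H_0 = 1: the integral of u H_(j+1) equals that of H_j, and u <= r then
    makes the integral of H_(j+1) positive. *)
Lemma curv_int_pos r j : (forall p, Sigma p -> hgt p <= r) -> (j <= n)%N ->
  0 < curv_int j (fun t => t) /\ 0 < curv_int j (fun=> 1).
Proof.
move=> hr; have [p Sp _] : exists2 p, Sigma p & p != 0.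
  by apply: boundary_nonzero => //; exists 0.
have r0 : 0 < r := lt_le_trans (hgt_pos Sp) (hr _ Sp).
have step i : 0 < curv_int i (fun t => t) -> 0 < curv_int i (fun=> 1).
  by move=> h; have := lt_le_trans h (curv_int_id_le i hr); rewrite pmulr_rgt0.
elim: j => [_|j IH jn]; last first.
  have [_ h] := IH (ltnW jn); rewrite -minkowski_id// in h.
  by split=> //; exact: step.
have h0 : 0 < curv_int 0 (fun t => t).
  apply: (@curv_int_gt0 0 (fun t => t) p).
  - by move=> t _; exact: cvg_id.
  - by move=> q Sq; apply: ltW; exact: hgt_pos.
  - exact: Sp.
  - by rewrite mean_curvE// bin0 divr1.
  - exact: hgt_pos.
by split=> //; exact: step.
Qed.

Section main_inequality.
Variables (m r c : R) (j : nat).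
Hypotheses (m0 : 0 < m) (m2 : m <= 2) (jn : (j < n)%N).
Hypothesis hgt_le : forall p, Sigma p -> hgt p <= r.
Hypothesis c_le : forall t : R, 0 < t -> t <= r -> c <= - dwgt m t.
Let A := curv_int j.+1 (fun=> 1).
Let B := curv_int j (fun=> 1).
Let D := curv_int j (fun t => t).
Let a := B / A.
Let b := D / B.
Let first := A `^ (m - 1) * ((B ^+ 2 - A * D) / (A `^ m + B `^ m)).
Let second := gfun2 m r / 2 * curv_int j.+1 (fun t => (t - a) ^+ 2).
Let third := c / 2 * curv_int j (fun t => (t - b) ^+ 2).
Let rhs := (j.+1%:R * ('C(n, j.+1))%:R)^-1 *
  Rintegral mu Sigma (fun p => newton_shape_form Om j p (tangential Om p) /
    (1 + (support_fun Om p) `^ m)).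

Let A0 : 0 < A. Proof. by have [] := curv_int_pos hgt_le jn. Qed.
Let B0 : 0 < B. Proof. by have [] := curv_int_pos hgt_le (ltnW jn). Qed.
Let D0 : 0 < D. Proof. by have [] := curv_int_pos hgt_le (ltnW jn). Qed.
Let a0 : 0 < a. Proof. by rewrite divr_gt0. Qed.
Let b0 : 0 < b. Proof. by rewrite divr_gt0. Qed.
Let aA : B = a * A. Proof. by rewrite /a divfK// gt_eqF. Qed.
Let bB : D = b * B. Proof. by rewrite /b divfK// gt_eqF. Qed.
Let ar : a <= r.
Proof. by rewrite /a ler_pdivrMr// /B -minkowski_id//; exact: curv_int_id_le. Qed.
Let br : b <= r.
Proof. by rewrite /b ler_pdivrMr//; exact: curv_int_id_le. Qed.

Lemma shape_integralE : rhs = curv_int j.+1 (gfun m) - curv_int j (primw m).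
Proof.
rewrite (minkowski_flux jn (@is_derive_primw R m)); last first.
  by move=> t t0; exact: continuous_wgt.
congr (_ * _); apply: eq_Rintegral => p /set_mem Sp.
by rewrite mulrC support_fun_hgt.
Qed.

(** Since B = a A and D = b B, the numerator is A B (a - b), while A^m + B^m = A A^(m-1) (1 +
    a^m). *)
Lemma first_termE : first = B * (wgt m a * (a - b)).
Proof.
have PE : A `^ m = A * A `^ (m - 1) by rewrite mulr_powRB1 ?ltW.
have BE : B `^ m = a `^ m * A `^ m by rewrite aA powRM ?ltW.
have Q0 : A `^ (m - 1) != 0 by rewrite gt_eqF// powR_gt0.
have d0 : 1 + a `^ m != 0 by rewrite gt_eqF// ltr_wpDr// powR_ge0.
have A1 : A != 0 by rewrite gt_eqF.
have dE : A `^ m + B `^ m = A * A `^ (m - 1) * (1 + a `^ m) by rewrite BE PE; ring.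
rewrite /first dE bB aA /wgt; move: (a `^ m) (A `^ (m - 1)) d0 Q0 => x y d0 Q0.
field; rewrite A1 Q0 d0 //.
Qed.

Let gfun2_ge t : 0 < t -> t <= r -> gfun2 m r <= gfun2 m t.
Proof.
move=> t0; rewrite le_eqVlt => /predU1P[->//|tr].
by apply: ltW; exact: gfun2_decr.
Qed.

(** The right side is the integral of t G(t) against H_(j+1) minus that of G against H_j. The values
    at the means are a G(a) A = G(a) B and G(b) B; their difference dominates [first] by concavity
    of G. The second derivative of t G(t) decreases strictly, whence the rigidity of the H_(j+1)
    part. *)
Lemma curv_int_inequality : first + second + third <= rhs /\
  ((forall p, Sigma p -> 0 < mean_curv Om j.+1 p) -> first + second + third = rhs ->
   forall p, Sigma p -> hgt p = a).
Proof.
have cprim : cpos (primw m).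
  move=> t t0; apply/differentiable_continuous/derivable1_diffP.
  by case: (is_derive_primw m t0).
have [g1 g2] := jensen_remainder hgt_le (@is_derive_gfun R m) (@is_derive_gfun1 R m m0)
  gfun2_ge a0 ar (etrans (minkowski_id jn) aA).
have cN t : 0 < t -> t <= r -> c <= -1 * dwgt m t by rewrite mulN1r; exact: c_le.
have [p1 _] := jensen_remainder hgt_le (is_derive_Nprimw m) (is_derive_Nwgt m) cN b0 br bB.
rewrite (curv_intZ j _ cprim) in p1.
have := ler_wpM2l (ltW B0) (primw_concave m0 a0 b0); rewrite -first_termE => q2.
have gB : gfun m a * A = primw m a * B by rewrite /gfun aA; ring.
rewrite -/A -/second in g1 g2; rewrite -/B -/third in p1; rewrite gB in g1 g2.
have [h1 h2] := collect_jensen q2 g1 p1.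
rewrite shape_integralE; split=> // HH /h2 E; apply: g2 => //.
by move=> t t0 tr; exact: gfun2_decr.
Qed.

(** Both sides vanish: X^T = 0 on the right, and on the left the two means coincide with the
    constant support function. *)
Lemma sphere_equality s : 0 < s -> Sigma = esphere 0 s -> first + second + third = rhs.
Proof.
move=> s0 SE; have hs p : Sigma p -> hgt p = s /\ tangential Om p = 0.
  by move=> Sp; exact: sphere_normal s0 SE Sp.
have rhs0 : rhs = 0.
  rewrite /rhs (@eq_Rintegral _ _ _ mu Sigma (fun=> 0)).
    by rewrite /Rintegral integral0 mulr0.
  move=> p /set_mem Sp; have [_ ->] := hs _ Sp.
  by rewrite /newton_shape_form !mul0mx dotv0l mul0r.
have ids i : curv_int i (fun t => t) = s * curv_int i (fun=> 1).
  have c1 : cpos (fun=> 1 : R) by move=> t _; exact: cvg_cst.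
  rewrite -(curv_intZ i s c1); apply: eq_curv_int => p Sp.
  by have [-> _] := hs _ Sp; rewrite mulr1.
have sqs i : curv_int i (fun t => (t - s) ^+ 2) = 0.
  rewrite (@eq_curv_int _ _ (fun=> 0 * 1)).
    by rewrite curv_intZ ?mul0r// => t _; exact: cvg_cst.
  by move=> p Sp; have [-> _] := hs _ Sp; rewrite subrr expr0n mul0r.
have as_ : a = s.
  by rewrite /a /B -minkowski_id// ids -/A mulfK// gt_eqF.
have bs : b = s by rewrite /b /D ids -/B mulfK// gt_eqF.
by rewrite first_termE /second /third as_ bs !sqs subrr !mulr0 !addr0 rhs0.
Qed.

End main_inequality.
End curvature_integrals.

Theorem theorem4p6 (R : realType) (n k : nat)
    (Om : set 'rV[R]_n.+1)
    (mu : {measure set (borelType 'rV[R]_n.+1) -> \bar R}) (r m : R) :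
  (1 <= n)%N -> (1 <= k <= n)%N ->
  Om !=set0 -> open Om -> convex_set Om -> bounded_set Om ->
  smooth_hypersurface (boundary Om) ->
  area_measure (boundary Om) mu ->
  circumscribed (boundary Om) 0 r ->
  let Sigma := boundary Om in
  let I := Icurv Om mu in
  let K := k%:Z in
  let first := (I K) `^ (m - 1) *
    ((I (K - 1) ^+ 2 - I K * I (K - 2)) / ((I K) `^ m + (I (K - 1)) `^ m)) in
  let second := (2 + (2 - m) * r `^ m) / (2 * (1 + r `^ m) ^+ 2) *
    delta2 Om mu k (I (K - 1) / I K) ^+ 2 in
  let third := m / (2 * (1 + r `^ m) ^+ 2 * r `^ (1 - m)) *
    delta2 Om mu k.-1 (I (K - 2) / I (K - 1)) ^+ 2 in
  let rhs := (k%:R * ('C(n, k))%:R)^-1 *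
    (\int[mu]_(p in Sigma)
       (newton_shape_form Om k.-1 p (tangential Om p) /
        (1 + (support_fun Om p) `^ m))) in
  let centered_sphere := exists2 s : R, 0 < s & Sigma = esphere 0 s in
  [/\ 0 < m <= 1 -> first + second + third <= rhs,
      1 < m <= 2 -> first + second <= rhs &
      (forall p, Sigma p -> 0 < mean_curv Om k p) ->
        (0 < m <= 1 -> (first + second + third = rhs <-> centered_sphere)) /\
        (1 < m <= 2 -> (first + second = rhs <-> centered_sphere))].
Proof.
move=> _ /andP[k0 kn] On openOm convOm bndOm smOm area circ.
(* With k = j + 1, the numbers I_k, I_(k-1) and I_(k-2) are the integrals of H_(j+1), H_j and u H_j;
   the last form includes I_{-1}. *)
case: k k0 kn => // j _ jn Sigma I K.
have Om0 : Om 0 by exact: circumcenter_in circ.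
have hr p : Sigma p -> height Om p <= r.
  move=> Sp; apply: le_trans (hgt_le_enorm openOm convOm bndOm Om0 smOm Sp) _.
  by rewrite -[p]subr0; apply: circ.1.
have KE : K = Posz j.+1 by [].
have IA : I K = curv_int Om mu j.+1 (fun=> 1) by rewrite /I Icurv_nat.
have IB : I (K - 1) = curv_int Om mu j (fun=> 1).
  by rewrite KE /I intS addrAC subrr add0r Icurv_nat.
have ID : I (K - 2) = curv_int Om mu j (fun t => t).
  by rewrite curv_int_id ?(ltnW jn).
move=> first second third rhs sph.
have A0 : 0 < curv_int Om mu j.+1 (fun=> 1) by exact: (curv_int_pos openOm convOm bndOm Om0 smOm area hr jn).2.
have B0 : 0 < curv_int Om mu j (fun=> 1) by exact: (curv_int_pos openOm convOm bndOm Om0 smOm area hr (ltnW jn)).2.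
have a0 := divr_gt0 B0 A0.
have coefE : (2 + (2 - m) * r `^ m) / (2 * (1 + r `^ m) ^+ 2) = gfun2 m r / 2.
  by rewrite /gfun2 [X in _ / X]mulrC invfM mulrA.
have firstE : first = curv_int Om mu j.+1 (fun=> 1) `^ (m - 1) *
    ((curv_int Om mu j (fun=> 1) ^+ 2 - curv_int Om mu j.+1 (fun=> 1) * curv_int Om mu j (fun t => t)) /
     (curv_int Om mu j.+1 (fun=> 1) `^ m + curv_int Om mu j (fun=> 1) `^ m)).
  by rewrite /first IA IB ID.
have secondE : second = gfun2 m r / 2 * curv_int Om mu j.+1
    (fun t => (t - curv_int Om mu j (fun=> 1) / curv_int Om mu j.+1 (fun=> 1)) ^+ 2).
  rewrite /second IA IB (delta2_sqr openOm convOm bndOm Om0 smOm).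
  by rewrite coefE.
(* Both ranges of [m] at once: [c] is a lower bound of -G'' on (0, r], and half of it is the
   coefficient of the third term. *)
have core c d : d = c / 2 -> 0 < m -> m <= 2 -> (forall t, 0 < t -> t <= r -> c <= - dwgt m t) ->
    first + second + d * delta2 Om mu j (I (K - 2) / I (K - 1)) ^+ 2 <= rhs /\
    ((forall p, Sigma p -> 0 < mean_curv Om j.+1 p) ->
     (first + second + d * delta2 Om mu j (I (K - 2) / I (K - 1)) ^+ 2 = rhs <-> sph)).
  move=> -> m0 m2 cl.
  have [h1 h2] := curv_int_inequality openOm convOm bndOm Om0 smOm area m0 m2 jn hr cl.
  rewrite firstE secondE IB ID (delta2_sqr openOm convOm bndOm Om0 smOm).
  split; first exact: h1.
  move=> HH; split => [/(h2 HH) ha|[s s0 Se]].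
    have Se := sphere_of_hgt openOm convOm bndOm Om0 smOm a0 On ha.
    rewrite /sph.
    exists (curv_int Om mu j (fun=> 1) / curv_int Om mu j.+1 (fun=> 1)); first exact: a0.
    exact: Se.
  exact: (sphere_equality openOm convOm bndOm Om0 smOm area c m0 jn hr s0 Se).
have [p Sp p0] := boundary_nonzero openOm bndOm On.
have r0 : 0 < r by exact: lt_le_trans (hgt_pos openOm convOm bndOm Om0 smOm Sp) (hr _ Sp).
have core1 : 0 < m <= 1 -> first + second + third <= rhs /\
    ((forall p, Sigma p -> 0 < mean_curv Om j.+1 p) -> (first + second + third = rhs <-> sph)).
  move=> /andP[m0 m1]; have m2 : m <= 2 by apply: le_trans m1 _; rewrite ler1n.
  apply: core m0 m2 (fun t => @dwgt_bound R m m0 t r m1).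
  by rewrite -[RHS]mulrA -invfM -[in LHS]mulrA [in LHS]mulrC [_ * 2]mulrC [RHS]mulrC.
have core2 : 1 < m <= 2 -> first + second <= rhs /\
    ((forall p, Sigma p -> 0 < mean_curv Om j.+1 p) -> (first + second = rhs <-> sph)).
  move=> /andP[m1 m2]; have m0 : 0 < m by exact: lt_trans m1.
  (* For m > 1 the bound is c = 0, and the third term drops out. *)
  have := core 0 0 (esym (mul0r _)) m0 m2 (fun t t0 _ => dwgt_le0 m0 t0).
  by rewrite mul0r addr0.
split; [by move=> /core1[]|by move=> /core2[]|].
by move=> HH; split; [move=> /core1[_]; apply|move=> /core2[_]; apply].
Qed.
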